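(* Let $\gamma_1,\gamma_2\in\{-1,1\}$ and $\alpha\in\mathbb{R}\setminus\{0\}$ with $\gamma_1\gamma_2-\alpha^2\ne 0$. Let $s>1$ and $\sigma_0>0$. Then there exist $T_0>0$ and $C>0$ such that for all initial data $\mathbf{u}_0=(r_{10}^*,v_{10}^*,r_{20}^*,v_{20}^* )\in G^s_{2\sigma_0}$ with $\|\mathbf{u}_0\|_{G^s_{2\sigma_0}}\le C$, the multiphase Whitham modulation equations $\partial_T\mathbf{u}^*=\mathbf{M}(\mathbf{u}^* )\,\partial_X\mathbf{u}^*$, with $\mathbf{M}$ the $4\times4$ matrix function given in the context, have a unique solution $$\mathbf{u}^*\in C\big([0,T_0],G^s_{\sigma_0}\big)\quad\text{with}\quad \mathbf{u}^*(X,T)\big|_{T=0}=\mathbf{u}_0(X).$$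
   Context: For $s,\sigma\ge 0$ the Gevrey space $G^s_\sigma=G^s_\sigma(\mathbb{R})$ consists of the (scalar- or vector-valued) functions on $\mathbb{R}$ with finite norm $\|\mathbf{u}\|_{G^s_\sigma}:=\big\|e^{\sigma(|\xi|+1)}(1+|\xi|^{2s})^{1/2}\,\widehat{\mathbf{u}}(\xi)\big\|_{L^2}$, where $\widehat{\mathbf{u}}$ is the Fourier transform of $\mathbf{u}$ in $X$. For $\mathbf{u}=(r_1,v_1,r_2,v_2)$, $$\mathbf{M}(\mathbf{u})=\begin{bmatrix}-2v_1&-1&0&0\\ 2\gamma_1e^{2r_1}&-2v_1&2\alpha e^{2r_2}&0\\ 0&0&-2v_2&-1\\ 2\alpha e^{2r_1}&0&2\gamma_2e^{2r_2}&-2v_2\end{bmatrix}.$$ *)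

(* Defs.v *)
From HB Require Import structures.
From mathcomp Require Import all_boot all_order all_algebra.
From mathcomp Require Import complex.
From mathcomp Require Import all_classical all_reals all_analysis.

Set Implicit Arguments.
Unset Strict Implicit.
Unset Printing Implicit Defensive.

Import Order.TTheory GRing.Theory Num.Theory.
Import numFieldNormedType.Exports.

Local Open Scope classical_set_scope.
Local Open Scope ring_scope.
Local Open Scope complex_scope.

Section FourierTransform.
Context {R : realType}.
Local Notation mu := (@lebesgue_measure R).

(* Convention: \hat f(xi) = \int f(x) e^{-i xi x} dx. *)
Definition fourier_integral (f : R -> R) (xi : R) : R[i] :=
  (\int[mu]_(x in setT) (f x * cos (xi * x)))
  -i* (\int[mu]_(x in setT) (f x * sin (xi * x))).

Definition L2dist (f g : R -> R) : \bar R :=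
  'N[mu]_2%:E [(fun x => (f x - g x)%:E)]%E.

Definition L2distC (f g : R -> R[i]) : \bar R :=
  'N[mu]_2%:E [(fun x => (Normc.normc (f x - g x))%:E)]%E.

(* The transform on L^2 is the continuous extension of [fourier_integral]
   from L^1 \cap L^2.  By Plancherel's theorem every f in L^2 has such a g,
   and g is unique up to a null set. *)
Definition is_fourier (f : R -> R) (g : R -> R[i]) : Prop :=
  [/\ f \in Lfun mu 2%:E,
      (fun xi => complex.Re (g xi)) \in Lfun mu 2%:E,
      (fun xi => complex.Im (g xi)) \in Lfun mu 2%:E &
      exists f_ : nat -> R -> R,
        [/\ forall n, f_ n \in Lfun mu 1%:E /\ f_ n \in Lfun mu 2%:E,
            L2dist (f_ n) f @[n --> \oo] --> 0%E &
            L2distC (fourier_integral (f_ n)) g @[n --> \oo] --> 0%E]].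

Definition fourier (f : R -> R) : R -> R[i] :=
  xget (fun=> 0) [set g | is_fourier f g].

End FourierTransform.

Section Gevrey.
Context {R : realType} {n : nat}.
Local Notation mu := (@lebesgue_measure R).
Implicit Type u : R -> 'cV[R]_n.

Definition gevrey_weight (s sigma xi : R) : R :=
  expR (sigma * (`|xi| + 1)) * Num.sqrt (1 + `|xi| `^ (2 * s)).

Definition component u (i : 'I_n) : R -> R := fun x => u x i 0.

(* Euclidean norm in C^n of \hat u(xi); the norm `|_| of the library on
   matrices is the sup norm. *)
Definition fourier_modulus u (xi : R) : R :=
  Num.sqrt (\sum_(i < n) Normc.normc (fourier (component u i) xi) ^+ 2).

Definition gevrey_norm (s sigma : R) u : \bar R :=
  'N[mu]_2%:E [(fun xi => (gevrey_weight s sigma xi * fourier_modulus u xi)%:E)]%E.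

(* Elements are functions, not classes modulo null sets.  The first conjunct
   ensures that [fourier] is not the default value of [xget]. *)
Definition gevrey (s sigma : R) : set (R -> 'cV[R]_n) :=
  [set u | (forall i, exists g, is_fourier (component u i) g) /\
           (gevrey_norm s sigma u < +oo)%E].

(* u \in C([0, T0], G^s_sigma), for u a function of time, then space *)
Definition gevrey_continuous (s sigma T0 : R) (u : R -> R -> 'cV[R]_n) : Prop :=
  forall T : R, T \in `[0, T0] ->
    gevrey s sigma (u T) /\
    gevrey_norm s sigma (u T' \- u T) @[T' --> within `[0, T0] (nbhs T)]
      --> 0%E.

End Gevrey.

Section Whitham.
Context {R : realType}.

Definition whitham_matrix (gamma1 gamma2 alpha : R) (u : 'cV[R]_4) : 'M[R]_4 :=
  let r1 := u (inord 0) 0 in let v1 := u (inord 1) 0 in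
  let r2 := u (inord 2) 0 in let v2 := u (inord 3) 0 in
  \matrix_(i < 4, j < 4)
    nth 0 (nth [::]
      [:: [:: - 2 * v1; - 1; 0; 0];
          [:: 2 * gamma1 * expR (2 * r1); - 2 * v1;
              2 * alpha * expR (2 * r2); 0];
          [:: 0; 0; - 2 * v2; - 1];
          [:: 2 * alpha * expR (2 * r1); 0;
              2 * gamma2 * expR (2 * r2); - 2 * v2]] i) j.

(* The system holds pointwise, with one-sided time derivatives at 0 and T0.
   Since u T is differentiable in space, it is the continuous representative
   of its class in G^s_sigma; the datum u0 is only given as a class, whence
   the almost everywhere equality. *)
Definition whitham_solution (gamma1 gamma2 alpha s sigma T0 : R)
    (u0 : R -> 'cV[R]_4) (u : R -> R -> 'cV[R]_4) : Prop :=
  [/\ gevrey_continuous s sigma T0 u,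
      forall T X : R, T \in `[0, T0] ->
        derivable (u T) X 1 /\
        (T' - T)^-1 *: (u T' X - u T X) @[T' --> within `[0, T0] T^']
          --> whitham_matrix gamma1 gamma2 alpha (u T X) *m 'D_1 (u T) X &
      {ae @lebesgue_measure R, forall X, u 0 X = u0 X}].

End Whitham.

(* Main.v *)
(* A function in a Gevrey space of radius [2 sigma0] has an exponentially decaying
   transform, hence agrees almost everywhere with an analytic function whose Taylor
   coefficients f_n = f^(n) / n! satisfy geometric bounds c rho^-n, both pointwise
   and in L^2.  Conversely, L^2 bounds of this kind give exponential decay of the
   transform, by Plancherel's inequality for iterated difference quotients.

   Existence.  With P_j = e^{2 r_j} - 1 as additional unknowns the system is
   quadratic, and it is solved at each point X by a power series in T whose
   coefficients are dominated by m(X) times a Cauchy-Kovalevskaya majorant.  As the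
   amplitude m is in L^2, the solution and its increments in T satisfy the L^2
   bounds above with a radius larger than sigma0.

   Uniqueness.  If the Taylor coefficients of the difference of two solutions are
   d_n, trading k derivatives for k time integrations gives
   |d_n| <= b (L r (T - t0))^k C(n+k, k) r^n for all k, so that d vanishes on a time
   interval whose length does not depend on t0. *)
From HB Require Import structures.
From mathcomp Require Import all_boot all_order all_algebra.
From mathcomp Require Import complex ring lra zify.
From mathcomp Require Import all_classical all_reals all_analysis.
From mathcomp Require Import measurable_realfun.
Require Import Defs.
Import Order.TTheory GRing.Theory Num.Theory.
Import numFieldNormedType.Exports.
Set Implicit Arguments.
Unset Strict Implicit.
Unset Printing Implicit Defensive.
Local Open Scope classical_set_scope.
Local Open Scope ring_scope.

(** At u = 0 the squared characteristic speeds are minus the eigenvalues of the symmetric matrix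
    with entries 2 gamma_j and 2 alpha, so the system can be elliptic and no energy estimate
    recovers the derivative lost on the right-hand side. The loss is paid for by the radius of
    analyticity, whence a datum of radius 2 sigma0 for a solution of radius sigma0. The obstacle is
    that Gevrey norms are L^2 norms of the transform, while majorants work pointwise. They are
    joined by an envelope: a single L^2 function m that dominates all Taylor coefficients of the
    datum at once, at the price of a smaller radius. Each later bound is linear in m(X), hence is an
    L^2 bound again. Smallness of the datum keeps m below a fixed constant, so that quadratic terms
    never exceed linear ones. The transform is only an L^2 limit, so that no formula for the
    transform of a derivative is at hand; finite differences have exact transforms and take its
    place. In the uniqueness part they also stand in for Taylor coefficients, since the equation
    holds only pointwise in X. *)

Lemma le_of_eq (R : numDomainType) (x y : R) : x = y -> x <= y.
Proof. by move=> ->. Qed.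

(** * Square-integrable functions *)

Section SquareIntegrable.
Context {R : realType}.
Local Notation mu := (@lebesgue_measure R).
Implicit Types f g h : R -> R.

(** The squared norm, as an extended real: estimates then need neither square roots nor
    integrability side conditions. [Lnorm2_le] and [Lnorm2_cvg0] translate back to the norms of the
    statement. *)
Definition sqint f : \bar R := (\int[mu]_x ((f x) ^+ 2)%:E)%E.
Definition isL2 f := measurable_fun setT f /\ (sqint f < +oo)%E.

Lemma sqint_ge0 f : (0 <= sqint f)%E.
Proof. by apply: integral_ge0 => x _; rewrite lee_fin sqr_ge0. Qed.

Lemma measurable_sqr f : measurable_fun setT f ->
  measurable_fun setT (fun x => ((f x) ^+ 2)%:E).
Proof. by move=> mf; apply/measurable_EFinP; exact: measurable_funX. Qed.

Lemma le_sqint f g : measurable_fun setT f -> measurable_fun setT g ->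
  (forall x, `|f x| <= `|g x|) -> (sqint f <= sqint g)%E.
Proof.
move=> mf mg fg; apply: ge0_le_integral => //.
- by move=> x _; rewrite lee_fin sqr_ge0.
- exact: measurable_sqr.
- exact: measurable_sqr.
- move=> x _; rewrite lee_fin -(real_normK (num_real (f x))) -[leRHS]real_normK ?num_real//.
  by rewrite ler_sqr ?nnegrE.
Qed.

Lemma sqintZ k f : measurable_fun setT f ->
  sqint (fun x => k * f x) = ((k ^+ 2)%:E * sqint f)%E.
Proof.
move=> mf; rewrite /sqint -ge0_integralZl//.
- by apply: eq_integral => x _; rewrite exprMn EFinM.
- exact: measurable_sqr.
- by move=> x _; rewrite lee_fin sqr_ge0.
- by rewrite lee_fin sqr_ge0.
Qed.

Lemma sqintN f : sqint (fun x => - f x) = sqint f.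
Proof. by apply: eq_integral => x _; rewrite sqrrN. Qed.

Lemma sqintD f g : measurable_fun setT f -> measurable_fun setT g ->
  (sqint (fun x => f x + g x)%R <= 2%:E * sqint f + 2%:E * sqint g)%E.
Proof.
move=> mf mg; rewrite /sqint -!ge0_integralZl//;
  try by [exact: measurable_sqr|move=> x _; rewrite lee_fin sqr_ge0].
rewrite -ge0_integralD//; last first.
- by apply: measurable_funeM; exact: measurable_sqr.
- by move=> x _; rewrite -EFinM lee_fin mulr_ge0// sqr_ge0.
- by apply: measurable_funeM; exact: measurable_sqr.
- by move=> x _; rewrite -EFinM lee_fin mulr_ge0// sqr_ge0.
apply: ge0_le_integral => //.
- by move=> x _; rewrite lee_fin sqr_ge0.
- by apply: measurable_sqr; exact: measurable_funD.
- by apply: emeasurable_funD; apply: measurable_funeM; exact: measurable_sqr.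
- by move=> x _; rewrite -!EFinM -EFinD lee_fin; have := sqr_ge0 (f x - g x); lra.
Qed.

Lemma sqintB f g : measurable_fun setT f -> measurable_fun setT g ->
  (sqint (fun x => f x - g x)%R <= 2%:E * sqint f + 2%:E * sqint g)%E.
Proof.
move=> mf mg; rewrite -[in leRHS](sqintN g).
by apply: sqintD => //; exact: measurableT_comp.
Qed.

Lemma isL2D f g : isL2 f -> isL2 g -> isL2 (fun x => f x + g x).
Proof.
move=> [mf f2] [mg g2]; split; first exact: measurable_funD.
by apply: le_lt_trans (sqintD mf mg) _; rewrite lte_add_pinfty// lte_mul_pinfty// sqint_ge0.
Qed.

Lemma isL2Z k f : isL2 f -> isL2 (fun x => k * f x).
Proof.
move=> [mf f2]; split; first exact: measurable_funM.
by rewrite sqintZ// lte_mul_pinfty// lee_fin sqr_ge0.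
Qed.

Lemma isL2N f : isL2 f -> isL2 (fun x => - f x).
Proof. by move=> /(isL2Z (-1)); under eq_fun do rewrite mulN1r. Qed.

Lemma isL2B f g : isL2 f -> isL2 g -> isL2 (fun x => f x - g x).
Proof. by move=> Lf /isL2N; exact: isL2D. Qed.

Lemma isL2_le f g : measurable_fun setT f -> isL2 g ->
  (forall x, `|f x| <= `|g x|) -> isL2 f.
Proof.
move=> mf [mg g2] fg; split => //; exact: le_lt_trans (le_sqint mf mg fg) g2.
Qed.

Lemma isL2_integrable f : isL2 f -> mu.-integrable setT (EFin \o (fun x => f x ^+ 2)).
Proof.
move=> [mf f2]; apply/integrableP; split; first exact: measurable_sqr.
by under eq_integral do rewrite gee0_abs ?lee_fin ?sqr_ge0//.
Qed.

Lemma isL2_mul f g : isL2 f -> isL2 g ->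
  mu.-integrable setT (EFin \o (fun x => f x * g x)).
Proof.
move=> Lf Lg; have [mf _] := Lf; have [mg _] := Lg.
apply: (le_integrable measurableT _ _
  (integrableD measurableT (isL2_integrable Lf) (isL2_integrable Lg))) => /=.
  by apply/measurable_EFinP; exact: measurable_funM.
move=> x _; rewrite !lee_fin normrM [leRHS]ger0_norm ?addr_ge0 ?sqr_ge0//.
have := sqr_ge0 (`|f x| - `|g x|); have := sqr_ge0 (`|f x| + `|g x|).
by rewrite -(real_normK (num_real (f x))) -(real_normK (num_real (g x))); nra.
Qed.

Lemma LfunE f : f \in Lfun mu 2%:E <-> isL2 f.
Proof.
split.
- move=> fL; have := Lfun2_integrable_sqr fL => /integrableP[_ h]; split.
    by move: fL; rewrite inE => /andP[]; rewrite inE.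
  by move: h; under eq_integral do rewrite /= ger0_norm ?sqr_ge0//.
- move=> [mf f2]; rewrite inE; apply/andP; split; rewrite inE//=.
  rewrite /finite_norm unlock poweR_lty//.
  by under eq_integral do rewrite /= powR_mulrn// real_normK ?num_real//.
Qed.

Lemma Lnorm2_sqr f : ('N[mu]_2%:E [(fun x => (f x)%:E)] `^ 2 = sqint f)%E.
Proof.
rewrite powR_Lnorm ?pnatr_eq0//; apply: eq_integral => x _.
by rewrite abse_EFin poweR_EFin powR_mulrn// real_normK ?num_real.
Qed.

Lemma Lnorm2_le f (c : R) : 0 <= c ->
  ('N[mu]_2%:E [(fun x => (f x)%:E)] <= c%:E)%E = (sqint f <= (c ^+ 2)%:E)%E.
Proof.
move=> c0; rewrite -Lnorm2_sqr; have := Lnorm_ge0 mu 2%:E (fun x => (f x)%:E).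
case: ('N[mu]_2%:E [_])%E => [r| |] => // r0; last by rewrite /= pnatr_eq0.
by rewrite poweR_EFin powR_mulrn// !lee_fin ler_sqr.
Qed.

Lemma Lnorm2_cvg0 (T : Type) (F : set_system T) (FF : Filter F) (f_ : T -> R -> R) :
  ('N[mu]_2%:E [(fun x => (f_ t x)%:E)] @[t --> F] --> 0)%E <->
  (forall e, 0 < e -> \forall t \near F, (sqint (f_ t) <= e%:E)%E).
Proof.
split.
- move=> /fine_cvgP[h1 /cvgrPdist_le h2] e e0.
  have s0 : 0 < Num.sqrt e by rewrite sqrtr_gt0.
  near=> t.
  rewrite -(sqr_sqrtr (ltW e0)) -Lnorm2_le ?sqrtr_ge0//.
  have h1t : ('N[mu]_2%:E [(fun x => (f_ t x)%:E)])%E \is a fin_num by near: t.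
  have h2t : `|0 - fine ('N[mu]_2%:E [(fun x => (f_ t x)%:E)])%E| <= Num.sqrt e.
    by near: t; apply: h2.
  rewrite -(fineK h1t) lee_fin; apply: le_trans h2t.
  by rewrite sub0r normrN ler_norm.
- move=> h; apply/fine_cvgP; split.
    have := h _ ltr01; apply: filterS => t ht0.
    have ht : ('N[mu]_2%:E [(fun x => (f_ t x)%:E)] <= 1%:E)%E.
      by rewrite Lnorm2_le// expr1n.
    by rewrite ge0_fin_numE ?Lnorm_ge0// (le_lt_trans ht)// ltry.
  apply/cvgrPdist_le => e e0; have := h _ (exprn_gt0 2 e0).
  apply: filterS => t; rewrite -Lnorm2_le ?(ltW e0)// => ht.
  rewrite sub0r normrN ger0_norm ?fine_ge0 ?Lnorm_ge0//.
  by rewrite -lee_fin fineK// ge0_fin_numE ?Lnorm_ge0// (le_lt_trans ht)// ltry.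
Unshelve. all: by end_near. Qed.

End SquareIntegrable.

(** * Derivatives of real functions *)

Section PointwiseDerivatives.
Context {R : realType}.
Implicit Types (f g : R -> R) (x : R).

Lemma ider_cst c x : is_derive x 1 (fun=> c : R) 0.
Proof. exact: is_derive_cst. Qed.

Lemma ider_id x : is_derive x 1 (fun y : R => y) 1.
Proof. exact: is_derive_id. Qed.

Lemma iderD f g x df dg : is_derive x 1 f df -> is_derive x 1 g dg ->
  is_derive x 1 (fun y => f y + g y) (df + dg).
Proof. by move=> hf hg; exact: (@is_deriveD _ _ _ f g). Qed.

Lemma iderN f x df : is_derive x 1 f df -> is_derive x 1 (fun y => - f y) (- df).
Proof. by move=> hf; exact: (@is_deriveN _ _ _ f). Qed.

Lemma iderB f g x df dg : is_derive x 1 f df -> is_derive x 1 g dg ->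
  is_derive x 1 (fun y => f y - g y) (df - dg).
Proof. by move=> hf hg; exact: (@is_deriveB _ _ _ f g). Qed.

Lemma iderM f g x df dg : is_derive x 1 f df -> is_derive x 1 g dg ->
  is_derive x 1 (fun y => f y * g y) (df * g x + f x * dg).
Proof.
move=> hf hg; apply: (is_derive_eq (@is_deriveM _ _ f g _ _ _ _ hf hg)).
by rewrite addrC /GRing.scale/= mulrC.
Qed.

Lemma ider_comp f g x df dg : is_derive (g x) 1 f df -> is_derive x 1 g dg ->
  is_derive x 1 (fun y => f (g y)) (df * dg).
Proof. exact: is_derive1_comp. Qed.

Lemma ider_expR f x df : is_derive x 1 f df ->
  is_derive x 1 (fun y => expR (f y)) (expR (f x) * df).
Proof. by move=> hf; exact: ider_comp. Qed.

Lemma ider_cos f x df : is_derive x 1 f df ->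
  is_derive x 1 (fun y => cos (f y)) (- sin (f x) * df).
Proof. by move=> hf; exact: ider_comp. Qed.

Lemma ider_sin f x df : is_derive x 1 f df ->
  is_derive x 1 (fun y => sin (f y)) (cos (f x) * df).
Proof. by move=> hf; exact: ider_comp. Qed.

Lemma ider_atan f x df : is_derive x 1 f df ->
  is_derive x 1 (fun y => atan (f y)) ((1 + f x ^+ 2)^-1 * df).
Proof. by move=> hf; exact: ider_comp. Qed.

Lemma ider_continuous f x df : is_derive x 1 f df -> {for x, continuous f}.
Proof.
by move=> [hf _]; apply: differentiable_continuous; apply/derivable1_diffP.
Qed.

Lemma ider_derivable f x df : is_derive x 1 f df -> derivable f x 1.
Proof. by case. Qed.

Lemma ider_derive1 f x df : is_derive x 1 f df -> derive1 f x = df.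
Proof. by move=> [_ <-]; rewrite derive1E. Qed.

End PointwiseDerivatives.

(** Synthesises the derivative of an explicit expression. After [eapply is_derive_eq] the rules
    above fill in the unknown derivative, and the remaining equation is left to [ring] or
    [field]. *)
Ltac ider := repeat first [exact: ider_cst | exact: ider_id | apply: ider_expR
  | apply: ider_cos | apply: ider_sin | apply: ider_atan
  | apply: iderB | apply: iderD | apply: iderN | apply: iderM].

(** * Fatou's lemma for uniformly bounded integrals *)

Section LimitTheorems.
Context d (T : measurableType d) (R : realType) (mu : {measure set T -> \bar R}).

(** Upper bounds on integrals pass to pointwise limits without any dominating function. Plancherel's
    inequality, the moment bounds and the exponential bounds are all obtained for regularised
    integrands and pass to the limit in this way. *)
Lemma fatou_le (g_ : nat -> T -> \bar R) (g : T -> \bar R) (c : \bar R) :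
  (forall n, measurable_fun setT (g_ n)) -> (forall n x, 0 <= g_ n x)%E ->
  (forall x, g_ n x @[n --> \oo] --> g x) ->
  (forall n, \int[mu]_x g_ n x <= c)%E -> (\int[mu]_x g x <= c)%E.
Proof.
move=> mg g0 gg gc.
have -> : (\int[mu]_x g x = \int[mu]_x limn_einf (g_ ^~ x))%E.
  apply: eq_integral => x _; have gx := gg x.
  have cvx : cvgn (g_ ^~ x) by apply/cvg_ex; exists (g x).
  by rewrite is_cvg_limn_einfE//; apply/esym/cvg_lim.
apply: le_trans (fatou mu measurableT mg (fun n x _ => g0 n x)) _.
rewrite limn_einf_lim; apply: lime_le; first exact: is_cvg_einfs.
apply: nearW => n; apply: le_trans (gc n); apply: ereal_inf_lbound.
by exists n => /=.
Qed.

End LimitTheorems.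

(** * The Fourier transform of square-integrable functions *)

Section PoissonKernel.
Context {R : realType}.
Local Notation mu := (@lebesgue_measure R).
Implicit Types (a e x y : R).

Lemma continuous_decay e : continuous (fun x : R => expR (- (e * `|x|))).
Proof.
move=> x; apply: (@continuous_comp _ _ _ (fun x : R => - (e * `|x|))).
  by apply: cvgN; apply: cvgM; [exact: cvg_cst|exact: norm_continuous].
exact: continuous_expR.
Qed.

Lemma cvg_expRNM e : 0 < e -> expR (- (e * x)) @[x --> +oo] --> 0.
Proof.
move=> e0; apply: (cvg_comp _ _ _ (@cvgr_expR R)).
exact: gt0_cvgMry.
Qed.

(** Adding 1 to the cosine makes the integrand nonnegative, so that the fundamental theorem of
    calculus for nonnegative functions on a half-line applies. The cosine transform of e^{-e|x|}
    itself follows by subtracting the case a = 0. *)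
Lemma integral_expRM_cos1 e a : 0 < e ->
  (\int[mu]_x (expR (- (e * `|x|)) * (1 + cos (a * x)))%:E =
   (2 * (e^-1 + e / (e ^+ 2 + a ^+ 2)))%:E)%E.
Proof.
move=> e0; have d0 : 0 < e ^+ 2 + a ^+ 2 by rewrite ltr_wpDr ?sqr_ge0// exprn_gt0.
have c1 : continuous (fun x : R => 1 + cos (a * x)).
  by move=> x; apply: ider_continuous; ider.
rewrite ge0_symfun_integralT; last 3 first.
- by move=> x; rewrite mulr_ge0 ?expR_ge0//; have := cos_geN1 (a * x); lra.
- by move=> x; apply: cvgM; [exact: continuous_decay|exact: c1].
- by move=> x /=; rewrite normrN mulrN cosN.
rewrite -set_itvcy.
(* An antiderivative on the half-line of e^{-e x} (1 + cos (a x)), vanishing at infinity. *)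
pose F x := expR (- (e * x)) * (- e^-1 + (a * sin (a * x) - e * cos (a * x)) / (e ^+ 2 + a ^+ 2)).
have dF x : is_derive x 1 F (expR (- (e * x)) * (1 + cos (a * x))).
  eapply is_derive_eq; [by rewrite /F; ider|].
  by rewrite /GRing.scale/=; field; rewrite !gt_eqF.
have cF x : {for x, continuous F} by apply: ider_continuous.
have -> : (\int[mu]_(x in `[0%R, +oo[) (expR (- (e * `|x|)) * (1 + cos (a * x)))%:E =
    \int[mu]_(x in `[0%R, +oo[) (expR (- (e * x)) * (1 + cos (a * x)))%:E)%E.
  by apply: eq_integral => x; rewrite inE/= in_itv/= andbT => x0; rewrite ger0_norm.
rewrite (@ge0_continuous_FTC2y _ _ F _ 0).
- rewrite -EFinB -EFinM; congr EFin; rewrite /F !mulr0 oppr0 expR0 sin0 cos0.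
  by field; rewrite !gt_eqF.
- by move=> x _; rewrite mulr_ge0 ?expR_ge0//; have := cos_geN1 (a * x); lra.
- apply: continuous_subspaceT => x.
  by apply: (@ider_continuous _ (fun x : R => expR (- (e * x)) * (1 + cos (a * x)))); ider.
- pose K := e^-1 + (`|a| + e) / (e ^+ 2 + a ^+ 2).
  have FK x : `|F x| <= expR (- (e * x)) * K.
    rewrite /F normrM ger0_norm ?expR_ge0// ler_wpM2l ?expR_ge0//.
    rewrite (le_trans (ler_normD _ _))// normrN ger0_norm ?invr_ge0 ?(ltW e0)// lerD2l.
    rewrite normrM [X in _ * X <= _]ger0_norm ?invr_ge0 ?(ltW d0)// ler_pM2r ?invr_gt0//.
    rewrite (le_trans (ler_normB _ _))// !normrM (ger0_norm (ltW e0)).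
    by rewrite lerD// ler_piMr ?(ltW e0)// ler_norml ?cos_geN1 ?cos_le1 ?sin_geN1 ?sin_le1.
  apply/norm_cvg0P; apply: (@squeeze_cvgr _ _ _ _ (fun=> 0) (fun x => expR (- (e * x)) * K)).
  + by apply: nearW => x; rewrite normr_ge0 FK.
  + exact: cvg_cst.
  + rewrite -[X in _ --> X](mul0r K); apply: cvgM; last exact: cvg_cst.
    exact: cvg_expRNM.
- by move=> x _; apply: ider_derivable (dF x).
- exact/cvg_at_right_filter/cF.
- by move=> x _; apply: ider_derive1.
Qed.

Lemma integral_decay e : 0 < e ->
  (\int[mu]_x (expR (- (e * `|x|)))%:E = (2 / e)%:E)%E.
Proof.
move=> e0; have := integral_expRM_cos1 0 e0.
have -> : (fun x : R => (expR (- (e * `|x|)) * (1 + cos (0 * x)))%:E) =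
    (fun x : R => 2%:E * (expR (- (e * `|x|)))%:E)%E.
  by apply/funext => x; rewrite mul0r cos0 -EFinM mulrC.
rewrite ge0_integralZl//; last first.
  apply/measurable_EFinP; apply: (@continuous_measurable_fun _ _ (fun x : R => _)).
exact: continuous_decay.
move=> /(congr1 (fun z => 2^-1%:E * z)%E); rewrite muleA -EFinM mulVf// mul1e => ->.
by rewrite -EFinM; congr EFin; field; rewrite gt_eqF.
Qed.

Lemma integrable_decay e : 0 < e ->
  mu.-integrable setT (EFin \o (fun x : R => expR (- (e * `|x|)))).
Proof.
move=> e0; apply/integrableP; split.
  by apply/measurable_EFinP; apply: continuous_measurable_fun; exact: continuous_decay.
under eq_integral do rewrite /= ger0_norm ?expR_ge0//.
by rewrite integral_decay// ltry.
Qed.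

Lemma integral_decay_cos e a : 0 < e ->
  \int[mu]_x (expR (- (e * `|x|)) * cos (a * x)) = 2 * e / (e ^+ 2 + a ^+ 2).
Proof.
move=> e0; have d0 : 0 < e ^+ 2 + a ^+ 2 by rewrite ltr_wpDr ?sqr_ge0// exprn_gt0.
have mc : measurable_fun setT (fun x : R => cos (a * x)).
  by apply: continuous_measurable_fun => x; apply: ider_continuous; ider.
have ic : mu.-integrable setT (EFin \o (fun x : R => expR (- (e * `|x|)) * cos (a * x))).
  apply: (le_integrable measurableT _ _ (integrable_decay e0)) => /=.
    apply/measurable_EFinP; apply: measurable_funM => //.
    by apply: continuous_measurable_fun; exact: continuous_decay.
  move=> x _; rewrite lee_fin normrM ler_piMr// ler_norml cos_geN1 cos_le1//.
have := congr1 fine (integral_expRM_cos1 a e0).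
rewrite -/(Rintegral _ _ _)/=; under eq_Rintegral do rewrite mulrDr mulr1.
rewrite RintegralD ?integrable_decay// {1}/Rintegral integral_decay//=.
by move=> h; apply: (addrI (2 / e)); rewrite h; field; rewrite !gt_eqF.
Qed.

(** Translation preserves the length of the intervals ]a, b], and Lebesgue measure is determined by
    these lengths. *)
Lemma lebesgue_measureD y (A : set R) : measurable A ->
  pushforward mu ((fun x => x + y) : _ -> measurableTypeR R) A = mu A.
Proof.
have my : measurable_fun setT (fun x : measurableTypeR R => x + y : measurableTypeR R).
  by apply: measurable_funD.
move=> mA; apply/esym.
pose nu := [the measure _ _ of pushforward mu (fun x : measurableTypeR R => x + y : measurableTypeR R)].
apply: (@lebesgue_measure_unique _ (nu my)) => //= _ [[a b]] _ <-.
rewrite /pushforward/=.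
have -> : (fun x => x + y) @^-1` `]a, b] = `](a - y), (b - y)]%classic.
  by apply/seteqP; split => x /=; rewrite !in_itv/= ltrBlDr lerBrDr.
rewrite !lebesgue_measure_itv/= !lte_fin ltrD2r; congr (if _ then _ else _).
by rewrite -!EFinB; congr EFin; ring.
Qed.

Lemma integral_shift y (f : R -> \bar R) : measurable_fun setT f ->
  (forall x, 0 <= f x)%E -> (\int[mu]_x f (x + y)%R = \int[mu]_x f x)%E.
Proof.
move=> mf f0.
have my : measurable_fun setT (fun x : measurableTypeR R => x + y : measurableTypeR R).
  by apply: measurable_funD.
have := ge0_integral_pushforward my mu measurableT mf (fun x _ => f0 x).
rewrite preimage_setT /comp => <-.
by apply: eq_measure_integral => A mA _; exact: lebesgue_measureD.
Qed.

Lemma integral_cauchy_kernel e y : 0 < e ->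
  (\int[mu]_x (e / (e ^+ 2 + (x - y) ^+ 2))%:E = pi%:E)%E.
Proof.
move=> e0.
have d0 x : 0 < e ^+ 2 + x ^+ 2 by rewrite ltr_wpDr ?sqr_ge0// exprn_gt0.
have c1 : continuous (fun x : R => e / (e ^+ 2 + x ^+ 2)).
  move=> x; apply: cvgM; first exact: cvg_cst.
  apply: cvgV; first by rewrite gt_eqF.
  by apply: cvgD; [exact: cvg_cst|apply: exprn_continuous].
rewrite (integral_shift (- y) (f := fun x : R => (e / (e ^+ 2 + x ^+ 2))%:E)); last first.
- by move=> x; rewrite lee_fin divr_ge0 ?(ltW e0)// ltW.
- by apply/measurable_EFinP; apply: (@continuous_measurable_fun _ _ (fun x : R => _)).
rewrite ge0_symfun_integralT//; last 2 first.
- by move=> x; rewrite divr_ge0 ?(ltW e0)// ltW.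
- by move=> x /=; rewrite sqrrN.
rewrite -set_itvcy.
have dF x : is_derive x 1 (fun x : R => atan (e^-1 * x)) (e / (e ^+ 2 + x ^+ 2)).
  eapply is_derive_eq; [by ider|].
  rewrite /GRing.scale/=; field; rewrite !gt_eqF// ?d0//.
have cF x : {for x, continuous (fun x : R => atan (e^-1 * x))} by apply: ider_continuous.
rewrite (@ge0_continuous_FTC2y _ _ (fun x : R => atan (e^-1 * x)) _ (pi / 2)).
- by rewrite mulr0 atan0 -EFinB -EFinM; congr EFin; field.
- by move=> x _; rewrite divr_ge0 ?(ltW e0)// ltW.
- exact: continuous_subspaceT.
- apply: (cvg_comp _ _ _ (@cvgy_atan R)); apply: gt0_cvgMry; last exact: cvg_id.
  by rewrite invr_gt0.
- by move=> x _; apply: ider_derivable (dF x).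
- exact/cvg_at_right_filter/cF.
- by move=> x _; apply: ider_derive1.
Qed.

End PoissonKernel.

(** * Cosine and sine integrals, and Plancherel's inequality on L^1 and L^2 *)

Section FourierIntegral.
Context {R : realType}.
Local Notation mu := (@lebesgue_measure R).
Local Notation L1 f := (mu.-integrable setT (EFin \o f)).
Implicit Types (f g : R -> R) (k : R * R -> R) (e x y : R).

(** The integrand is dominated by M |g(x)| |f(y)|, a product of integrable functions, and Tonelli's
    theorem computes the integral of the latter. This is the integrability that Fubini's theorem
    asks for below. *)
Lemma integrable_prod_bounded f g k (M : R) : L1 f -> L1 g ->
  measurable_fun setT k -> (forall z, `|k z| <= M) ->
  (mu \x mu)%E.-integrable setT (fun z => (g z.1 * (f z.2 * k z))%:E).
Proof.
move=> f1 g1 mk kM.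
have [/measurable_EFinP mf _] := integrableP _ _ _ f1.
have [/measurable_EFinP mg _] := integrableP _ _ _ g1.
have mF : measurable_fun setT (fun z : R * R => (g z.1 * (f z.2 * k z))%:E).
  apply/measurable_EFinP; apply: measurable_funM; first exact: measurableT_comp.
  by apply: measurable_funM => //; exact: measurableT_comp.
apply/integrable12ltyP => //=.
have M0 : 0 <= M by apply: le_trans (kM (0, 0)).
have iM : mu.-integrable setT (fun x => (`|f x| * M)%:E).
  have := integrableZr measurableT M (integrable_norm f1).
  by apply: eq_integrable => // x _ /=; rewrite EFinM.
have mI : (\int[mu]_x (`|f x| * M)%:E < +oo)%E.
  by apply: integrable_lty.
have I0 : (0 <= \int[mu]_x (`|f x| * M)%:E)%E.
  by apply: integral_ge0 => x _; rewrite lee_fin mulr_ge0.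
apply: (@le_lt_trans _ _ (\int[mu]_x (`|g x|%:E * \int[mu]_y (`|f y| * M)%:E))%E).
  apply: ge0_le_integral => //.
  - by move=> x _; exact: integral_ge0.
  - have := @measurable_fun_fubini_tonelli_F _ _ _ _ _ mu
      (fun z : R * R => `|(g z.1 * (f z.2 * k z))%:E|%E).
    by apply => //; exact: measurableT_comp.
  - apply: emeasurable_funM => //; first by apply/measurable_EFinP; exact: measurableT_comp.
  - move=> x _; rewrite -ge0_integralZl//; last 2 first.
    + by apply/measurable_EFinP; apply: measurable_funM => //; exact: measurableT_comp.
    + by move=> y _; rewrite lee_fin mulr_ge0.
    apply: ge0_le_integral => //.
    + apply/measurable_EFinP; apply: measurableT_comp => //; apply/measurable_EFinP.
      exact: (measurable_fun_pair2 x mF).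
    + apply: measurable_funeM; apply/measurable_EFinP; apply: measurable_funM => //.
      exact: measurableT_comp.
    + by move=> y _; rewrite -EFinM lee_fin !normrM ler_wpM2l// ler_wpM2l.
rewrite ge0_integralZr//; last by apply/measurable_EFinP; exact: measurableT_comp.
rewrite lte_mul_pinfty//; first by apply: integral_ge0.
  rewrite ge0_fin_numE//; last by apply: integral_ge0.
  by have := integrable_lty measurableT (integrable_norm g1).
Qed.

Section Exchange.
Variables (f g : R -> R) (k : R * R -> R) (M : R).
Hypotheses (f1 : L1 f) (g1 : L1 g) (mk : measurable_fun setT k)
  (kM : forall z, `|k z| <= M).

Let F := fun z => (g z.1 * (f z.2 * k z))%:E.
Let iF : (mu \x mu)%E.-integrable setT F := integrable_prod_bounded f1 g1 mk kM.

Lemma integrable_mul_bounded (h : R -> R) (N : R) : measurable_fun setT h ->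
  (forall x, `|h x| <= N) -> L1 (fun x => f x * h x).
Proof.
move=> mh hN; have N0 : 0 <= N by apply: le_trans (hN 0).
have [/measurable_EFinP mf _] := integrableP _ _ _ f1.
apply: (le_integrable measurableT _ _ (integrableZl measurableT N f1)) => /=.
  by apply/measurable_EFinP; exact: measurable_funM.
by move=> x _; rewrite lee_fin !normrM mulrC ler_wpM2r// (ger0_norm N0).
Qed.

Let innerE x : (g x * \int[mu]_y (f y * k (x, y)))%:E = fubini_F mu F x.
Proof.
rewrite /fubini_F /F/=.
have mkx : measurable_fun setT (fun y => k (x, y)) by exact: measurable_fun_pair2.
have L := integrable_mul_bounded mkx (fun y => kM (x, y)).
under eq_integral do rewrite EFinM.
by rewrite integralZl// EFinM /Rintegral fineK// integrable_fin_num.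
Qed.

Lemma integrable_fubini_bounded : L1 (fun x => g x * \int[mu]_y (f y * k (x, y))).
Proof.
have := integrable_fubini_F iF; apply: eq_integrable => // x _ /=.
by rewrite innerE.
Qed.

End Exchange.

Lemma Rintegral_exchange f g k M : L1 f -> L1 g -> measurable_fun setT k ->
  (forall z, `|k z| <= M) ->
  \int[mu]_x (g x * \int[mu]_y (f y * k (x, y))) =
  \int[mu]_y (f y * \int[mu]_x (g x * k (x, y))).
Proof.
move=> f1 g1 mk kM; congr fine.
have := Fubini (integrable_prod_bounded f1 g1 mk kM).
have E1 x : (\int[mu]_y (g x * (f y * k (x, y)))%:E = (g x * \int[mu]_y (f y * k (x, y)))%:E)%E.
  have mkx : measurable_fun setT (fun y => k (x, y)) by exact: measurable_fun_pair2.
  have L := integrable_mul_bounded f1 mkx (fun y => kM (x, y)).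
  under eq_integral do rewrite EFinM.
  by rewrite integralZl// EFinM /Rintegral fineK// integrable_fin_num.
have E2 y : (\int[mu]_x (g x * (f y * k (x, y)))%:E = (f y * \int[mu]_x (g x * k (x, y)))%:E)%E.
  have mkx : measurable_fun setT (fun x => k (x, y)) by exact: measurable_fun_pair1.
  have L := integrable_mul_bounded g1 mkx (fun x => kM (x, y)).
  under eq_integral do rewrite mulrCA EFinM.
  by rewrite integralZl// EFinM /Rintegral fineK// integrable_fin_num.
move=> h; under eq_integral do rewrite -E1; under [RHS]eq_integral do rewrite -E2.
exact: h.
Qed.

Definition cosint f xi := \int[mu]_x (f x * cos (xi * x)).
Definition sinint f xi := \int[mu]_x (f x * sin (xi * x)).

Lemma measurable_cosM : measurable_fun setT (fun z : R * R => cos (z.1 * z.2)).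
Proof.
apply: measurableT_comp; last exact: measurable_funM.
by apply: continuous_measurable_fun; exact: continuous_cos.
Qed.

Lemma measurable_sinM : measurable_fun setT (fun z : R * R => sin (z.1 * z.2)).
Proof.
apply: measurableT_comp; last exact: measurable_funM.
by apply: continuous_measurable_fun; exact: continuous_sin.
Qed.

Lemma normr_cos x : `|cos x| <= 1. Proof. by rewrite ler_norml cos_geN1 cos_le1. Qed.
Lemma normr_sin x : `|sin x| <= 1. Proof. by rewrite ler_norml sin_geN1 sin_le1. Qed.

Lemma measurable_cos_lin xi : measurable_fun setT (fun x : R => cos (xi * x)).
Proof. exact: (measurable_fun_pair2 xi measurable_cosM). Qed.

Lemma measurable_sin_lin xi : measurable_fun setT (fun x : R => sin (xi * x)).
Proof. exact: (measurable_fun_pair2 xi measurable_sinM). Qed.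

Lemma integrable_mul_cos f xi : L1 f -> L1 (fun x => f x * cos (xi * x)).
Proof.
move=> f1; apply: (integrable_mul_bounded f1 (measurable_cos_lin xi)) => x.
exact: normr_cos.
Qed.

Lemma integrable_mul_sin f xi : L1 f -> L1 (fun x => f x * sin (xi * x)).
Proof.
move=> f1; apply: (integrable_mul_bounded f1 (measurable_sin_lin xi)) => x.
exact: normr_sin.
Qed.

Lemma measurable_decay e : measurable_fun setT (fun x : R => expR (- (e * `|x|))).
Proof. by apply: continuous_measurable_fun; exact: continuous_decay. Qed.

(** Fubini's theorem yields measurability of the inner integral only after multiplication by an
    integrable function of x; e^{-|x|} is used for this and divided out again. *)
Lemma measurable_fubini_bounded f k (M : R) : L1 f -> measurable_fun setT k ->
  (forall z, `|k z| <= M) ->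
  measurable_fun setT (fun x => \int[mu]_y (f y * k (x, y))).
Proof.
move=> f1 mk k1; have := integrable_fubini_bounded f1 (@integrable_decay R 1 ltr01) mk k1.
move=> /integrableP[/measurable_EFinP mI _].
have -> : (fun x => \int[mu]_y (f y * k (x, y))) =
    (fun x => expR (1 * `|x|) * (expR (- (1 * `|x|)) * \int[mu]_y (f y * k (x, y)))).
  by apply/funext => x; rewrite mulrA -expRD subrr expR0 mul1r.
apply: measurable_funM => //; apply: measurableT_comp; first exact: measurable_expR.
by apply: measurable_funM => //; exact: measurable_normr.
Qed.

Lemma measurable_integral2 (F : R * R -> \bar R) : measurable_fun setT F ->
  (forall z, 0 <= F z)%E -> measurable_fun setT (fun x => \int[mu]_y F (x, y))%E.
Proof.
by move=> mF F0; have := @measurable_fun_fubini_tonelli_F _ _ _ _ _ mu F mF F0. Qed.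

Lemma tonelli (F : R -> R -> \bar R) : measurable_fun setT (fun z => F z.1 z.2) ->
  (forall x y, 0 <= F x y)%E ->
  (\int[mu]_x \int[mu]_y F x y = \int[mu]_y \int[mu]_x F x y)%E.
Proof.
move=> mF F0.
have := @fubini_tonelli _ _ _ _ R mu mu (fun z => F z.1 z.2) mF (fun z => F0 z.1 z.2).
by [].
Qed.

Lemma Rintegral_le_abs (h : R -> R) : measurable_fun setT h ->
  ((`|\int[mu]_x h x|)%:E <= \int[mu]_x `|h x|%:E)%E.
Proof.
move=> mh; have := @le_abse_integral _ _ _ mu setT (EFin \o h) measurableT.
move=> /(_ (proj2 (measurable_EFinP _ _) mh)); apply: le_trans.
rewrite /Rintegral /comp; by case: (\int[mu]_x (h x)%:E)%E => [r| |] //=; rewrite ?normr0 ?leey.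
Qed.

Lemma measurable_cosint f : L1 f -> measurable_fun setT (cosint f).
Proof.
move=> f1; apply: (measurable_fubini_bounded f1 measurable_cosM) => z.
exact: normr_cos.
Qed.

Lemma measurable_sinint f : L1 f -> measurable_fun setT (sinint f).
Proof.
move=> f1; apply: (measurable_fubini_bounded f1 measurable_sinM) => z.
exact: normr_sin.
Qed.

Lemma normr_Rintegral_bounded f (h : R -> R) : L1 f -> measurable_fun setT h ->
  (forall x, `|h x| <= 1) -> `|\int[mu]_x (f x * h x)| <= \int[mu]_x `|f x|.
Proof.
move=> f1 mh h1; have L := integrable_mul_bounded f1 mh h1.
apply: le_trans (le_normr_Rintegral measurableT L) _.
apply: le_Rintegral => //; first exact: (integrable_norm L).
  exact: (integrable_norm f1).
by move=> x _; rewrite normrM ler_piMr.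
Qed.

Lemma normr_cosint f xi : L1 f -> `|cosint f xi| <= \int[mu]_x `|f x|.
Proof.
by move=> f1; apply: normr_Rintegral_bounded => //; [exact: measurable_cos_lin|move=> x; exact: normr_cos].
Qed.

Lemma normr_sinint f xi : L1 f -> `|sinint f xi| <= \int[mu]_x `|f x|.
Proof.
by move=> f1; apply: normr_Rintegral_bounded => //; [exact: measurable_sin_lin|move=> x; exact: normr_sin].
Qed.

Lemma Rintegral_mul_cosB f xi y : L1 f ->
  \int[mu]_x (f x * cos (xi * (x - y))) =
  cosint f xi * cos (xi * y) + sinint f xi * sin (xi * y).
Proof.
move=> f1; rewrite /cosint /sinint.
rewrite -!RintegralZr//; [|exact: integrable_mul_sin|exact: integrable_mul_cos].
rewrite -RintegralD//; last 2 first.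
- have := integrableZr measurableT (cos (xi * y)) (integrable_mul_cos xi f1).
  by apply: eq_integrable => // x _ /=; rewrite EFinM.
- have := integrableZr measurableT (sin (xi * y)) (integrable_mul_sin xi f1).
  by apply: eq_integrable => // x _ /=; rewrite EFinM.
by apply: eq_Rintegral => x _; rewrite mulrBr cosB; ring.
Qed.

(** The cosine transform of e^{-e|x|}, see [integral_decay_cos]. *)
Definition poisson e x := 2 * e / (e ^+ 2 + x ^+ 2).

Lemma poisson_ge0 e x : 0 < e -> 0 <= poisson e x.
Proof.
move=> e0; rewrite divr_ge0 ?mulr_ge0 ?(ltW e0)// addr_ge0 ?sqr_ge0//.
Qed.

Lemma measurable_poisson e : 0 < e -> measurable_fun setT (poisson e).
Proof.
move=> e0; apply: continuous_measurable_fun => x.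
apply: cvgM; first exact: cvg_cst.
apply: cvgV; first by rewrite gt_eqF// ltr_wpDr ?sqr_ge0// exprn_gt0.
by apply: cvgD; [exact: cvg_cst|apply: exprn_continuous].
Qed.

Lemma integral_poisson e y : 0 < e ->
  (\int[mu]_x (poisson e (x - y))%:E = (2 * pi)%:E)%E.
Proof.
move=> e0; rewrite EFinM -(integral_cauchy_kernel y e0) -ge0_integralZl//.
- by apply: eq_integral => x _; rewrite -EFinM /poisson mulrA.
- apply/measurable_EFinP; have -> : (fun x : R => e / (e ^+ 2 + (x - y) ^+ 2)) =
      (fun x : R => 2^-1 * poisson e (x - y)).
    by apply/funext => x; rewrite /poisson; field; rewrite gt_eqF// ltr_wpDr ?sqr_ge0// exprn_gt0.
  apply: measurable_funM => //; apply: measurableT_comp; first exact: measurable_poisson.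
  exact: measurable_funB.
- by move=> x _; rewrite lee_fin divr_ge0 ?(ltW e0)// addr_ge0 ?sqr_ge0.
Qed.

Lemma poissonN e x : poisson e (- x) = poisson e x.
Proof. by rewrite /poisson sqrrN. Qed.

(** Abel summation of the inversion formula: exchanging the integrals turns the factor e^{-e|xi|} on
    the transform side into a Poisson average of f. *)
Lemma cosint_poisson f e y : 0 < e -> L1 f ->
  \int[mu]_xi (expR (- (e * `|xi|)) * (cosint f xi * cos (xi * y) + sinint f xi * sin (xi * y))) =
  \int[mu]_x (f x * poisson e (x - y)).
Proof.
move=> e0 f1; have mk : measurable_fun setT (fun z : R * R => cos (z.1 * (z.2 - y))).
  apply: measurableT_comp; first by apply: continuous_measurable_fun; exact: continuous_cos.
  by apply: measurable_funM => //; exact: measurable_funB.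
have := Rintegral_exchange f1 (integrable_decay e0) mk (fun z => normr_cos _).
under eq_Rintegral do rewrite /= Rintegral_mul_cosB//.
move=> ->; apply: eq_Rintegral => x _; congr (_ * _).
under eq_Rintegral do rewrite /= mulrC [_ * (x - y)]mulrC mulrC.
exact: integral_decay_cos.
Qed.

(* Inserting the factor [e^{-e|xi|}] turns the integral of [|\hat f|^2] into a
   quadratic form in [f] whose kernel, the Poisson kernel, has mass [2 pi]. *)
Lemma decay_plancherel f e : 0 < e -> L1 f -> isL2 f ->
  (\int[mu]_xi (expR (- (e * `|xi|)) * (cosint f xi ^+ 2 + sinint f xi ^+ 2))%:E
   <= (2 * pi)%:E * sqint f)%E.
Proof.
move=> e0 f1 f2; set M := \int[mu]_x `|f x|.
have [mf f2y] := f2.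
pose k (z : R * R) := cosint f z.1 * cos (z.1 * z.2) + sinint f z.1 * sin (z.1 * z.2).
have mk : measurable_fun setT k.
  apply: measurable_funD; apply: measurable_funM.
  - by apply: measurableT_comp => //; exact: measurable_cosint.
  - exact: measurable_cosM.
  - by apply: measurableT_comp => //; exact: measurable_sinint.
  - exact: measurable_sinM.
have kM z : `|k z| <= M + M.
  rewrite (le_trans (ler_normD _ _))// lerD// normrM.
  - by rewrite -[leRHS]mulr1 ler_pM ?normr_cos ?normr_cosint.
  - by rewrite -[leRHS]mulr1 ler_pM ?normr_sin ?normr_sinint.
have E1 xi : cosint f xi ^+ 2 + sinint f xi ^+ 2 = \int[mu]_y (f y * k (xi, y)).
  have i1 : L1 (fun x => cosint f xi * (f x * cos (xi * x))).
    have := integrableZl measurableT (cosint f xi) (integrable_mul_cos xi f1).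
    by apply: eq_integrable => // x _ /=; rewrite EFinM.
  have i2 : L1 (fun x => sinint f xi * (f x * sin (xi * x))).
    have := integrableZl measurableT (sinint f xi) (integrable_mul_sin xi f1).
    by apply: eq_integrable => // x _ /=; rewrite EFinM.
  rewrite !expr2 {2}/cosint {2}/sinint -!RintegralZl//;
    [|exact: integrable_mul_sin|exact: integrable_mul_cos].
  by rewrite -RintegralD//; apply: eq_Rintegral => x _; rewrite /k/=; ring.
have iF := integrable_fubini_bounded f1 (integrable_decay e0) mk kM.
rewrite -[leLHS]fineK; last first.
  have := integrable_fin_num measurableT iF.
  by under eq_integral do rewrite /= -E1.
have := Rintegral_exchange f1 (integrable_decay e0) mk kM.
under eq_Rintegral do rewrite -E1.
rewrite -/(Rintegral _ _ _) => ->.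
under eq_Rintegral do rewrite /k/= cosint_poisson//.
have mp : measurable_fun setT (fun z : R * R => poisson e (z.2 - z.1)).
  by apply: measurableT_comp; [exact: measurable_poisson|exact: measurable_funB].
have p0 z : 0 <= poisson e z by exact: poisson_ge0.
have pM z : `|poisson e z| <= 2 / e.
  rewrite ger0_norm// /poisson ler_pdivrMr ?ltr_wpDr ?sqr_ge0 ?exprn_gt0//.
  rewrite -subr_ge0; have -> : 2 / e * (e ^+ 2 + z ^+ 2) - 2 * e = 2 / e * z ^+ 2.
    by field; rewrite gt_eqF.
  by rewrite mulr_ge0 ?sqr_ge0// divr_ge0 ?(ltW e0).
have mp1 y : measurable_fun setT (fun x => poisson e (x - y)).
  exact: (measurable_fun_pair2 y mp).
have mp1' x : measurable_fun setT (fun y => poisson e (y - x)) by exact: mp1.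
have mH : measurable_fun setT (fun y => \int[mu]_x (f x * poisson e (x - y))).
  exact: (measurable_fubini_bounded f1 mp (fun z => pM _)).
have mG : measurable_fun setT (fun z : R * R => (`|f z.1| * (`|f z.2| * poisson e (z.2 - z.1)))%:E).
  apply/measurable_EFinP; apply: measurable_funM.
    by apply: measurableT_comp => //; apply: measurableT_comp.
  by apply: measurable_funM => //; apply: measurableT_comp => //; apply: measurableT_comp.
have mA : measurable_fun setT (fun z : R * R => (2^-1 * f z.2 ^+ 2 * poisson e (z.2 - z.1))%:E).
  apply/measurable_EFinP; apply: measurable_funM => //; apply: measurable_funM => //.
  by apply: measurable_funX; apply: measurableT_comp.
have mB : measurable_fun setT (fun z : R * R => (2^-1 * f z.1 ^+ 2 * poisson e (z.2 - z.1))%:E).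
  apply/measurable_EFinP; apply: measurable_funM => //; apply: measurable_funM => //.
  by apply: measurable_funX; apply: measurableT_comp.
have hG z : (0 <= (`|f z.1| * (`|f z.2| * poisson e (z.2 - z.1)))%:E)%E.
  by rewrite lee_fin; apply: mulr_ge0 => //; apply: mulr_ge0.
have hA z : (0 <= (2^-1 * f z.2 ^+ 2 * poisson e (z.2 - z.1))%:E)%E.
  by rewrite lee_fin; apply: mulr_ge0 => //; apply: mulr_ge0 => //; exact: sqr_ge0.
have hB z : (0 <= (2^-1 * f z.1 ^+ 2 * poisson e (z.2 - z.1))%:E)%E.
  by rewrite lee_fin; apply: mulr_ge0 => //; apply: mulr_ge0 => //; exact: sqr_ge0.
apply: (@le_trans _ _ (\int[mu]_y `|f y * \int[mu]_x (f x * poisson e (x - y))|%:E)%E).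
  apply: le_trans (Rintegral_le_abs _); last exact: measurable_funM.
  by rewrite lee_fin ler_norm.
apply: (@le_trans _ _ (\int[mu]_y \int[mu]_x (`|f y| * (`|f x| * poisson e (x - y)))%:E)%E).
  apply: ge0_le_integral => //.
  - by apply/measurable_EFinP; apply: measurableT_comp => //; exact: measurable_funM.
  - exact: (measurable_integral2 mG hG).
  - move=> y _; under eq_integral do rewrite EFinM.
    rewrite ge0_integralZl//; last 2 first.
    + by apply/measurable_EFinP; apply: measurable_funM; [exact: measurableT_comp|exact: mp1].
    + by move=> x _; rewrite lee_fin mulr_ge0// p0.
    rewrite normrM EFinM; apply: lee_wpmul2l => //.
    apply: le_trans (Rintegral_le_abs _) _; first by apply: measurable_funM => //; exact: mp1.
    apply: ge0_le_integral => //.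
    + by apply/measurable_EFinP; apply: measurableT_comp => //; apply: measurable_funM => //; exact: mp1.
    + by apply/measurable_EFinP; apply: measurable_funM; [exact: measurableT_comp|exact: mp1].
    + by move=> x _; rewrite lee_fin normrM (ger0_norm (p0 _)).
(* Schur's test: |f(x) f(y)| is at most half the sum of the squares, and in each half the kernel
   integrates to 2 pi in the variable that f does not involve. *)
apply: (@le_trans _ _ (\int[mu]_y ((\int[mu]_x (2^-1 * f x ^+ 2 * poisson e (x - y))%:E)%E +
    (\int[mu]_x (2^-1 * f y ^+ 2 * poisson e (x - y))%:E)%E)%E)%E).
  apply: ge0_le_integral => //.
  - by move=> y _; apply: integral_ge0 => x _; exact: (hG (y, x)).
  - exact: (measurable_integral2 mG hG).
  - apply: emeasurable_funD.
    + exact: (measurable_integral2 mA hA).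
    + exact: (measurable_integral2 mB hB).
  - move=> y _; rewrite -ge0_integralD//.
    + apply: ge0_le_integral => //.
      * by move=> x _; exact: (hG (y, x)).
      * exact: (measurable_fun_pair2 y mG).
      * by apply: emeasurable_funD; [exact: (measurable_fun_pair2 y mA)|exact: (measurable_fun_pair2 y mB)].
      * move=> x _; rewrite -EFinD lee_fin -mulrDl mulrA ler_wpM2r//.
        rewrite -(real_normK (num_real (f x))) -(real_normK (num_real (f y))).
        by have := sqr_ge0 (`|f x| - `|f y|); nra.
    + by move=> x _; exact: (hA (y, x)).
    + exact: (measurable_fun_pair2 y mA).
    + by move=> x _; exact: (hB (y, x)).
    + exact: (measurable_fun_pair2 y mB).
have pi0 : 0 <= 2 * pi :> R by rewrite mulr_ge0 ?pi_ge0.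
have half : (\int[mu]_x (2^-1 * f x ^+ 2 * (2 * pi))%:E = pi%:E * sqint f)%E.
  rewrite /sqint -ge0_integralZl ?lee_fin ?pi_ge0//.
  - by apply: eq_integral => x _; rewrite -EFinM; congr EFin; field.
  - exact: measurable_sqr.
  - by move=> x _; rewrite lee_fin sqr_ge0.
rewrite ge0_integralD//; last 4 first.
- by move=> y _; apply: integral_ge0 => x _; exact: (hA (y, x)).
- exact: (measurable_integral2 mA hA).
- by move=> y _; apply: integral_ge0 => x _; exact: (hB (y, x)).
- exact: (measurable_integral2 mB hB).
have -> : (\int[mu]_y \int[mu]_x (2^-1 * f y ^+ 2 * poisson e (x - y))%:E = pi%:E * sqint f)%E.
  rewrite -half; apply: eq_integral => y _; under eq_integral do rewrite EFinM.
  rewrite ge0_integralZl//.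
  - by rewrite integral_poisson// -EFinM.
  - by apply/measurable_EFinP; exact: mp1.
  - by move=> x _; rewrite lee_fin p0.
  - by rewrite lee_fin mulr_ge0// sqr_ge0.
have -> : (\int[mu]_y \int[mu]_x (2^-1 * f x ^+ 2 * poisson e (x - y))%:E = pi%:E * sqint f)%E.
  rewrite (tonelli (F := fun y x => (2^-1 * f x ^+ 2 * poisson e (x - y))%:E) mA) => [|y x]; last exact: (hA (y, x)).
  rewrite -half; apply: eq_integral => x _; under eq_integral do rewrite /= -(opprB _ x) poissonN EFinM.
  rewrite ge0_integralZl//.
  - by rewrite integral_poisson// -EFinM.
  - by apply/measurable_EFinP; exact: mp1'.
  - by move=> y _; rewrite lee_fin p0.
  - by rewrite lee_fin mulr_ge0// sqr_ge0.
by rewrite -ge0_muleDl ?lee_fin ?pi_ge0// -EFinD -mulr2n mulr_natl.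
Qed.

(** The regularising factor e^{-e|xi|} tends to 1 along e = 1/(n+1) while the bound stays the same.
    Only this inequality of Plancherel's theorem is used below, in both directions of the
    transform. *)
Lemma plancherel_le f : L1 f -> isL2 f ->
  (sqint (cosint f) + sqint (sinint f) <= (2 * pi)%:E * sqint f)%E.
Proof.
move=> f1 f2; have mc := measurable_cosint f1; have ms := measurable_sinint f1.
rewrite /sqint -ge0_integralD//; last 4 first.
- by move=> x _; rewrite lee_fin sqr_ge0.
- exact: measurable_sqr.
- by move=> x _; rewrite lee_fin sqr_ge0.
- exact: measurable_sqr.
apply: (@fatou_le _ _ R mu ( fun n xi =>
  (expR (- (n.+1%:R^-1 * `|xi|)) * (cosint f xi ^+ 2 + sinint f xi ^+ 2))%:E)
  (fun xi => (cosint f xi ^+ 2)%:E + (sinint f xi ^+ 2)%:E)%E).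
- move=> n; apply/measurable_EFinP; apply: measurable_funM; first exact: measurable_decay.
  by apply: measurable_funD; exact: measurable_funX.
- by move=> n x; rewrite lee_fin mulr_ge0 ?expR_ge0// addr_ge0 ?sqr_ge0.
- move=> x; rewrite -EFinD; apply: cvg_EFin; first exact: nearW.
  rewrite -[X in _ --> X]mul1r; apply: cvgM; last exact: cvg_cst.
  have h : - (n.+1%:R^-1 * `|x|) @[n --> \oo] --> - (0 * `|x|).
    by apply: cvgN; apply: cvgM; [exact: cvg_harmonic|exact: cvg_cst].
  have := cvg_comp _ _ h (@continuous_expR R (- (0 * `|x|))).
  by rewrite mul0r oppr0 expR0.
- by move=> n; apply: decay_plancherel.
Qed.

End FourierIntegral.

(** * The transform on L^2 *)

Section FourierL2.
Context {R : realType}.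
Local Notation mu := (@lebesgue_measure R).
Local Notation L1 f := (mu.-integrable setT (EFin \o f)).
Implicit Types (f g a b : R -> R).

Definition L2cvg (f_ : nat -> R -> R) f := forall e, 0 < e ->
  \forall n \near \oo, (sqint (fun x => f_ n x - f x)%R <= e%:E)%E.

(* [a] and [b] are the cosine and sine transforms of [f], so [\hat f = a - i b]. *)
Definition ft f a b := [/\ isL2 f, isL2 a, isL2 b & exists f_ : nat -> R -> R,
  [/\ forall n, L1 (f_ n) /\ isL2 (f_ n), L2cvg f_ f,
      L2cvg (fun n => cosint (f_ n)) a & L2cvg (fun n => sinint (f_ n)) b]].

Lemma normc_sqr (z : R[i]) : Normc.normc z ^+ 2 = complex.Re z ^+ 2 + complex.Im z ^+ 2.
Proof. by case: z => x y /=; rewrite sqr_sqrtr// addr_ge0 ?sqr_ge0. Qed.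

Lemma measurable_normc (p q : R -> R) : measurable_fun setT p -> measurable_fun setT q ->
  measurable_fun setT (fun x => Normc.normc (p x +i* q x)%C).
Proof.
move=> mp mq; rewrite /Normc.normc/=; apply: measurableT_comp.
  by apply: continuous_measurable_fun; exact: sqrt_continuous.
by apply: measurable_funD; exact: measurable_funX.
Qed.

Lemma sqint_normc (g : R -> R[i]) : measurable_fun setT (fun x => complex.Re (g x)) ->
  measurable_fun setT (fun x => complex.Im (g x)) ->
  sqint (fun x => Normc.normc (g x)) =
  (sqint (fun x => complex.Re (g x)) + sqint (fun x => complex.Im (g x)))%E.
Proof.
move=> mr mi; rewrite /sqint -ge0_integralD//; last 4 first.
- by move=> x _; rewrite lee_fin sqr_ge0.
- exact: measurable_sqr.
- by move=> x _; rewrite lee_fin sqr_ge0.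
- exact: measurable_sqr.
by apply: eq_integral => x _; rewrite normc_sqr EFinD.
Qed.

(** [fourier_integral f] is [cosint f] minus i times [sinint f], whence the sign on the imaginary
    part. From here on a transform is a pair of real functions. *)
Lemma is_fourierP f (g : R -> R[i]) : is_fourier f g <->
  ft f (fun xi => complex.Re (g xi)) (fun xi => - complex.Im (g xi)).
Proof.
have key (f_ : nat -> R -> R) : (forall n, L1 (f_ n) /\ isL2 (f_ n)) ->
    isL2 (fun xi => complex.Re (g xi)) -> isL2 (fun xi => complex.Im (g xi)) ->
    forall n, sqint (fun xi => Normc.normc (fourier_integral (f_ n) xi - g xi)) =
     (sqint (fun xi => cosint (f_ n) xi - complex.Re (g xi))%R +
      sqint (fun xi => sinint (f_ n) xi - - complex.Im (g xi))%R)%E.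
  move=> hf [mr _] [mi _] n; have [f1 _] := hf n.
  have eR xi : complex.Re (fourier_integral (f_ n) xi - g xi) = cosint (f_ n) xi - complex.Re (g xi).
    by case: (g xi).
  have eI xi : complex.Im (fourier_integral (f_ n) xi - g xi) = - (sinint (f_ n) xi - - complex.Im (g xi)).
    by case: (g xi) => x y /=; rewrite opprD opprK.
  rewrite sqint_normc.
  - congr (_ + _)%E; first by apply: eq_integral => xi _; rewrite eR.
    by rewrite -sqintN; apply: eq_integral => xi _; rewrite eI opprK.
  - under eq_fun do rewrite eR; apply: measurable_funB => //.
    exact: measurable_cosint.
  - under eq_fun do rewrite eI; apply: measurableT_comp => //.
    apply: measurable_funB; first exact: measurable_sinint.
    exact: measurableT_comp.
split.
- move=> [/LfunE f2 /LfunE r2 /LfunE i2 [f_ [f12 ff hff]]].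
  have hf n : L1 (f_ n) /\ isL2 (f_ n).
    by have [/Lfun1_integrable ? /LfunE ?] := f12 n.
  split => //; first exact: isL2N.
  exists f_; split=> //.
  + exact/Lnorm2_cvg0.
  + move=> e e0; have /Lnorm2_cvg0 := hff; move=> /(_ _ e0); apply: filterS => n.
    by rewrite key//; apply: le_trans; rewrite leeDl// sqint_ge0.
  + move=> e e0; have /Lnorm2_cvg0 := hff; move=> /(_ _ e0); apply: filterS => n.
    by rewrite key//; apply: le_trans; rewrite leeDr// sqint_ge0.
- move=> [f2 r2 /isL2N i2' [f_ [hf ff hc hs]]].
  have i2 : isL2 (fun xi => complex.Im (g xi)) by under eq_fun do rewrite -[complex.Im _]opprK.
  split; [exact/LfunE|exact/LfunE|exact/LfunE|].
  exists f_; split.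
  + by move=> n; have [? ?] := hf n; split; [exact/Lfun1_integrable|exact/LfunE].
  + exact/Lnorm2_cvg0.
  + apply/Lnorm2_cvg0 => e e0; have e20 : 0 < e / 2 by rewrite divr_gt0.
    near=> n; rewrite key// [e]splitr EFinD leeD//.
      by near: n; exact: hc.
    by near: n; exact: hs.
Unshelve. all: by end_near. Qed.

Lemma L2cvg_ext (u_ v_ : nat -> R -> R) (u : R -> R) :
  (forall n x, v_ n x = u_ n x) -> L2cvg u_ u -> L2cvg v_ u.
Proof. by move=> uv; have -> : v_ = u_ by apply/funext => n; apply/funext => x. Qed.

(** Multipliers bounded by 1 cover both uses: the rotations by cos and sin that come from
    translations, and the constants 1 and -1 that give differences. *)
Lemma L2cvg_lincomb (u_ v_ : nat -> R -> R) (u v p q : R -> R) :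
  (forall n, measurable_fun setT (u_ n)) -> (forall n, measurable_fun setT (v_ n)) ->
  measurable_fun setT u -> measurable_fun setT v ->
  measurable_fun setT p -> measurable_fun setT q ->
  (forall x, `|p x| <= 1) -> (forall x, `|q x| <= 1) ->
  L2cvg u_ u -> L2cvg v_ v ->
  L2cvg (fun n x => p x * u_ n x + q x * v_ n x) (fun x => p x * u x + q x * v x).
Proof.
move=> mu_ mv_ mu' mv mp mq p1 q1 hu hv e e0.
have e4 : 0 < e / 4 by rewrite divr_gt0.
near=> n.
have -> : (fun x => p x * u_ n x + q x * v_ n x - (p x * u x + q x * v x)) =
    (fun x => p x * (u_ n x - u x) + q x * (v_ n x - v x)).
  by apply/funext => x; ring.
have mB1 : measurable_fun setT (fun x => u_ n x - u x) by exact: measurable_funB.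
have mB2 : measurable_fun setT (fun x => v_ n x - v x) by exact: measurable_funB.
have mM1 : measurable_fun setT (fun x => p x * (u_ n x - u x)) by exact: measurable_funM.
have mM2 : measurable_fun setT (fun x => q x * (v_ n x - v x)) by exact: measurable_funM.
apply: le_trans (sqintD mM1 mM2) _.
apply: (@le_trans _ _ (2%:E * (e / 4)%:E + 2%:E * (e / 4)%:E)%E); last first.
  by rewrite -!EFinM -EFinD lee_fin; apply: le_of_eq; field.
rewrite leeD// lee_wpmul2l//.
- apply: le_trans (le_sqint mM1 mB1 _) _; last by near: n; exact: hu.
  by move=> x; rewrite normrM ler_piMl.
- apply: le_trans (le_sqint mM2 mB2 _) _; last by near: n; exact: hv.
  by move=> x; rewrite normrM ler_piMl.
Unshelve. all: by end_near. Qed.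

(** Plancherel's inequality for the approximations, carried to the limit. The inequality (u + v)^2
    <= 2 u^2 + 2 v^2 is used twice, which turns 2 pi into 8 pi; an error d in the approximations
    costs (2 + 8 pi) d. *)
Lemma ft_bound f a b : ft f a b ->
  (sqint a <= (8 * pi)%:E * sqint f)%E /\ (sqint b <= (8 * pi)%:E * sqint f)%E.
Proof.
move=> [[mf f2] [ma a2] [mb b2] [f_ [hf ff fa fb]]].
have key (h : R -> R) (H : (R -> R) -> R -> R) : measurable_fun setT h ->
    (forall n, measurable_fun setT (H (f_ n))) ->
    (forall n, (sqint (H (f_ n)) <= (2 * pi)%:E * sqint (f_ n))%E) ->
    L2cvg (fun n => H (f_ n)) h -> (sqint h <= (8 * pi)%:E * sqint f)%E.
  move=> mh mH bH cH; apply/lee_addgt0Pr => e e0.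
  have pi0 : 0 < pi :> R by exact: pi_gt0.
  pose d := e / (2 + 8 * pi).
  have k0 : 0 < 2 + 8 * pi :> R by rewrite addr_gt0// mulr_gt0.
  have d0 : 0 < d by rewrite divr_gt0.
  near \oo => n.
  have [_ [mfn _]] := hf n.
  have h1 : (sqint (fun x => H (f_ n) x - h x)%R <= d%:E)%E by near: n; exact: cH.
  have h2 : (sqint (fun x => f_ n x - f x)%R <= d%:E)%E by near: n; exact: ff.
  have h3 : (sqint h <= 2%:E * sqint (H (f_ n)) + 2%:E * d%:E)%E.
    have -> : sqint h = sqint (fun x => H (f_ n) x - (H (f_ n) x - h x)).
      by apply: eq_integral => x _; rewrite subKr.
    apply: le_trans (sqintB (mH n) (measurable_funB (mH n) mh)) _.
    by rewrite leeD2l// lee_wpmul2l.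
  have h4 : (sqint (f_ n) <= 2%:E * sqint f + 2%:E * d%:E)%E.
    have -> : sqint (f_ n) = sqint (fun x => f x + (f_ n x - f x)).
      by apply: eq_integral => x _; rewrite addrC subrK.
    apply: le_trans (sqintD mf (measurable_funB mfn mf)) _.
    by rewrite leeD2l// lee_wpmul2l.
  have h5 := bH n.
  move: h3 h4 h5 f2; have := sqint_ge0 h; have := sqint_ge0 f.
  have := sqint_ge0 (f_ n); have := sqint_ge0 (H (f_ n)).
  case: (sqint (H (f_ n))) => [x3| |]//; case: (sqint (f_ n)) => [x4| |]//;
    case: (sqint f) => [x1| |]//; case: (sqint h) => [x2| |]//.
  + rewrite -!EFinM -!EFinD !lee_fin => _ _ _ _ h3 h4 h5 _.
    have de : d * (2 + 8 * pi) = e by rewrite divfK// gt_eqF.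
    have : 2 * x3 <= 2 * (2 * pi * (2 * x1 + 2 * d)).
      by rewrite ler_pM2l// (le_trans h5)// ler_pM2l// mulr_gt0.
    by nra.
have half n g g' : (sqint g + sqint g' <= (2 * pi)%:E * sqint (f_ n))%E ->
    (sqint g <= (2 * pi)%:E * sqint (f_ n))%E /\ (sqint g' <= (2 * pi)%:E * sqint (f_ n))%E.
  move=> h; split; apply: le_trans h; first by rewrite leeDl// sqint_ge0.
  by rewrite leeDr// sqint_ge0.
split.
- apply: (key a cosint) => // n; have [f1 f2n] := hf n; first exact: measurable_cosint.
  exact: (half n _ _ (plancherel_le f1 f2n)).1.
- apply: (key b sinint) => // n; have [f1 f2n] := hf n; first exact: measurable_sinint.
  exact: (half n _ _ (plancherel_le f1 f2n)).2.
Unshelve. all: by end_near. Qed.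

Lemma L2cvgB (u_ v_ : nat -> R -> R) (u v : R -> R) :
  (forall n, measurable_fun setT (u_ n)) -> (forall n, measurable_fun setT (v_ n)) ->
  isL2 u -> isL2 v ->
  L2cvg u_ u -> L2cvg v_ v -> L2cvg (fun n x => u_ n x - v_ n x) (fun x => u x - v x).
Proof.
move=> mu_ mv_ [mu' _] [mv _] hu hv.
have := L2cvg_lincomb (p := fun=> 1) (q := fun=> -1) mu_ mv_ mu' mv
  (measurable_cst _) (measurable_cst _) _ _ hu hv.
under eq_fun do under eq_fun do rewrite mul1r mulN1r.
under [X in L2cvg _ X]eq_fun do rewrite mul1r mulN1r.
by apply=> x; rewrite ?normrN1 ?normr1.
Qed.

Lemma L1B f g : L1 f -> L1 g -> L1 (fun x => f x - g x).
Proof. by move=> f1 g1; have := integrableB measurableT f1 g1. Qed.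

Lemma cosintB f g xi : L1 f -> L1 g ->
  cosint (fun x => f x - g x) xi = cosint f xi - cosint g xi.
Proof.
move=> f1 g1; rewrite /cosint -RintegralB//; [|exact: integrable_mul_cos..].
by apply: eq_Rintegral => x _; rewrite mulrBl.
Qed.

Lemma sinintB f g xi : L1 f -> L1 g ->
  sinint (fun x => f x - g x) xi = sinint f xi - sinint g xi.
Proof.
move=> f1 g1; rewrite /sinint -RintegralB//; [|exact: integrable_mul_sin..].
by apply: eq_Rintegral => x _; rewrite mulrBl.
Qed.

Lemma ftB f a b f' a' b' : ft f a b -> ft f' a' b' ->
  ft (fun x => f x - f' x) (fun x => a x - a' x) (fun x => b x - b' x).
Proof.
move=> [f2 a2 b2 [f_ [hf ff fa fb]]] [f2' a2' b2' [f'_ [hf' ff' fa' fb']]].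
have m1 n : measurable_fun setT (f_ n) by have [_ []] := hf n.
have m1' n : measurable_fun setT (f'_ n) by have [_ []] := hf' n.
have f1 n : L1 (f_ n) by have [] := hf n.
have f1' n : L1 (f'_ n) by have [] := hf' n.
split; [exact: isL2B|exact: isL2B|exact: isL2B|].
exists (fun n x => f_ n x - f'_ n x); split.
- by move=> n; have [? ?] := hf n; have [? ?] := hf' n; split; [exact: L1B|exact: isL2B].
- exact: L2cvgB.
- apply: L2cvg_ext (fun n xi => cosintB xi (f1 n) (f1' n)) _; apply: L2cvgB => // n; exact: measurable_cosint.
- apply: L2cvg_ext (fun n xi => sinintB xi (f1 n) (f1' n)) _; apply: L2cvgB => // n; exact: measurable_sinint.
Qed.

Lemma measurable_shift (h : R) f : measurable_fun setT f ->
  measurable_fun setT (fun x : R => f (x + h)).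
Proof. by move=> mf; apply: measurableT_comp => //; exact: measurable_funD. Qed.

Lemma sqint_shift (h : R) f : measurable_fun setT f -> sqint (fun x => f (x + h)) = sqint f.
Proof.
move=> mf; rewrite /sqint (integral_shift h (f := fun x => (f x ^+ 2)%:E))//.
  exact: measurable_sqr.
by move=> x; rewrite lee_fin sqr_ge0.
Qed.

Lemma isL2_shift (h : R) f : isL2 f -> isL2 (fun x => f (x + h)).
Proof. by move=> [mf f2]; split; [exact: measurable_shift|rewrite sqint_shift]. Qed.

Lemma L1_shift (h : R) f : L1 f -> L1 (fun x => f (x + h)).
Proof.
move=> /integrableP[/measurable_EFinP mf fy]; apply/integrableP; split.
  by apply/measurable_EFinP; exact: measurable_shift.
rewrite /= (integral_shift h (f := fun x => `|f x|%:E))//.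
by apply/measurable_EFinP; exact: measurableT_comp.
Qed.

Lemma Rintegral_shift (h : R) f : L1 f -> \int[mu]_x f (x + h) = \int[mu]_x f x.
Proof.
move=> f1; have /integrableP[mf _] := f1; congr fine.
have mh : measurable_fun setT (fun x : measurableTypeR R => x + h : measurableTypeR R).
  by apply: measurable_funD.
have f1' : mu.-integrable ((fun x : measurableTypeR R => x + h : measurableTypeR R) @^-1` setT)
    ((EFin \o f) \o (fun x => x + h)).
  by rewrite preimage_setT; exact: L1_shift.
have := integral_pushforward mh mf f1' measurableT.
rewrite preimage_setT /comp => <-.
by apply: eq_measure_integral => A mA _; exact: lebesgue_measureD.
Qed.

Lemma cosint_shift (h : R) f xi : L1 f ->
  cosint (fun x => f (x + h)) xi = cos (h * xi) * cosint f xi + sin (h * xi) * sinint f xi.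
Proof.
move=> f1; rewrite /cosint.
have -> : \int[mu]_x (f (x + h) * cos (xi * x)) =
    \int[mu]_x ((fun y => f y * cos (xi * (y - h))) (x + h)).
  by apply: eq_Rintegral => x _; rewrite addrK.
rewrite (Rintegral_shift h (f := fun y => f y * cos (xi * (y - h)))).
  by rewrite Rintegral_mul_cosB// [h * xi]mulrC /cosint; ring.
have mk : measurable_fun setT (fun y : R => cos (xi * (y - h))).
  have := measurable_shift (- h) (measurable_cos_lin xi).
  by [].
exact: (integrable_mul_bounded f1 mk (fun x => normr_cos _)).
Qed.

Lemma sinint_shift (h : R) f xi : L1 f ->
  sinint (fun x => f (x + h)) xi = cos (h * xi) * sinint f xi - sin (h * xi) * cosint f xi.
Proof.
move=> f1; rewrite /sinint.
have -> : \int[mu]_x (f (x + h) * sin (xi * x)) =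
    \int[mu]_x ((fun y => f y * sin (xi * (y - h))) (x + h)).
  by apply: eq_Rintegral => x _; rewrite addrK.
have mk : measurable_fun setT (fun y : R => sin (xi * (y - h))).
  have := measurable_shift (- h) (measurable_sin_lin xi).
  by [].
rewrite (Rintegral_shift h (f := fun y => f y * sin (xi * (y - h)))); last exact: (integrable_mul_bounded f1 mk (fun x => normr_sin _)).
rewrite /cosint -!RintegralZl//; [|exact: integrable_mul_cos|exact: integrable_mul_sin].
rewrite -RintegralB//; last 2 first.
- have := integrableZl measurableT (cos (h * xi)) (integrable_mul_sin xi f1).
  by apply: eq_integrable => // x _ /=; rewrite EFinM.
- have := integrableZl measurableT (sin (h * xi)) (integrable_mul_cos xi f1).
  by apply: eq_integrable => // x _ /=; rewrite EFinM.
by apply: eq_Rintegral => x _; rewrite mulrBr sinB [h * xi]mulrC; ring.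
Qed.

(** Translation by h multiplies a - i b by e^{i h xi}, that is, it rotates the pair (a, b). The
    identity is exact for the integrable approximations, and rotations preserve L^2 convergence. *)
Lemma ft_shift (h : R) f a b : ft f a b -> ft (fun x => f (x + h))
  (fun xi => cos (h * xi) * a xi + sin (h * xi) * b xi)
  (fun xi => cos (h * xi) * b xi - sin (h * xi) * a xi).
Proof.
move=> [f2 a2 b2 [f_ [hf ff fa fb]]].
have mc := measurable_cos_lin h; have ms := measurable_sin_lin h.
have [ma _] := a2; have [mb _] := b2.
have bc g : isL2 g -> isL2 (fun xi => cos (h * xi) * g xi).
  move=> g2; have [mg _] := g2; apply: (isL2_le _ g2); first exact: measurable_funM.
  by move=> x; rewrite normrM ler_piMl// normr_cos.
have bs g : isL2 g -> isL2 (fun xi => sin (h * xi) * g xi).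
  move=> g2; have [mg _] := g2; apply: (isL2_le _ g2); first exact: measurable_funM.
  by move=> x; rewrite normrM ler_piMl// normr_sin.
have f1 n : L1 (f_ n) by have [] := hf n.
split; [exact: isL2_shift|by apply: isL2D; [exact: bc|exact: bs]|
  by apply: isL2B; [exact: bc|exact: bs]|].
exists (fun n x => f_ n (x + h)); split.
- by move=> n; have [? ?] := hf n; split; [exact: L1_shift|exact: isL2_shift].
- move=> e e0; have := ff e e0; apply: filterS => n; have [_ [mfn _]] := hf n.
  have [mf _] := f2.
  by rewrite (sqint_shift h (f := fun x => f_ n x - f x))//; exact: measurable_funB.
- exact: L2cvg_ext (fun n xi => cosint_shift h xi (f1 n))
    (L2cvg_lincomb (fun n => measurable_cosint (f1 n)) (fun n => measurable_sinint (f1 n))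
      ma mb mc ms (fun x => normr_cos _) (fun x => normr_sin _) fa fb).
- have nms : measurable_fun setT (fun x => - sin (h * x)) by exact: measurableT_comp.
  have ns x : `|- sin (h * x)| <= 1 by rewrite normrN normr_sin.
  have H := L2cvg_lincomb (fun n => measurable_sinint (f1 n)) (fun n => measurable_cosint (f1 n))
    mb ma mc nms (fun x => normr_cos _) ns fb fa.
  have -> : (fun xi => cos (h * xi) * b xi - sin (h * xi) * a xi) =
      (fun xi => cos (h * xi) * b xi + - sin (h * xi) * a xi).
    by apply/funext => xi; rewrite mulNr.
  by apply: L2cvg_ext H => n xi; rewrite (sinint_shift h xi (f1 n)) mulNr.
Qed.

Lemma geometric_limit (v : nat -> R) (B q : R) : 0 <= B -> 0 <= q < 1 ->
  (forall k, `|v k.+1 - v k| <= B * q ^+ k) ->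
  exists2 l, v n @[n --> \oo] --> l & forall k, `|v k - l| <= B * q ^+ k / (1 - q).
Proof.
move=> B0 /andP[q0 q1] hv.
have d0 : 0 < 1 - q by rewrite subr_gt0.
have hd k m : `|v k - v (k + m)%N| <= B * q ^+ k / (1 - q).
  (* The exact partial geometric sum is kept, as the weaker bound does not carry the induction on
     m. *)
  suff H : `|v k - v (k + m)%N| <= B * q ^+ k * (1 - q ^+ m) / (1 - q).
    apply: le_trans H _; rewrite ler_pM2r ?invr_gt0// ler_piMr ?mulr_ge0 ?exprn_ge0//.
    by rewrite gerBl exprn_ge0.
  elim: m => [|m IH]; first by rewrite addn0 subrr normr0 expr0 subrr mulr0 mul0r.
  have -> : v k - v (k + m.+1)%N = (v k - v (k + m)%N) - (v (k + m).+1 - v (k + m)%N).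
    by rewrite addnS; ring.
  apply: le_trans (ler_normB _ _) _.
  apply: le_trans (lerD IH (hv _)) _.
  rewrite exprD; apply: le_of_eq; rewrite exprS.
  by field; rewrite gt_eqF.
have cv : cvgn v.
  apply/cauchy_cvgP; apply/cauchy_ballP => e e0.
  have hq : B * q ^+ n / (1 - q) @[n --> \oo] --> B * 0 / (1 - q).
    apply: cvgM; last exact: cvg_cst.
    by apply: cvgM; [exact: cvg_cst|apply: cvg_expr; rewrite ger0_norm].
  rewrite mulr0 mul0r in hq.
  have e20 : 0 < e / 2 by rewrite divr_gt0.
  have /cvgrPdist_lt /(_ _ e20) [N _ hN] := hq.
  exists (v @` [set n | (N <= n)%N], v @` [set n | (N <= n)%N]).
    by split; exists N => // n hn; exists n.
  move=> [_ _] /= [[m hm <-] [n hn <-]]; rewrite /ball/=.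
  have hN' := hN N (leqnn N); rewrite /= sub0r normrN in hN'.
  have hh j : (N <= j)%N -> `|v N - v j| < e / 2.
    move=> /subnKC <-; apply: le_lt_trans (hd N _) _.
    by apply: le_lt_trans hN'; exact: ler_norm.
  have -> : v m - v n = (v N - v n) - (v N - v m) by ring.
  by rewrite (le_lt_trans (ler_normB _ _))// [e]splitr ltrD// hh.
exists (limn v) => // k.
have c2 : `|v k - v (k + m)%N| @[m --> \oo] --> `|v k - limn v|.
  apply: cvg_norm; apply: cvgB; first exact: cvg_cst.
  have -> : (fun m => v (k + m)%N) = [sequence v (n + k)%N]_n.
    by apply/funext => m; rewrite addnC.
  by rewrite cvg_shiftn.
rewrite -(cvg_lim (@Rhausdorff R) c2); apply: limr_le; first by apply/cvg_ex; eexists; exact: c2.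
by apply: nearW => m; exact: hd.
Qed.

(* The weighted sum [S] of the squared increments is integrable as 9/16 < 1, and
   where it is finite the increments are at most [sqrt (S x) (2/3)^n]. *)
Lemma L2_complete (u_ : nat -> R -> R) (c : R) : 0 <= c -> (forall n, isL2 (u_ n)) ->
  (forall n, (sqint (fun x => u_ n.+1 x - u_ n x)%R <= (c * 4^-1 ^+ n)%:E)%E) ->
  exists2 u, isL2 u & L2cvg u_ u.
Proof.
move=> c0 u2 hu.
have m1 n : measurable_fun setT (u_ n) by have [] := u2 n.
pose D n x := u_ n.+1 x - u_ n x.
have mD n : measurable_fun setT (D n) by exact: measurable_funB.
pose w n : R := (9 / 4) ^+ n.
have w0 n : 0 <= w n by rewrite exprn_ge0.
pose S x := (\sum_(n <oo) (w n * D n x ^+ 2)%:E)%E.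
have t0 n x : (0 <= (w n * D n x ^+ 2)%:E)%E by rewrite lee_fin mulr_ge0 ?sqr_ge0.
have mt n : measurable_fun setT (fun x => (w n * D n x ^+ 2)%:E).
  by apply/measurable_EFinP; apply: measurable_funM => //; exact: measurable_funX.
have S0 x : (0 <= S x)%E by apply: nneseries_ge0.
have mS : measurable_fun setT S by apply: ge0_emeasurable_sum => // n x _ _.
have iS : (\int[mu]_x S x <= (c * (16 / 7))%:E)%E.
  rewrite /S integral_nneseries//.
  apply: lime_le; first by apply: is_cvg_nneseries => n _ _; exact: integral_ge0.
  apply: nearW => n.
  apply: (@le_trans _ _ (\sum_(0 <= k < n) (c * (9 / 16) ^+ k)%:E)%E).
    apply: lee_sum => k _.
    have -> : (\int[mu]_x (w k * D k x ^+ 2)%:E = (w k)%:E * sqint (D k))%E.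
      rewrite /sqint -ge0_integralZl ?lee_fin//; first exact: measurable_sqr.
      by move=> x _; rewrite lee_fin sqr_ge0.
    apply: le_trans (lee_wpmul2l _ (hu k)) _; first by rewrite lee_fin.
    rewrite -EFinM lee_fin /w mulrCA -exprMn.
    by have -> : 9 / 4 * 4^-1 = 9 / 16 :> R by field.
  rewrite sumEFin lee_fin -mulr_sumr ler_wpM2l//.
  have -> : \sum_(0 <= i < n) (9 / 16 : R) ^+ i = (1 - (9 / 16) ^+ n) * (16 / 7).
    elim: n => [|n IH]; first by rewrite big_geq// expr0 subrr mul0r.
    by rewrite big_nat_recr//= IH exprS; field.
  by rewrite ler_piMl// gerBl exprn_ge0.
pose E := [set x | (S x < +oo)%E].
have mE : measurable E.
  by rewrite /E -[X in measurable X]setTI; exact: emeasurable_fun_infty_o.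
(* Multiplication by the indicator of E makes the sequence converge everywhere. Off E the limit is 0
   and the estimate is trivial because S x is infinite. *)
have lim_ex x : exists l, (u_ n x * \1_E x) @[n --> \oo] --> l /\
    forall k, ((`|u_ k x - l| ^+ 2)%:E <= (9 * (4 / 9) ^+ k)%:E * S x)%E.
  have [xE|xE] := pselect (E x); last first.
    exists 0; split.
      rewrite indicE memNset//; under eq_fun do rewrite mulr0; exact: cvg_cst.
    move=> k; move: xE; rewrite /E/= => /negP; rewrite -leNgt leye_eq => /eqP ->.
    by rewrite gt0_muley ?leey// lte_fin mulr_gt0// exprn_gt0// divr_gt0.
  have sE : S x = (fine (S x))%:E by rewrite fineK// ge0_fin_numE.
  set s := fine (S x) in sE.
  have s0 : 0 <= s by rewrite -lee_fin -sE.
  have hD k : w k * D k x ^+ 2 <= s.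
    rewrite -lee_fin -sE; apply: le_trans (nneseries_lim_ge k.+1 _) => //.
    by rewrite big_nat_recr//= leeDr// sume_ge0.
  have hv k : `|u_ k.+1 x - u_ k x| <= Num.sqrt s * (2 / 3) ^+ k.
    have w1 : 0 < w k by rewrite exprn_gt0// divr_gt0.
    rewrite -ler_sqr ?nnegrE ?mulr_ge0 ?sqrtr_ge0 ?exprn_ge0 ?divr_ge0//.
    rewrite real_normK ?num_real// exprMn sqr_sqrtr// -exprM mulnC exprM.
    rewrite -(ler_pM2l w1); apply: le_trans (hD k) _.
    rewrite mulrCA /w -exprMn.
    have -> : 9 / 4 * (2 / 3) ^+ 2 = 1 :> R by field.
    by rewrite expr1n mulr1.
  have [|l ul hl] := geometric_limit (sqrtr_ge0 s) _ hv.
    by rewrite divr_ge0//= ltr_pdivrMr// mul1r ltr_nat.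
  exists l; split.
    by rewrite indicE mem_set//; under eq_fun do rewrite mulr1.
  move=> k; rewrite sE -EFinM lee_fin.
  have hl2 : `|u_ k x - l| ^+ 2 <= (Num.sqrt s * (2 / 3) ^+ k / (1 - 2 / 3)) ^+ 2.
    rewrite ler_sqr ?nnegrE// divr_ge0 ?mulr_ge0 ?sqrtr_ge0 ?exprn_ge0 ?divr_ge0//.
    by rewrite subr_ge0 ler_pdivrMr// mul1r ler_nat.
  apply: le_trans hl2 _; rewrite exprMn exprMn sqr_sqrtr// -exprM mulnC exprM.
  apply: le_of_eq.
  have -> : ((1 - 2 / 3)^-1) ^+ 2 = 9 :> R by field.
  have -> : (2 / 3) ^+ 2 = 4 / 9 :> R by field.
  by ring.
have [u hu'] := choice lim_ex.
have mu' : measurable_fun setT u.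
  apply: (@measurable_fun_cvg _ _ _ _ (fun n x => u_ n x * \1_E x)).
  - by move=> n; apply: measurable_funM.
  - by move=> x _; exact: (hu' x).1.
have bd k : (sqint (fun x => u_ k x - u x)%R <= (9 * (4 / 9) ^+ k * (c * (16 / 7)))%:E)%E.
  apply: (@le_trans _ _ (\int[mu]_x ((9 * (4 / 9) ^+ k)%:E * S x)%E)%E).
    apply: ge0_le_integral => //.
    - by move=> x _; rewrite lee_fin sqr_ge0.
    - by apply: measurable_sqr; exact: measurable_funB.
    - exact: measurable_funeM.
    - by move=> x _; have := (hu' x).2 k; rewrite real_normK ?num_real.
  rewrite ge0_integralZl ?lee_fin ?mulr_ge0 ?exprn_ge0 ?divr_ge0//.
  apply: le_trans (lee_wpmul2l _ iS) _; last by rewrite -EFinM.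
  by rewrite lee_fin mulr_ge0 ?exprn_ge0 ?divr_ge0.
exists u.
  have -> : u = (fun x => u_ 0%N x - (u_ 0%N x - u x)) by apply/funext => x; rewrite subKr.
  apply: isL2B => //; split; first exact: measurable_funB.
  by apply: le_lt_trans (bd 0%N) _; rewrite ltry.
move=> e e0.
have hq : 9 * (4 / 9) ^+ n * (c * (16 / 7)) @[n --> \oo] --> (9 * 0 * (c * (16 / 7)) : R).
  apply: cvgM; last exact: cvg_cst.
  apply: cvgM; first exact: cvg_cst.
  by apply: cvg_expr; rewrite ger0_norm ?divr_ge0// ltr_pdivrMr// mul1r ltr_nat.
rewrite mulr0 mul0r in hq.
have /cvgrPdist_le /(_ _ e0) := hq; apply: filterS => n.
rewrite sub0r normrN => h; apply: le_trans (bd n) _; rewrite lee_fin.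
by apply: le_trans h; exact: ler_norm.
Qed.

(** Truncations of f to [-n, n] lie in L^1 and L^2. A subsequence converging at the rate 4^-k is
    extracted; by Plancherel's inequality the increments of its transforms decay at the same rate,
    and completeness supplies the limits. *)
Lemma ft_exists f : isL2 f -> exists a b, ft f a b.
Proof.
move=> f2; have [mf _] := f2.
pose t n x := f x * \1_`[- n%:R, n%:R] x.
have mt n : measurable_fun setT (t n) by apply: measurable_funM.
have t2 n : isL2 (t n).
  apply: (isL2_le (mt n) f2) => x; rewrite normrM ler_piMr//.
  by rewrite indicE; case: (x \in _); rewrite ?normr1 ?normr0.
have t1 n : L1 (t n).
  apply: isL2_mul => //; split; first exact: measurable_indic.
  rewrite /sqint; have := integrable_indic_itv (- n%:R : R) n%:R true false.
  move=> /(integrable_lty measurableT)/=; apply: le_lt_trans; apply: ge0_le_integral => //.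
  - by apply: measurable_sqr; exact: measurable_indic.
  - by apply/measurable_EFinP; exact: measurable_indic.
  - by move=> x _; rewrite lee_fin indicE; case: (x \in _); rewrite ?expr1n ?expr0n.
have tail : forall e, 0 < e -> exists n, (sqint (fun x => t n x - f x)%R <= e%:E)%E.
  move=> e e0.
  have : (\int[mu]_x ((t n x - f x) ^+ 2)%:E)%E @[n --> \oo] --> (\int[mu]_x (cst 0%E x))%E.
    apply: (@dominated_cvg _ _ R mu setT measurableT
      (fun n x => ((t n x - f x) ^+ 2)%:E) (cst 0%E) (fun x => (f x ^+ 2)%:E)) => //.
    - by move=> n; apply: measurable_sqr; exact: measurable_funB.
    - move=> x _; apply: cvg_near_cst.
      near=> n; rewrite /t indicE mem_set ?mulr1 ?subrr ?expr0n//=.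
      rewrite in_itv/= -ler_norml; near: n; exact: nbhs_infty_ger.
    - exact: isL2_integrable.
    - move=> n x _; rewrite lee_fin /t indicE ger0_norm ?sqr_ge0//.
      case: (x \in _); rewrite ?mulr1 ?mulr0 ?subrr ?sub0r ?sqrrN//.
      by rewrite expr0n sqr_ge0.
  rewrite integral0 => /fine_cvgP[h1 /cvgrPdist_le /(_ _ e0) h2].
  near \oo => n; exists n.
  have h1n : (\int[mu]_x ((t n x - f x) ^+ 2)%:E)%E \is a fin_num by near: n.
  have : `|0 - fine (\int[mu]_x ((t n x - f x) ^+ 2)%:E)%E| <= e by near: n.
  rewrite sub0r normrN => h; rewrite /sqint -(fineK h1n) lee_fin.
  by apply: le_trans h; exact: ler_norm.
have [N hN] := choice (fun k : nat => tail (4^-1 ^+ k) (exprn_gt0 k (ltac:(by []) : 0 < 4^-1 :> R))).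
pose h k := t (N k).
have h1 k : L1 (h k) by exact: t1.
have h2 k : isL2 (h k) by exact: t2.
have mh k : measurable_fun setT (h k) by exact: mt.
have fh : L2cvg h f.
  move=> e e0.
  have : (4^-1 : R) ^+ k @[k --> \oo] --> 0.
    by apply: cvg_expr; rewrite ger0_norm// invf_lt1// ltr1n.
  move=> /cvgrPdist_le /(_ _ e0); apply: filterS => k; rewrite sub0r normrN => hk.
  apply: le_trans (hN k) _; rewrite lee_fin; apply: le_trans hk; exact: ler_norm.
have step k : (sqint (fun x => h k.+1 x - h k x)%R <= (4 * 4^-1 ^+ k)%:E)%E.
  have -> : sqint (fun x => h k.+1 x - h k x) = sqint (fun x => (h k.+1 x - f x) - (h k x - f x)).
    by apply: eq_integral => x _; congr (_ ^+ 2)%:E; ring.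
  apply: le_trans (sqintB _ _) _; [exact: measurable_funB|exact: measurable_funB|].
  apply: (@le_trans _ _ (2%:E * (4^-1 ^+ k)%:E + 2%:E * (4^-1 ^+ k)%:E)%E); last first.
    by rewrite -!EFinM -EFinD lee_fin; apply: le_of_eq; ring.
  rewrite leeD// lee_wpmul2l//.
    apply: le_trans (hN k.+1) _; rewrite lee_fin exprS ler_piMl ?exprn_ge0//.
    by rewrite invf_le1// ler1n.
  exact: hN.
have pi0 : 0 < pi :> R by exact: pi_gt0.
have both k : (sqint (fun x => cosint (h k.+1) x - cosint (h k) x)%R <= (8 * pi * 4^-1 ^+ k)%:E)%E /\
    (sqint (fun x => sinint (h k.+1) x - sinint (h k) x)%R <= (8 * pi * 4^-1 ^+ k)%:E)%E.
  have := plancherel_le (L1B (h1 k.+1) (h1 k)) (isL2B (h2 k.+1) (h2 k)).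
  have -> : sqint (cosint (fun x => h k.+1 x - h k x)) = sqint (fun x => cosint (h k.+1) x - cosint (h k) x).
    by apply: eq_integral => x _; rewrite cosintB.
  have -> : sqint (sinint (fun x => h k.+1 x - h k x)) = sqint (fun x => sinint (h k.+1) x - sinint (h k) x).
    by apply: eq_integral => x _; rewrite sinintB.
  have hb : ((2 * pi)%:E * sqint (fun x => h k.+1 x - h k x)%R <= (8 * pi * 4^-1 ^+ k)%:E)%E.
    apply: le_trans (lee_wpmul2l _ (step k)) _; first by rewrite lee_fin mulr_ge0// ltW.
    by rewrite -EFinM lee_fin; apply: le_of_eq; ring.
  move=> H; split; apply: le_trans (le_trans _ H) hb; first by rewrite leeDl// sqint_ge0.
  by rewrite leeDr// sqint_ge0.
have c2 k : isL2 (cosint (h k)) /\ isL2 (sinint (h k)).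
  have H := plancherel_le (h1 k) (h2 k).
  have Hy : ((2 * pi)%:E * sqint (h k) < +oo)%E.
    by rewrite lte_mul_pinfty// ?lee_fin ?mulr_ge0 ?(ltW pi0)//; have [] := h2 k.
  split; [split; first exact: measurable_cosint|split; first exact: measurable_sinint].
    by apply: le_lt_trans (le_trans _ H) Hy; rewrite leeDl// sqint_ge0.
  by apply: le_lt_trans (le_trans _ H) Hy; rewrite leeDr// sqint_ge0.
have [a a2 ha] := L2_complete (mulr_ge0 (ler0n _ 8) (ltW pi0)) (fun k => (c2 k).1) (fun k => (both k).1).
have [b b2 hb] := L2_complete (mulr_ge0 (ler0n _ 8) (ltW pi0)) (fun k => (c2 k).2) (fun k => (both k).2).
by exists a, b; split => //; exists h; split.
Unshelve. all: by end_near. Qed.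

End FourierL2.

(** * Analyticity and exponential decay of the transform *)

Section SpectralDecay.
Context {R : realType}.
Local Notation mu := (@lebesgue_measure R).
Local Notation L1 f := (mu.-integrable setT (EFin \o f)).
Implicit Types (f g a b : R -> R) (h : R).

(* [f_ n] is the function [f_ 0]^(n) / n! of Taylor coefficients. *)
Definition tower (f_ : nat -> R -> R) :=
  forall n (x : R), is_derive x 1 (f_ n) (n.+1%:R * f_ n.+1 x).

Lemma tower_continuous (f_ : nat -> R -> R) n : tower f_ -> continuous (f_ n).
Proof. by move=> tf x; apply: ider_continuous (tf n x). Qed.

Lemma tower_measurable (f_ : nat -> R -> R) n : tower f_ -> measurable_fun setT (f_ n).
Proof. by move=> tf; apply: continuous_measurable_fun; exact: tower_continuous. Qed.

(** The Cauchy-Schwarz inequality for the integral of g' over [x, x + h]. *)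
Lemma sqr_increment (g g' : R -> R) h (x : R) : 0 < h ->
  (forall y : R, is_derive y 1 g (g' y)) -> continuous g' ->
  (((g (x + h) - g x) ^+ 2)%:E <= h%:E * \int[mu]_(t in `[0%R, h]) ((g' (x + t)) ^+ 2)%:E)%E.
Proof.
move=> h0 dg cg.
have cx : continuous (fun t => g' (x + t)).
  move=> t; apply: (@continuous_comp _ _ _ (fun t => x + t) g'); last exact: cg.
  by apply: cvgD; [exact: cvg_cst|exact: cvg_id].
have dx (t : R) : is_derive t 1 (fun t => g (x + t)) (g' (x + t)).
  have := @ider_comp _ g (fun t => x + t) t (g' (x + t)) 1 (dg _).
  rewrite mulr1; apply; eapply is_derive_eq; [by ider|by rewrite add0r].
have ctx : continuous (fun t => g (x + t)) by move=> t; apply: ider_continuous (dx t).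
have F2 : (\int[mu]_(t in `[0%R, h]) (g' (x + t))%:E = (g (x + h))%:E - (g (x + 0))%:E)%E.
  apply: (@continuous_FTC2 _ (fun t => g' (x + t)) (fun t => g (x + t))) => //.
  - exact: continuous_subspaceT.
  - split.
    + by move=> t _; apply: ider_derivable (dx t).
    + exact/cvg_at_right_filter/ctx.
    + exact/cvg_at_left_filter/ctx.
  - by move=> t _; apply: ider_derive1.
rewrite addr0 in F2.
have mg : measurable_fun `[0, h] (fun t => g' (x + t)).
  by apply: measurable_funTS; exact: continuous_measurable_fun.
have mi : measurable (`[0%R, h]%classic : set (measurableTypeR R)) by exact: measurable_itv.
set A := g (x + h) - g x.
(* The mean slope: integrating (c - g')^2 >= 0 over the interval is the Cauchy-Schwarz
   inequality. *)
pose c := A / h.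
have i1 : mu.-integrable `[0, h] (EFin \o (fun t => g' (x + t))).
  apply: continuous_compact_integrable; first exact: segment_compact.
  exact: continuous_subspaceT.
have i2 : mu.-integrable `[0, h] (EFin \o (fun t => g' (x + t) ^+ 2)).
  apply: continuous_compact_integrable; first exact: segment_compact.
  apply: continuous_subspaceT => t; apply: (@continuous_comp _ _ _ _ (fun z : R => z ^+ 2)).
    exact: cx.
  exact: exprn_continuous.
have ic : mu.-integrable `[0, h] (EFin \o cst (c ^+ 2)).
  apply: continuous_compact_integrable; first exact: segment_compact.
  by apply: continuous_subspaceT => t; exact: cvg_cst.
have r1 : \int[mu]_(t in `[0%R, h]) g' (x + t) = A.
  by rewrite /Rintegral F2.
have r3 : \int[mu]_(t in `[0%R, h]) cst (c ^+ 2) t = c ^+ 2 * h.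
  rewrite Rintegral_cst//; congr (_ * _).
  have := lebesgue_measure_itv `[0, h]; rewrite /= lte_fin h0 sube0 => mI.
  exact: (congr1 fine mI).
have : \int[mu]_(t in `[0%R, h]) (2 * c * g' (x + t)) <=
    \int[mu]_(t in `[0%R, h]) (cst (c ^+ 2) t + g' (x + t) ^+ 2).
  apply: le_Rintegral => //.
  - by have := integrableZl mi (2 * c) i1.
  - by have := integrableD mi ic i2.
  - by move=> t _ /=; have := sqr_ge0 (c - g' (x + t)); lra.
rewrite RintegralZl// RintegralD// r1 r3 => H.
have -> : (\int[mu]_(t in `[0%R, h]) (g' (x + t) ^+ 2)%:E =
    (\int[mu]_(t in `[0%R, h]) (g' (x + t) ^+ 2))%:E)%E.
  by rewrite /Rintegral fineK//; exact: integrable_fin_num.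
rewrite -EFinM lee_fin -ler_pdivrMl//.
move: H; rewrite /c.
have -> : 2 * (A / h) * A = 2 * (h^-1 * A ^+ 2) by field; rewrite gt_eqF.
have -> : (A / h) ^+ 2 * h = h^-1 * A ^+ 2 by field; rewrite gt_eqF.
by lra.
Qed.

(** Integrating [sqr_increment] in x and exchanging the integrals, each t in [0, h] contributes the
    translation-invariant quantity [sqint g']; this is the second factor h. *)
Lemma sqint_increment (g g' : R -> R) h : 0 < h ->
  (forall y : R, is_derive y 1 g (g' y)) -> continuous g' ->
  (sqint (fun x => g (x + h) - g x)%R <= (h ^+ 2)%:E * sqint g')%E.
Proof.
move=> h0 dg cg.
have mg' : measurable_fun setT g' by exact: continuous_measurable_fun.
have mg : measurable_fun setT g.
  by apply: continuous_measurable_fun => x; apply: ider_continuous (dg x).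
pose F x t : \bar R := ((g' (x + t)) ^+ 2 * \1_`[0, h] t)%:E.
have mF : measurable_fun setT (fun z => F z.1 z.2).
  apply/measurable_EFinP; apply: measurable_funM.
    apply: measurable_funX; apply: measurableT_comp => //.
    exact: measurable_funD.
  by apply: measurableT_comp => //; exact: measurable_indic.
have F0 x t : (0 <= F x t)%E by rewrite lee_fin mulr_ge0 ?sqr_ge0.
have FE x : (\int[mu]_(t in `[0%R, h]) ((g' (x + t)) ^+ 2)%:E = \int[mu]_t F x t)%E.
  rewrite integral_mkcond; apply: eq_integral => t _.
  by rewrite /F patchE indicE; case: (t \in _); rewrite ?mulr1 ?mulr0.
apply: (@le_trans _ _ (\int[mu]_x (h%:E * \int[mu]_t F x t))%E).
  apply: ge0_le_integral => //.
  - by move=> x _; rewrite lee_fin sqr_ge0.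
  - by apply: measurable_sqr; apply: measurable_funB => //; exact: measurable_shift.
  - by apply: measurable_funeM; exact: (measurable_integral2 mF (fun z => F0 z.1 z.2)).
  - by move=> x _; rewrite -FE; exact: sqr_increment.
rewrite ge0_integralZl//; last 3 first.
- exact: (measurable_integral2 mF (fun z => F0 z.1 z.2)).
- by move=> x _; exact: integral_ge0.
- by rewrite lee_fin ltW.
rewrite (tonelli mF F0).
have -> : (\int[mu]_t \int[mu]_x F x t = \int[mu]_t ((\1_`[0, h] t)%:E * sqint g'))%E.
  apply: eq_integral => t _; rewrite -(sqint_shift t mg') /sqint -ge0_integralZl ?lee_fin//.
  - by apply: eq_integral => x _; rewrite /F EFinM muleC.
  - by apply: measurable_sqr; exact: measurable_shift.
  - by move=> x _; rewrite lee_fin sqr_ge0.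
rewrite ge0_integralZr ?sqint_ge0//; last by apply/measurable_EFinP; exact: measurable_indic.
have -> : (\int[mu]_t (\1_`[0%R, h] t)%:E = h%:E)%E.
  rewrite integral_indic// setIT; have := lebesgue_measure_itv `[0, h].
  by rewrite /= lte_fin h0 sube0.
by rewrite muleA -EFinM expr2.
Qed.

(** The iterated forward difference of step h. It commutes with differentiation, and [ft] is stable
    under it, being stable under translation and subtraction. *)
Fixpoint incr h n f : R -> R :=
  if n is n'.+1 then (fun x => incr h n' f (x + h) - incr h n' f x) else f.

Lemma incr_derive h n f f' : (forall y : R, is_derive y 1 f (f' y)) ->
  forall y : R, is_derive y 1 (incr h n f) (incr h n f' y).
Proof.
move=> df; elim: n => [|n IH] y //=; apply: iderB => //.
have := @ider_comp _ (incr h n f) (fun t => t + h) y (incr h n f' (y + h)) 1 (IH _).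
rewrite mulr1; apply; eapply is_derive_eq; [by ider|by rewrite addr0].
Qed.

Lemma incrZ h n f k x : incr h n (fun y => k * f y) x = k * incr h n f x.
Proof. by elim: n x => [|n IH] x //=; rewrite !IH mulrBr. Qed.

Lemma incr_continuous h n f : continuous f -> continuous (incr h n f).
Proof.
move=> cf; elim: n => [|n IH] //= x; apply: cvgB; last exact: IH.
apply: (@continuous_comp _ _ _ (fun t => t + h) (incr h n f)); last exact: IH.
by apply: cvgD; [exact: cvg_id|exact: cvg_cst].
Qed.

(** Each difference costs a factor h and one derivative. The quotient (m+n)! / m! relates the n-th
    derivative of [f_ m] to the normalised coefficient [f_ (m + n)]. *)
Lemma sqint_incr_tower (f_ : nat -> R -> R) h n m : 0 < h -> tower f_ ->
  (sqint (incr h n (f_ m)) <= ((h ^+ n * ((m + n)`!%:R / m`!%:R)) ^+ 2)%:E * sqint (f_ (m + n)%N))%E.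
Proof.
move=> h0 tf; elim: n m => [|n IH] m.
  by rewrite addn0 divff ?pnatr_eq0 -?lt0n ?fact_gt0// expr0 mulr1 expr1n mul1e.
have cm : continuous (fun x => m.+1%:R * f_ m.+1 x).
  by move=> x; apply: cvgM; [exact: cvg_cst|exact: tower_continuous].
have := sqint_increment h0 (incr_derive h n (tf m)) (@incr_continuous h n _ cm).
move=> /le_trans; apply.
have -> : incr h n (fun x => m.+1%:R * f_ m.+1 x) = fun x => m.+1%:R * incr h n (f_ m.+1) x.
  by apply/funext => x; rewrite incrZ.
rewrite sqintZ; last first.
  by apply: continuous_measurable_fun; apply: incr_continuous; exact: tower_continuous.
rewrite muleA -EFinM; apply: le_trans (lee_wpmul2l _ (IH m.+1)) _.
  by rewrite lee_fin mulr_ge0 ?sqr_ge0.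
rewrite addSnnS muleA -EFinM lee_wpmul2r ?sqint_ge0// lee_fin; apply: le_of_eq.
rewrite -!exprMn; congr (_ ^+ 2).
rewrite exprS [in RHS](_ : m`!%:R = m.+1`!%:R / m.+1%:R :> R); last first.
  by rewrite factS natrM mulrC mulKf// pnatr_eq0.
have hA : m.+1%:R != 0 :> R by rewrite pnatr_eq0.
have hB : m.+1`!%:R != 0 :> R by rewrite pnatr_eq0 -lt0n fact_gt0.
move: hA hB; set A : R := m.+1%:R; set B : R := m.+1`!%:R; move=> hA hB.
by rewrite invf_div; ring.
Qed.

(** One difference multiplies the transform by e^{i h xi} - 1, whose squared modulus is 2 - 2 cos (h
    xi). *)
Lemma ft_incr h n f a b : ft f a b -> exists a' b', ft (incr h n f) a' b' /\
  forall xi, a' xi ^+ 2 + b' xi ^+ 2 = (a xi ^+ 2 + b xi ^+ 2) * (2 - 2 * cos (h * xi)) ^+ n.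
Proof.
move=> fab; elim: n => [|n [a' [b' [ft' E]]]].
  by exists a, b; split => // xi; rewrite mulr1.
eexists; eexists; split; first exact: (ftB (ft_shift h ft') ft').
move=> xi /=.
rewrite [_ ^+ n.+1]exprSr mulrA -E; have := cos2Dsin2 (h * xi).
set C := cos _; set S := sin _ => H.
have -> : (C * a' xi + S * b' xi - a' xi) ^+ 2 + (C * b' xi - S * a' xi - b' xi) ^+ 2 =
    (a' xi ^+ 2 + b' xi ^+ 2) * ((C ^+ 2 + S ^+ 2) + 1 - 2 * C) by ring.
by rewrite H; ring.
Qed.

Lemma lipschitz_bound f f' (L : R) : (forall y : R, is_derive y 1 f (f' y)) ->
  (forall y, `|f' y| <= L) -> forall y z, `|f y - f z| <= L * `|y - z|.
Proof.
move=> df bf; have cf y : {for y, continuous f} by apply: ider_continuous (df y).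
have key y z : z <= y -> `|f y - f z| <= L * `|y - z|.
  move=> zy; have [] := @MVT_segment R f f' z y zy (fun t _ => df t).
    exact: continuous_subspaceT.
  by move=> t _ ->; rewrite normrM ler_wpM2r.
move=> y z; have [zy|/ltW yz] := leP z y; first exact: key.
by rewrite distrC [`|y - z|]distrC key.
Qed.

Lemma quadratic_bound f f' (L : R) : (forall y : R, is_derive y 1 f (f' y)) ->
  (forall y z, `|f' y - f' z| <= L * `|y - z|) ->
  forall x h, `|f (x + h) - f x - h * f' x| <= L * h ^+ 2.
Proof.
move=> df bf x h.
pose g y := f y - (y - x) * f' x.
have dg (y : R) : is_derive y 1 g (f' y - f' x).
  have d2 : is_derive y 1 (fun y => (y - x) * f' x) (f' x).
    by eapply is_derive_eq; [by ider|rewrite /GRing.scale/=; ring].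
  exact: (iderB (df y) d2).
have cg : continuous g by move=> y; apply: ider_continuous (dg y).
have -> : f (x + h) - f x - h * f' x = g (x + h) - g x by rewrite /g; ring.
have L0 : 0 <= L by have := bf 1 0; rewrite subr0 normr1 mulr1; exact: le_trans.
have key (a b : R) : a <= b -> (forall t, t \in `[a, b] -> `|t - x| <= `|h|) -> b - a = `|h| ->
    `|g b - g a| <= L * h ^+ 2.
  move=> ab hab e; have [] := @MVT_segment R g (fun t => f' t - f' x) a b ab (fun t _ => dg t).
    exact: continuous_subspaceT.
  move=> t tab ->; rewrite e normrM normr_id -(real_normK (num_real h)) expr2 mulrA.
  rewrite ler_wpM2r// (le_trans (bf _ _))// ler_wpM2l//; exact: hab.
have [h0|/ltW h0] := leP 0 h.
- apply: key; first by rewrite lerDl.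
  + move=> t; rewrite in_itv/= => /andP[? ?]; rewrite !ger0_norm//; lra.
  + by rewrite ger0_norm//; ring.
- rewrite distrC; apply: key; first by rewrite gerDl.
  + move=> t; rewrite in_itv/= => /andP[? ?]; rewrite !ler0_norm//; lra.
  + by rewrite ler0_norm//; ring.
Qed.

Lemma sin_lipschitz (y z : R) : `|sin y - sin z| <= `|y - z|.
Proof.
rewrite -[leRHS]mul1r; apply: (@lipschitz_bound sin cos) => t.
exact: normr_cos.
Qed.

Lemma cos_lipschitz (y z : R) : `|cos y - cos z| <= `|y - z|.
Proof.
rewrite -[leRHS]mul1r; apply: (@lipschitz_bound cos (fun t => - sin t)) => t.
by rewrite normrN normr_sin.
Qed.

Lemma sin_quadratic (x h : R) : `|sin (x + h) - sin x - h * cos x| <= h ^+ 2.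
Proof.
rewrite -[leRHS]mul1r; apply: (@quadratic_bound sin cos) => y z.
by rewrite mul1r cos_lipschitz.
Qed.

Lemma cos_quadratic (x h : R) : `|cos (x + h) - cos x - h * - sin x| <= h ^+ 2.
Proof.
rewrite -[leRHS]mul1r; apply: (@quadratic_bound cos (fun t => - sin t)) => y z.
by rewrite mul1r -opprD normrN sin_lipschitz.
Qed.

(** By the half-angle formula the expression is the square of 2 (k+1) sin (xi / (2 (k+1))): the
    symbol of a difference quotient of step 1/(k+1) tends to that of the derivative. *)
Lemma cvg_2M2cos (xi : R) :
  (2 - 2 * cos (k.+1%:R^-1 * xi)) * k.+1%:R ^+ 2 @[k --> \oo] --> xi ^+ 2.
Proof.
have -> : (fun k => (2 - 2 * cos (k.+1%:R^-1 * xi)) * k.+1%:R ^+ 2) =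
    (fun k => (2 * k.+1%:R * sin (k.+1%:R^-1 * (xi / 2))) ^+ 2).
  apply/funext => k.
  have -> : k.+1%:R^-1 * xi = k.+1%:R^-1 * (xi / 2) + k.+1%:R^-1 * (xi / 2) by field; rewrite addrC natr1 pnatr_eq0.
  rewrite cosD; have := cos2Dsin2 (k.+1%:R^-1 * (xi / 2)).
  set C := cos _; set S := sin _ => H.
  have -> : C * C = 1 - S ^+ 2 by rewrite -H; ring.
  by ring.
have h : 2 * k.+1%:R * sin (k.+1%:R^-1 * (xi / 2)) @[k --> \oo] --> xi.
  apply/subr_cvg0; apply/norm_cvg0P.
  apply: (@squeeze_cvgr _ _ _ _ (fun=> 0) (fun k : nat => xi ^+ 2 / 2 * k.+1%:R^-1)).
  - apply: nearW => k; rewrite normr_ge0/=.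
    have := sin_quadratic 0 (k.+1%:R^-1 * (xi / 2)).
    rewrite add0r sin0 cos0 subr0 mulr1 => H.
    have k0 : 0 < k.+1%:R :> R by rewrite ltr0n.
    have -> : 2 * k.+1%:R * sin (k.+1%:R^-1 * (xi / 2)) - xi =
        2 * k.+1%:R * (sin (k.+1%:R^-1 * (xi / 2)) - k.+1%:R^-1 * (xi / 2)).
      by field; rewrite addrC natr1 gt_eqF.
    have k2 : 0 <= 2 * k.+1%:R :> R by rewrite mulr_ge0// ltW.
    rewrite normrM (ger0_norm k2).
    apply: le_trans (ler_wpM2l k2 H) _.
    apply: le_of_eq; field.
    by rewrite addrC natr1 gt_eqF.
  - exact: cvg_cst.
  - rewrite -[X in _ --> X](mulr0 (xi ^+ 2 / 2)); apply: cvgM; first exact: cvg_cst.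
    exact: cvg_harmonic.
exact: (cvg_comp _ _ h (@exprn_continuous _ 2 xi)).
Qed.

(** Plancherel's inequality for the n-th difference quotients of step 1/(k+1), followed by Fatou's
    lemma in k. The n-th derivative is n! times [f_ n], and 16 pi adds up the two constants 8 pi for
    a and for b. *)
Lemma ft_tower_moment (f_ : nat -> R -> R) a b n : tower f_ -> ft (f_ 0%N) a b ->
  (\int[mu]_xi (xi ^+ (2 * n) * (a xi ^+ 2 + b xi ^+ 2))%:E <=
   (16 * pi * n`!%:R ^+ 2)%:E * sqint (f_ n))%E.
Proof.
move=> tf fab; have [_ [ma _] [mb _] _] := fab.
have mab : measurable_fun setT (fun xi => a xi ^+ 2 + b xi ^+ 2).
  by apply: measurable_funD; exact: measurable_funX.
apply: (@fatou_le _ _ R mu (fun k xi => ((a xi ^+ 2 + b xi ^+ 2) *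
   ((2 - 2 * cos (k.+1%:R^-1 * xi)) * k.+1%:R ^+ 2) ^+ n)%:E)
   (fun xi => (xi ^+ (2 * n) * (a xi ^+ 2 + b xi ^+ 2))%:E)).
- move=> k; apply/measurable_EFinP; apply: measurable_funM => //; apply: measurable_funX.
  apply: measurable_funM => //; apply: measurable_funB => //; apply: measurable_funM => //.
  exact: measurable_cos_lin.
- move=> k xi; rewrite lee_fin mulr_ge0 ?addr_ge0 ?sqr_ge0// exprn_ge0// mulr_ge0 ?sqr_ge0//.
- move=> xi; apply: cvg_EFin; first exact: nearW.
  rewrite mulrC exprM; apply: cvgM; first exact: cvg_cst.
  have := cvg_comp _ _ (@cvg_2M2cos xi) (@exprn_continuous R n (xi ^+ 2)).
  by apply.
move=> k; pose h : R := k.+1%:R^-1.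
have h0 : 0 < h by rewrite invr_gt0.
have [a' [b' [ft' E]]] := ft_incr h n fab.
have [_ [ma' _] [mb' _] _] := ft'.
have [ba bb] := ft_bound ft'.
have hk : (h ^+ n) ^+ 2 * (k.+1%:R ^+ 2) ^+ n = 1.
  by rewrite exprAC -exprMn -exprMn /h mulVf ?expr1n// pnatr_eq0.
have -> : (\int[mu]_xi ((a xi ^+ 2 + b xi ^+ 2) *
    ((2 - 2 * cos (k.+1%:R^-1 * xi)) * k.+1%:R ^+ 2) ^+ n)%:E =
    ((k.+1%:R ^+ 2) ^+ n)%:E * (sqint a' + sqint b'))%E.
  rewrite /sqint -ge0_integralD//; last 4 first.
  - by move=> x _; rewrite lee_fin sqr_ge0.
  - exact: measurable_sqr.
  - by move=> x _; rewrite lee_fin sqr_ge0.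
  - exact: measurable_sqr.
  rewrite -ge0_integralZl//; last 2 first.
  - by apply: emeasurable_funD; exact: measurable_sqr.
  - by move=> x _; rewrite -EFinD lee_fin addr_ge0 ?sqr_ge0.
  apply: eq_integral => xi _; rewrite -EFinD -EFinM E; congr EFin.
  by rewrite exprMn; ring.
have T := sqint_incr_tower n 0 h0 tf.
rewrite add0n fact0 divr1 in T.
have pi0 : 0 <= 8 * pi :> R by rewrite mulr_ge0 ?pi_ge0.
apply: (@le_trans _ _ (((k.+1%:R ^+ 2) ^+ n)%:E * ((16 * pi)%:E * sqint (incr h n (f_ 0%N))))%E).
  apply: lee_wpmul2l; first by rewrite lee_fin exprn_ge0// sqr_ge0.
  have -> : 16 * pi = 8 * pi + 8 * pi :> R by ring.
  rewrite EFinD ge0_muleDl ?lee_fin//; exact: leeD.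
apply: (@le_trans _ _ (((k.+1%:R ^+ 2) ^+ n)%:E * ((16 * pi)%:E * (((h ^+ n * n`!%:R) ^+ 2)%:E * sqint (f_ n))))%E).
  apply: lee_wpmul2l; first by rewrite lee_fin exprn_ge0// sqr_ge0.
  by apply: lee_wpmul2l => //; rewrite lee_fin mulr_ge0 ?pi_ge0.
rewrite !muleA -!EFinM lee_wpmul2r ?sqint_ge0// lee_fin; apply: le_of_eq.
rewrite [(h ^+ n * _) ^+ 2]exprMn.
apply: (@etrans _ _ ((h ^+ n) ^+ 2 * (k.+1%:R ^+ 2) ^+ n * (16 * pi * n`!%:R ^+ 2))); last by rewrite hk mul1r.
by move: ((h ^+ n) ^+ 2) ((k.+1%:R ^+ 2) ^+ n) (n`!%:R ^+ 2) => x y z; ring.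
Qed.

(** Cauchy-Schwarz with the weights q^n, whose total is at most 1/(1-q). The induction carries the
    exact partial total (1 - q^N)/(1 - q); its step is a completed square. *)
Lemma weighted_cauchy (q : R) (x : nat -> R) N : 0 < q < 1 -> (forall n, 0 <= x n) ->
  (\sum_(n < N) x n) ^+ 2 <= (1 - q)^-1 * \sum_(n < N) (q^-1 ^+ n * x n ^+ 2).
Proof.
move=> /andP[q0 q1] x0.
have d0 : 0 < 1 - q by rewrite subr_gt0.
suff H : (\sum_(n < N) x n) ^+ 2 <= (1 - q ^+ N) / (1 - q) * \sum_(n < N) (q^-1 ^+ n * x n ^+ 2).
  apply: le_trans H _; apply: ler_wpM2r.
    by apply: sumr_ge0 => n _; rewrite mulr_ge0 ?sqr_ge0// exprn_ge0// invr_ge0 ltW.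
  by rewrite ler_piMl ?invr_ge0 ?(ltW d0)// gerBl exprn_ge0// ltW.
elim: N => [|N IH]; first by rewrite !big_ord0 expr0n mulr0.
rewrite !big_ord_recr/=; move: IH.
set S := \sum_(n < N) x n; set T := \sum_(n < N) _ => IH.
have qN : 0 < q ^+ N by rewrite exprn_gt0.
set Q := q ^+ N in IH qN *; set y := x N.
have Q1 : Q <= 1 by rewrite exprn_ile1// ltW.
have -> : q^-1 ^+ N = Q^-1 by rewrite exprVn.
have -> : (1 - q ^+ N.+1) / (1 - q) = (1 - Q) / (1 - q) + Q.
  by rewrite exprS -/Q; field; rewrite gt_eqF.
set G := (1 - Q) / (1 - q) in IH *.
have G0 : 0 <= G by rewrite divr_ge0// ?subr_ge0// ltW.
have T0 : 0 <= T.
  by apply: sumr_ge0 => n _; rewrite mulr_ge0 ?sqr_ge0// exprn_ge0// invr_ge0 ltW.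
have y0 : 0 <= y by exact: x0.
have S0 : 0 <= S by apply: sumr_ge0 => n _; exact: x0.
suff H2 : 2 * S * y <= G * (Q^-1 * y ^+ 2) + Q * T.
  have -> : (G + Q) * (T + Q^-1 * y ^+ 2) = G * T + (G * (Q^-1 * y ^+ 2) + Q * T) + y ^+ 2.
    by field; rewrite gt_eqF.
  have -> : (S + y) ^+ 2 = S ^+ 2 + 2 * S * y + y ^+ 2 by ring.
  by rewrite lerD2r lerD.
have Z0 : 0 <= Q^-1 * y ^+ 2 by rewrite mulr_ge0 ?sqr_ge0// invr_ge0 ltW.
have P0 : 0 <= G * (Q^-1 * y ^+ 2) + Q * T by rewrite addr_ge0// mulr_ge0// ltW.
have P1 : 0 <= 2 * S * y by rewrite mulr_ge0// mulr_ge0.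
rewrite -ler_sqr ?nnegrE//.
apply: (@le_trans _ _ (4 * (G * T) * y ^+ 2)).
  have -> : (2 * S * y) ^+ 2 = 4 * S ^+ 2 * y ^+ 2 by ring.
  by rewrite ler_wpM2r ?sqr_ge0// ler_wpM2l.
rewrite -subr_ge0; have -> : (G * (Q^-1 * y ^+ 2) + Q * T) ^+ 2 - 4 * (G * T) * y ^+ 2 =
  (G * (Q^-1 * y ^+ 2) - Q * T) ^+ 2 by field; rewrite gt_eqF.
exact: sqr_ge0.
Qed.

(** The exponential is expanded in powers of sigma |xi|, and [weighted_cauchy] with q = sigma / rho
    reduces its square to moments. The n! of the moment bound cancels that of the series and leaves
    q^n, whose sum is the second factor 1/(1-q). *)
Lemma ft_tower_exp (f_ : nat -> R -> R) a b (rho sigma c : R) : 0 < sigma < rho ->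
  tower f_ -> ft (f_ 0%N) a b ->
  (forall n, sqint (f_ n) <= ((c * rho^-1 ^+ n) ^+ 2)%:E)%E ->
  (\int[mu]_xi (expR (sigma * `|xi|) ^+ 2 * (a xi ^+ 2 + b xi ^+ 2))%:E <=
   (16 * pi * (1 - sigma / rho)^-1 ^+ 2 * c ^+ 2)%:E)%E.
Proof.
move=> /andP[s0 sr] tf fab hf.
have r0 : 0 < rho by exact: lt_trans sr.
set q := sigma / rho.
have q0 : 0 < q by rewrite divr_gt0.
have q1 : q < 1 by rewrite ltr_pdivrMr// mul1r.
have q01 : 0 < q < 1 by rewrite q0.
have d0 : 0 < 1 - q by rewrite subr_gt0.
have pi0 : 0 < pi :> R by exact: pi_gt0.
have [_ [ma _] [mb _] _] := fab.
have mab : measurable_fun setT (fun xi => a xi ^+ 2 + b xi ^+ 2).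
  by apply: measurable_funD; exact: measurable_funX.
have ab0 xi : 0 <= a xi ^+ 2 + b xi ^+ 2 by rewrite addr_ge0 ?sqr_ge0.
pose t n (xi : R) := (sigma * `|xi|) ^+ n / n`!%:R.
have t0 n xi : 0 <= t n xi by rewrite divr_ge0// exprn_ge0// mulr_ge0// ltW.
have mt n : measurable_fun setT (t n).
  apply: measurable_funM => //; apply: measurable_funX; apply: measurable_funM => //.
have f0 n : 0 < n`!%:R :> R by rewrite ltr0n fact_gt0.
apply: (@fatou_le _ _ R mu (fun N xi => ((\sum_(n < N) t n xi) ^+ 2 * (a xi ^+ 2 + b xi ^+ 2))%:E)
  (fun xi => (expR (sigma * `|xi|) ^+ 2 * (a xi ^+ 2 + b xi ^+ 2))%:E)).
- move=> N; apply/measurable_EFinP; apply: measurable_funM => //; apply: measurable_funX.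
  by apply: measurable_sum => n; exact: mt.
- by move=> N xi; rewrite lee_fin mulr_ge0// sqr_ge0.
- move=> xi; apply: cvg_EFin; first exact: nearW.
  apply: cvgM; last exact: cvg_cst.
  have h : \sum_(n < N) t n xi @[N --> \oo] --> expR (sigma * `|xi|).
    have E : expR (sigma * `|xi|) = limn (series (exp_coeff (sigma * `|xi|))).
      by [].
    have := is_cvg_series_exp_coeff (sigma * `|xi|); rewrite E.
    by move=> h; under eq_fun do rewrite -(big_mkord xpredT (fun n => t n xi)); apply: h.
  exact: (cvg_comp _ _ h (@exprn_continuous _ 2 _)).
move=> N.
apply: (@le_trans _ _ (\int[mu]_xi ((1 - q)^-1%:E * (\sum_(n < N)
    (q^-1 ^+ n * (sigma ^+ n / n`!%:R) ^+ 2)%:E * (xi ^+ (2 * n) * (a xi ^+ 2 + b xi ^+ 2))%:E)%E)%E)%E).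
  apply: ge0_le_integral => //.
  - by move=> xi _; rewrite lee_fin mulr_ge0// sqr_ge0.
  - apply/measurable_EFinP; apply: measurable_funM => //; apply: measurable_funX.
    by apply: measurable_sum => n; exact: mt.
  - apply: measurable_funeM; apply: emeasurable_sum => n; apply: measurable_funeM.
    by apply/measurable_EFinP; apply: measurable_funM.
  - move=> xi _.
    rewrite (eq_bigr (fun n : 'I_N => (q^-1 ^+ n * (sigma ^+ n / n`!%:R) ^+ 2 *
      (xi ^+ (2 * n) * (a xi ^+ 2 + b xi ^+ 2)))%:E)); last by move=> n _; rewrite EFinM.
    rewrite sumEFin -EFinM lee_fin.
    have -> : \sum_(i < N) q^-1 ^+ i * (sigma ^+ i / i`!%:R) ^+ 2 *
        (xi ^+ (2 * i) * (a xi ^+ 2 + b xi ^+ 2)) = (\sum_(i < N) q^-1 ^+ i *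
        (sigma ^+ i / i`!%:R) ^+ 2 * xi ^+ (2 * i)) * (a xi ^+ 2 + b xi ^+ 2).
      by rewrite mulr_suml; apply: eq_bigr => i _; rewrite mulrA.
    rewrite mulrA ler_wpM2r//.
    apply: le_trans (weighted_cauchy N q01 (fun n => t0 n xi)) _.
    apply: le_of_eq; congr (_ * _).
    apply: eq_bigr => n _; rewrite -mulrA; congr (_ * _).
    have -> : t n xi = sigma ^+ n / n`!%:R * `|xi| ^+ n by rewrite /t exprMn mulrAC.
    rewrite exprMn; congr (_ * _).
    by rewrite -exprM mulnC exprM real_normK ?num_real// -exprM.
have mM n : measurable_fun setT (fun xi : R => (xi ^+ (2 * n) * (a xi ^+ 2 + b xi ^+ 2))%:E).
  by apply/measurable_EFinP; apply: measurable_funM.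
have M0 n xi : (0 <= (xi ^+ (2 * n) * (a xi ^+ 2 + b xi ^+ 2))%:E)%E.
  by rewrite lee_fin mulr_ge0// exprM exprn_ge0// sqr_ge0.
have w0 n : 0 <= q^-1 ^+ n * (sigma ^+ n / n`!%:R) ^+ 2.
  by rewrite mulr_ge0 ?sqr_ge0// exprn_ge0// invr_ge0 ltW.
rewrite ge0_integralZl ?lee_fin ?invr_ge0 ?(ltW d0)//; last 2 first.
- by apply: emeasurable_sum => n; apply: measurable_funeM; exact: mM.
- by move=> xi _; apply: sume_ge0 => n _; apply: mule_ge0; [rewrite lee_fin; exact: w0|exact: M0].
have -> : 16 * pi * (1 - q)^-1 ^+ 2 * c ^+ 2 = (1 - q)^-1 * ((1 - q)^-1 * (16 * pi * c ^+ 2)).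
  by rewrite expr2; ring.
rewrite [leRHS]EFinM; apply: lee_wpmul2l; first by rewrite lee_fin invr_ge0 ltW.
rewrite ge0_integral_sum//; last 2 first.
- by move=> n; apply: measurable_funeM; exact: mM.
- by move=> n xi _; apply: mule_ge0; [rewrite lee_fin; exact: w0|exact: M0].
apply: (@le_trans _ _ (\sum_(n < N) (q ^+ n * (16 * pi * c ^+ 2))%:E)%E).
  apply: lee_sum => n _.
  rewrite ge0_integralZl ?lee_fin ?w0//; last exact: mM.
  have := le_trans (ft_tower_moment n tf fab) (lee_wpmul2l _ (hf n)).
  move=> /(_ (ltac:(by rewrite lee_fin !mulr_ge0 ?sqr_ge0 ?pi_ge0))) H.
  apply: le_trans (lee_wpmul2l _ H) _; first by rewrite lee_fin w0.
  rewrite -!EFinM lee_fin; apply: le_of_eq.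
  have -> : q ^+ n = q^-1 ^+ n * (q ^+ n) ^+ 2.
    by rewrite expr2 mulrA exprVn mulVf ?mul1r// expf_neq0// gt_eqF.
  have -> : (q ^+ n) ^+ 2 = (sigma ^+ n * rho^-1 ^+ n) ^+ 2 by rewrite /q exprMn.
  have := f0 n; move: (q^-1 ^+ n) (sigma ^+ n) (rho^-1 ^+ n) (n`!%:R : R) => W S P F F0.
  by field; rewrite gt_eqF.
rewrite sumEFin lee_fin -mulr_suml; apply: ler_wpM2r.
  by rewrite mulr_ge0 ?sqr_ge0// mulr_ge0// ltW.
have -> : \sum_(i < N) q ^+ i = (1 - q ^+ N) / (1 - q).
  elim: N => [|N IH]; first by rewrite big_ord0 expr0 subrr mul0r.
  by rewrite big_ord_recr/= IH exprS; field; rewrite gt_eqF.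
by rewrite ler_piMl ?invr_ge0 ?(ltW d0)// gerBl exprn_ge0// ltW.
Qed.

End SpectralDecay.

(** * Inversion, and Taylor coefficients from exponential decay *)

Section InverseTransform.
Context {R : realType}.
Local Notation mu := (@lebesgue_measure R).
Local Notation L1 f := (mu.-integrable setT (EFin \o f)).
Implicit Types (f g a b : R -> R) (h : R).

(** A quadratic remainder estimate passes through integrals and series by the triangle inequality
    alone, so that differentiation under them needs no further limit theorem. *)
Lemma is_derive_quadratic f (d L x : R) :
  (forall h, `|f (x + h) - f x - h * d| <= L * h ^+ 2) -> is_derive x 1 f d.
Proof.
move=> H.
suff Hc : h^-1 *: ((f \o shift x) (h *: (1 : R)) - f x) @[h --> 0^'] --> d.
  split; first by apply/cvg_ex; exists d.
  exact: cvg_lim Hc.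
apply/subr_cvg0; apply/norm_cvg0P.
apply: (@squeeze_cvgr _ _ _ _ (fun=> 0) (fun h : R => L * `|h|)).
- near=> h; rewrite normr_ge0/= /GRing.scale/= mulr1.
  have h0 : h != 0 by near: h; exact: nbhs_dnbhs_neq.
  have -> : h^-1 * (f (h + x) - f x) - d = h^-1 * (f (x + h) - f x - h * d).
    by rewrite (addrC h) [RHS]mulrBr mulKf.
  rewrite normrM normfV ler_pdivrMl ?normr_gt0//.
  rewrite (le_trans (H h))// -[X in _ * X <= _](real_normK (num_real h)).
  by apply: le_of_eq; ring.
- exact: cvg_cst.
- rewrite -[X in _ --> X](mulr0 L); apply: cvgM; first exact: cvg_cst.
  rewrite -[X in _ --> X](@normr0 _ R); apply: cvg_norm.
  exact: nbhs_dnbhs.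
Unshelve. all: by end_near. Qed.

Lemma exp_coeff_le (x : R) n : 0 <= x -> x ^+ n / n`!%:R <= expR x.
Proof.
move=> x0; case: n => [|n].
  by rewrite expr0 fact0 divr1 -expR0 ler_expR.
by apply: le_trans (expR_ge1Dxn n x0); rewrite lerDr.
Qed.

Section ExponentialWeight.
Variables (A : R -> R) (rho sigma c : R).
Hypothesis (rho0 : 0 < rho) (rhosigma : rho < sigma) (c0 : 0 < c).
Hypothesis mA : measurable_fun setT A.
Hypothesis hA : (sqint (fun xi => expR (sigma * `|xi|) * A xi)%R <= (c ^+ 2)%:E)%E.

Let coeff n xi := xi ^+ n / n`!%:R * A xi.

Let mcoeff n : measurable_fun setT (coeff n).
Proof. by apply: measurable_funM => //; apply: measurable_funM. Qed.

Let mexp (r : R) : measurable_fun setT (fun xi : R => expR (r * `|xi|)).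
Proof. by have := measurable_decay (- r); under eq_fun do rewrite mulNr opprK. Qed.

Lemma coeff_le n xi : `|coeff n xi| <= rho^-1 ^+ n * (expR (rho * `|xi|) * `|A xi|).
Proof.
rewrite normrM mulrA ler_wpM2r// normrM normrX.
rewrite [X in _ * X <= _]ger0_norm ?invr_ge0//.
rewrite exprVn ler_pdivlMl ?exprn_gt0//; apply: le_trans (exp_coeff_le n _).
  by rewrite exprMn mulrA.
by rewrite mulr_ge0// ltW.
Qed.

(** With d = sigma - rho, the inequality u v <= c u^2 / 2 + v^2 / (2c) is applied to u = e^{-d|xi|},
    of squared norm 1/d, and to v = e^{sigma|xi|} |A|, of norm at most c. The total is this constant
    times c. *)
Definition inverse_const (rho sigma : R) := ((sigma - rho)^-1 + 1) / 2.

Let wL2 : isL2 (fun xi => expR (sigma * `|xi|) * A xi).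
Proof. by split; [exact: measurable_funM|apply: le_lt_trans hA _; rewrite ltry]. Qed.

Let decayE xi : expR (rho * `|xi|) * `|A xi| =
  expR (- ((sigma - rho) * `|xi|)) * `|expR (sigma * `|xi|) * A xi|.
Proof.
rewrite normrM (ger0_norm (expR_ge0 _)) mulrA -expRD; congr (expR _ * _); ring.
Qed.

Let mw1 : measurable_fun setT (fun xi : R => expR (rho * `|xi|) * `|A xi|).
Proof. by apply: measurable_funM => //; apply: measurableT_comp. Qed.

Lemma exp_weight_integral :
  (\int[mu]_xi (expR (rho * `|xi|) * `|A xi|)%:E <= (inverse_const rho sigma * c)%:E)%E.
Proof.
have d0 : 0 < sigma - rho by rewrite subr_gt0.
have d2 : 0 < 2 * (sigma - rho) by rewrite mulr_gt0.
have mw := wL2.1.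
apply: (@le_trans _ _ (\int[mu]_xi ((c / 2)%:E * (expR (- (2 * (sigma - rho) * `|xi|)))%:E +
   (2 * c)^-1%:E * ((expR (sigma * `|xi|) * A xi) ^+ 2)%:E))%E).
  apply: ge0_le_integral => //.
  - by apply/measurable_EFinP.
  - apply: emeasurable_funD; apply: measurable_funeM; last exact: measurable_sqr.
    by apply/measurable_EFinP; exact: measurable_decay.
  - move=> xi _; rewrite -!EFinM -EFinD lee_fin decayE.
    have -> : expR (- (2 * (sigma - rho) * `|xi|)) = expR (- ((sigma - rho) * `|xi|)) ^+ 2.
      by rewrite expr2 -expRD; congr expR; ring.
    rewrite -[X in _ + _ * X](real_normK (num_real _)).
    move: (expR _) (`|_ * A xi|) => u v.
    rewrite -subr_ge0.
    have -> : c / 2 * u ^+ 2 + (2 * c)^-1 * v ^+ 2 - u * v = (2 * c)^-1 * (c * u - v) ^+ 2.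
      by field; rewrite gt_eqF.
    by rewrite mulr_ge0 ?sqr_ge0// invr_ge0 mulr_ge0// ltW.
rewrite ge0_integralD//; last 4 first.
- by move=> xi _; rewrite mule_ge0// lee_fin ?expR_ge0// divr_ge0// ltW.
- by apply: measurable_funeM; apply/measurable_EFinP; exact: measurable_decay.
- by move=> xi _; rewrite mule_ge0// lee_fin ?sqr_ge0// invr_ge0 mulr_ge0// ltW.
- by apply: measurable_funeM; exact: measurable_sqr.
have c2 : (0 <= (c / 2)%:E)%E by rewrite lee_fin divr_ge0// ltW.
have c3 : (0 <= (2 * c)^-1%:E)%E by rewrite lee_fin invr_ge0 mulr_ge0// ltW.
rewrite (ge0_integralZl _ _ _ _ c2)//; try by [apply/measurable_EFinP; exact: measurable_decay
  |move=> xi _; rewrite lee_fin expR_ge0].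
rewrite integral_decay// (ge0_integralZl _ _ _ _ c3)//; try by [exact: measurable_sqr
  |move=> xi _; rewrite lee_fin sqr_ge0].
apply: (@le_trans _ _ ((c / 2 * (2 / (2 * (sigma - rho))))%:E + (2 * c)^-1%:E * (c ^+ 2)%:E)%E).
  by rewrite EFinM; apply: leeD => //; apply: lee_wpmul2l.
rewrite -EFinM -EFinD lee_fin; apply: le_of_eq.
by rewrite /inverse_const; field; rewrite !gt_eqF.
Qed.

Let L1w : L1 (fun xi => expR (rho * `|xi|) * `|A xi|).
Proof.
apply/integrableP; split.
  by apply/measurable_EFinP.
under eq_integral do rewrite /= ger0_norm ?mulr_ge0 ?expR_ge0//.
by apply: le_lt_trans exp_weight_integral _; rewrite ltry.
Qed.

Lemma integrable_inverse_coeff n : L1 (fun xi => xi ^+ n / n`!%:R * A xi).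
Proof.
apply: (le_integrable measurableT _ _ (integrableZl measurableT (rho^-1 ^+ n) L1w)) => /=.
  by apply/measurable_EFinP; exact: mcoeff.
move=> xi _; rewrite lee_fin; apply: le_trans (coeff_le n xi) _; exact: ler_norm.
Qed.

Let L1coeff n : L1 (coeff n) := integrable_inverse_coeff n.

Lemma coeff_integral n : \int[mu]_xi `|coeff n xi| <= rho^-1 ^+ n * (inverse_const rho sigma * c).
Proof.
apply: (@le_trans _ _ (\int[mu]_xi (rho^-1 ^+ n * (expR (rho * `|xi|) * `|A xi|)))).
  apply: le_Rintegral => //.
  - exact: (integrable_norm (L1coeff n)).
  - exact: (integrableZl measurableT (rho^-1 ^+ n) L1w).
  - by move=> xi _; exact: coeff_le.
rewrite RintegralZl; [|by []|exact: L1w]; apply: ler_wpM2l; first by rewrite exprn_ge0// invr_ge0 ltW.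
rewrite /Rintegral -lee_fin fineK; first exact: exp_weight_integral.
exact: integrable_fin_num L1w.
Qed.

(** The n-th Taylor coefficient at X of the integral of A(xi) cos (xi X + theta): each derivative
    brings down xi and advances the phase by a quarter turn. The phases 0 and - pi / 2 give the
    cosine and the sine integral. *)
Definition inverse_coeff (theta : R) n X :=
  \int[mu]_xi (xi ^+ n / n`!%:R * A xi * cos (xi * X + (theta + n%:R * (pi / 2)))).

Let mphase (X t : R) : measurable_fun setT (fun xi : R => cos (xi * X + t)).
Proof.
apply: (measurableT_comp (f := cos)); first exact: continuous_measurable_fun (@continuous_cos R).
by apply: measurable_funD => //; exact: measurable_funM.
Qed.

Lemma inverse_coeff_le theta n X :
  `|inverse_coeff theta n X| <= rho^-1 ^+ n * (inverse_const rho sigma * c).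
Proof.
apply: le_trans (normr_Rintegral_bounded _ _ _) (coeff_integral n) => //.
by move=> xi; exact: normr_cos.
Qed.

Let L1phase n X t : L1 (fun xi => coeff n xi * cos (xi * X + t)).
Proof. by apply: (@integrable_mul_bounded _ _ _ _ 1) => // xi; exact: normr_cos. Qed.

(** The second-order remainder of the cosine is at most (xi h)^2, and xi^2 times [coeff n] is
    (n+1)(n+2) times [coeff n.+2], whose integral [coeff_integral] controls. *)
Lemma inverse_coeff_tower theta : tower (inverse_coeff theta).
Proof.
move=> n X; apply: (@is_derive_quadratic _ _
  (n.+1%:R * n.+2%:R * (rho^-1 ^+ n.+2 * (inverse_const rho sigma * c)))) => h.
pose phi (xi : R) := xi * X + (theta + n%:R * (pi / 2)).
have E1 : n.+1%:R * inverse_coeff theta n.+1 X = \int[mu]_xi (coeff n xi * (xi * - sin (phi xi))).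
  rewrite -RintegralZl//; last exact: L1phase.
  apply: eq_Rintegral => xi _.
  have -> : xi * X + (theta + n.+1%:R * (pi / 2)) = phi xi + pi / 2.
    by rewrite /phi -natr1; ring.
  rewrite cosDpihalf /coeff factS natrM exprS.
  have f0 : n`!%:R != 0 :> R by rewrite pnatr_eq0 -lt0n fact_gt0.
  have f1 : n.+1%:R != 0 :> R by rewrite pnatr_eq0.
  move: f0 f1; move: (n.+1%:R : R) (n`!%:R : R) (xi ^+ n) (A xi) (sin _) => p q r u v p0 q0.
  by field; rewrite p0.
have L1s : L1 (fun xi => coeff n xi * (xi * - sin (phi xi))).
  have := integrableZl measurableT (n.+1%:R : R) (L1phase n.+1 X (theta + n.+1%:R * (pi / 2))).
  apply: eq_integrable => // xi _ /=; congr EFin.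
  have -> : xi * X + (theta + n.+1%:R * (pi / 2)) = phi xi + pi / 2.
    by rewrite /phi -natr1; ring.
  rewrite cosDpihalf /coeff factS natrM exprS.
  have f0 : n`!%:R != 0 :> R by rewrite pnatr_eq0 -lt0n fact_gt0.
  have f1 : n.+1%:R != 0 :> R by rewrite pnatr_eq0.
  move: f0 f1; move: (n.+1%:R : R) (n`!%:R : R) (xi ^+ n) (A xi) (sin _) => p q r u v p0 q0.
  by field; rewrite p0.
rewrite E1 {E1} /inverse_coeff -RintegralB//; try exact: L1phase.
rewrite -RintegralZl//.
have L1hs := integrableZl measurableT h L1s.
have L1d : L1 (fun xi => coeff n xi * cos (xi * (X + h) + (theta + n%:R * (pi / 2))) -
    coeff n xi * cos (phi xi)).
  by have := integrableB measurableT (L1phase n (X + h) (theta + n%:R * (pi / 2)))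
    (L1phase n X (theta + n%:R * (pi / 2))).
rewrite -RintegralB//.
have L2 := integrable_norm ((L1coeff n.+2)).
apply: le_trans (le_normr_Rintegral _ _) _ => //.
  by have := integrableB measurableT L1d L1hs.
rewrite -mulrA (mulrC _ (h ^+ 2)).
apply: (@le_trans _ _ (\int[mu]_xi (h ^+ 2 * (n.+1%:R * n.+2%:R) * `|coeff n.+2 xi|))); last first.
  rewrite RintegralZl// [in leRHS]mulrA [leRHS]mulrA.
  apply: ler_wpM2l; [by rewrite mulr_ge0 ?sqr_ge0// mulr_ge0|exact: coeff_integral].
apply: le_Rintegral => //.
- by have := integrable_norm (integrableB measurableT L1d L1hs).
- by have := integrableZl measurableT (h ^+ 2 * (n.+1%:R * n.+2%:R)) L2.
move=> xi _ /=.
have -> : xi * (X + h) + (theta + n%:R * (pi / 2)) = phi xi + xi * h by rewrite /phi; ring.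
have -> : coeff n xi * cos (phi xi + xi * h) - coeff n xi * cos (phi xi) -
    h * (coeff n xi * (xi * - sin (phi xi))) =
    coeff n xi * (cos (phi xi + xi * h) - cos (phi xi) - xi * h * - sin (phi xi)) by ring.
rewrite normrM.
apply: le_trans (ler_wpM2l (normr_ge0 _) (cos_quadratic _ _)) _.
rewrite -[X in _ * X <= _](ger0_norm (sqr_ge0 _)) -normrM.
have -> : h ^+ 2 * (n.+1%:R * n.+2%:R) * `|coeff n.+2 xi| =
   `|h ^+ 2 * (n.+1%:R * n.+2%:R) * coeff n.+2 xi|.
  by rewrite [in RHS]normrM [in RHS]ger0_norm// mulr_ge0// sqr_ge0.
apply: le_of_eq; congr (`|_|).
rewrite /coeff !factS !natrM !exprS expr0.
have f0 : n`!%:R != 0 :> R by rewrite pnatr_eq0 -lt0n fact_gt0.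
have f1 : n.+1%:R != 0 :> R by rewrite pnatr_eq0.
have f2 : n.+2%:R != 0 :> R by rewrite pnatr_eq0.
by move: f0 f1 f2; move: (n.+1%:R : R) (n.+2%:R : R) (n`!%:R : R) (xi ^+ n) => p q r s p0 q0 r0; field; rewrite p0 q0.
Qed.

(** As a function of X the integral combines the cosine and sine integrals of [coeff n], so that
    Plancherel's inequality serves in the inverse direction as well. *)
Lemma sqint_inverse_coeff theta n :
  (sqint (inverse_coeff theta n) <= (2 * pi * (c * rho^-1 ^+ n) ^+ 2)%:E)%E.
Proof.
have mc := measurable_cosint (L1coeff n); have ms := measurable_sinint (L1coeff n).
set t := theta + n%:R * (pi / 2).
have E X : inverse_coeff theta n X = cosint (coeff n) X * cos t - sinint (coeff n) X * sin t.
  have ic := integrable_mul_cos X (L1coeff n); have js := integrable_mul_sin X (L1coeff n).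
  rewrite /cosint /sinint -(RintegralZr _ measurableT ic) -(RintegralZr _ measurableT js).
  rewrite -RintegralB//.
  - by apply: eq_Rintegral => xi _; rewrite cosD (mulrC X) /coeff; ring.
  - exact: (integrableZr measurableT (cos t) (integrable_mul_cos X (L1coeff n))).
  - exact: (integrableZr measurableT (sin t) (integrable_mul_sin X (L1coeff n))).
have L2c : isL2 (coeff n) /\ (sqint (coeff n) <= ((c * rho^-1 ^+ n) ^+ 2)%:E)%E.
  have r0 : 0 <= rho^-1 ^+ n by rewrite exprn_ge0// invr_ge0 ltW.
  have le xi : `|coeff n xi| <= `|rho^-1 ^+ n * (expR (sigma * `|xi|) * A xi)|.
    apply: le_trans (coeff_le n xi) _; rewrite normrM ger0_norm// ler_wpM2l// normrM.
    rewrite ger0_norm ?expR_ge0// ler_wpM2r// ler_expR ler_wpM2r// ltW//.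
  have L2w := isL2Z (rho^-1 ^+ n) wL2; split; first exact: isL2_le L2w le.
  apply: le_trans (le_sqint (mcoeff n) L2w.1 le) _.
  rewrite sqintZ; last exact: wL2.1.
  have p0 : (0 <= ((rho^-1 ^+ n) ^+ 2)%:E)%E by rewrite lee_fin sqr_ge0.
  by apply: le_trans (lee_wpmul2l p0 hA) _; rewrite -EFinM lee_fin mulrC exprMn.
apply: (@le_trans _ _ (sqint (cosint (coeff n)) + sqint (sinint (coeff n)))%E); last first.
  apply: le_trans (plancherel_le (L1coeff n) L2c.1) _.
  rewrite [leRHS]EFinM; apply: lee_wpmul2l L2c.2.
  by rewrite lee_fin mulr_ge0 ?pi_ge0.
rewrite /sqint -ge0_integralD//; last 4 first.
- by move=> x _; rewrite lee_fin sqr_ge0.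
- exact: measurable_sqr.
- by move=> x _; rewrite lee_fin sqr_ge0.
- exact: measurable_sqr.
apply: ge0_le_integral => //.
- by move=> x _; rewrite lee_fin sqr_ge0.
- apply: measurable_sqr; rewrite (funext E : inverse_coeff theta n = _).
  by apply: measurable_funB; apply: measurable_funM.
- by apply: emeasurable_funD; exact: measurable_sqr.
- move=> x _; rewrite -EFinD lee_fin E -subr_ge0.
  move: (cosint _ _) (sinint _ _) => C S.
  have -> : C ^+ 2 + S ^+ 2 - (C * cos t - S * sin t) ^+ 2 =
     (C ^+ 2 + S ^+ 2) * (1 - (cos t ^+ 2 + sin t ^+ 2)) + (C * sin t + S * cos t) ^+ 2 by ring.
  by rewrite cos2Dsin2 subrr mulr0 add0r sqr_ge0.
Qed.

End ExponentialWeight.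

Lemma Rintegral_mul_le f g (e : R) : 0 < e -> isL2 f -> isL2 g ->
  ((`|\int[mu]_x (f x * g x)|)%:E <= (e^-1 / 2)%:E * sqint f + (e / 2)%:E * sqint g)%E.
Proof.
move=> e0 Lf Lg; have [mf _] := Lf; have [mg _] := Lg.
apply: le_trans (Rintegral_le_abs _) _; first exact: measurable_funM.
have e1 : (0 <= (e^-1 / 2)%:E)%E by rewrite lee_fin divr_ge0// invr_ge0 ltW.
have e2 : (0 <= (e / 2)%:E)%E by rewrite lee_fin divr_ge0// ltW.
rewrite /sqint -(ge0_integralZl _ _ _ _ e1)//; try by [exact: measurable_sqr
  |move=> xi _; rewrite lee_fin sqr_ge0].
rewrite -(ge0_integralZl _ _ _ _ e2)//; try by [exact: measurable_sqr
  |move=> xi _; rewrite lee_fin sqr_ge0].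
rewrite -ge0_integralD//; try by [move=> x _; rewrite mule_ge0// lee_fin sqr_ge0
  |apply: measurable_funeM; exact: measurable_sqr].
apply: ge0_le_integral => //.
- by apply/measurable_EFinP; apply: measurableT_comp => //; exact: measurable_funM.
- by apply: emeasurable_funD; apply: measurable_funeM; exact: measurable_sqr.
- move=> x _; rewrite -!EFinM -EFinD lee_fin normrM.
  rewrite -[X in _ * X + _](real_normK (num_real _)) -[X in _ + _ * X](real_normK (num_real (g x))).
  move: `|f x| `|g x| => u v; rewrite -subr_ge0.
  have -> : e^-1 / 2 * u ^+ 2 + e / 2 * v ^+ 2 - u * v = e^-1 / 2 * (u - e * v) ^+ 2.
    by field; rewrite gt_eqF.
  by rewrite mulr_ge0 ?sqr_ge0// divr_ge0// invr_ge0 ltW.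
Qed.

Lemma L2cvg_Rintegral (u_ : nat -> R -> R) (u g : R -> R) :
  (forall n, isL2 (u_ n)) -> isL2 u -> isL2 g -> L2cvg u_ u ->
  \int[mu]_x (u_ n x * g x) @[n --> \oo] --> \int[mu]_x (u x * g x).
Proof.
move=> Lu_ Lu Lg uu; apply/cvgrPdist_le => e e0.
have [_ Hg] := Lg; set H := fine (sqint g).
have HE : sqint g = H%:E by rewrite fineK// ge0_fin_numE ?sqint_ge0.
have H0 : 0 <= H by rewrite fine_ge0// sqint_ge0.
have H1 : 0 < H + 1 by rewrite ltr_wpDl.
(* With this weight both terms of [Rintegral_mul_le] are at most e / 2 once the squared distance is
   at most d e. *)
pose d := e / (H + 1).
have d0 : 0 < d by rewrite divr_gt0.
near=> n.
have h : (sqint (fun x => u_ n x - u x)%R <= (d * e)%:E)%E.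
  by near: n; apply: uu; rewrite mulr_gt0.
have LB := isL2B (Lu_ n) Lu.
rewrite distrC -RintegralB//; [|exact: isL2_mul|exact: isL2_mul].
have -> : \int[mu]_x (u_ n x * g x - u x * g x) = \int[mu]_x ((u_ n x - u x) * g x).
  by apply: eq_Rintegral => x _; rewrite mulrBl.
rewrite -lee_fin; apply: le_trans (Rintegral_mul_le d0 LB Lg) _.
have d1 : (0 <= (d^-1 / 2)%:E)%E by rewrite lee_fin divr_ge0// invr_ge0 ltW.
apply: (@le_trans _ _ ((d^-1 / 2)%:E * (d * e)%:E + (d / 2)%:E * H%:E)%E).
  by rewrite HE; apply: leeD => //; apply: lee_wpmul2l.
rewrite -!EFinM -EFinD lee_fin.
have -> : d^-1 / 2 * (d * e) = e / 2 by field; rewrite gt_eqF.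
have -> : d / 2 * H = e / 2 * (H / (H + 1)) by rewrite /d; field; rewrite gt_eqF.
rewrite {3}(splitr e) lerD2l ler_piMr ?divr_ge0 ?ltW//.
by rewrite ltr_pdivrMr// mul1r ltrDl.
Unshelve. all: by end_near. Qed.

Lemma isL2_decay (e : R) : 0 < e -> isL2 (fun x : R => expR (- (e * `|x|))).
Proof.
move=> e0; split; first exact: measurable_decay.
have e2 : 0 < 2 * e by rewrite mulr_gt0.
have E := integral_decay e2.
have -> : sqint (fun x : R => expR (- (e * `|x|))) = (\int[mu]_x (expR (- (2 * e * `|x|)))%:E)%E.
  apply: eq_integral => x _; congr EFin; rewrite expr2 -expRD; congr expR; ring.
by rewrite E ltry.
Qed.

Lemma poisson_le (e x : R) : 0 < e -> poisson e x <= 2 / e.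
Proof.
move=> e0; rewrite /poisson ler_pdivrMr; last by rewrite ltr_pwDl ?sqr_ge0// exprn_gt0.
have -> : 2 / e * (e ^+ 2 + x ^+ 2) = 2 * e + 2 / e * x ^+ 2 by field; rewrite gt_eqF.
by rewrite lerDl mulr_ge0 ?sqr_ge0// divr_ge0// ltW.
Qed.

Lemma measurable_poissonB (e y : R) : 0 < e -> measurable_fun setT (fun x : R => poisson e (x - y)).
Proof. by move=> e0; have := measurable_shift (- y) (measurable_poisson e0). Qed.

Lemma isL2_poisson (e y : R) : 0 < e -> isL2 (fun x : R => poisson e (x - y)).
Proof.
move=> e0; have mp := measurable_poissonB y e0; split => //.
have c0 : (0 <= (2 / e)%:E)%E by rewrite lee_fin divr_ge0// ltW.
apply: (@le_lt_trans _ _ (\int[mu]_x ((2 / e)%:E * (poisson e (x - y))%:E))%E).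
  apply: ge0_le_integral => //.
  - by move=> x _; rewrite lee_fin sqr_ge0.
  - exact: measurable_sqr.
  - by apply: measurable_funeM; apply/measurable_EFinP.
  - by move=> x _; rewrite lee_fin expr2 ler_wpM2r ?poisson_ge0// poisson_le.
rewrite (ge0_integralZl _ _ _ _ c0)//; try by [exact/measurable_EFinP
  |move=> x _; rewrite lee_fin poisson_ge0].
by rewrite integral_poisson// -EFinM ltry.
Qed.

Lemma isL2_mul1 f g : isL2 f -> measurable_fun setT g -> (forall x, `|g x| <= 1) ->
  isL2 (fun x => f x * g x).
Proof.
move=> Lf mg g1; apply: (isL2_le _ Lf); first exact: measurable_funM Lf.1 mg.
by move=> x; rewrite normrM ler_piMr.
Qed.

(** Both sides of [cosint_poisson] are integrals against fixed L^2 functions, hence continuous under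
    the L^2 limits that define [ft]. *)
Lemma ft_poisson f a b (e y : R) : 0 < e -> ft f a b ->
  \int[mu]_xi (expR (- (e * `|xi|)) * (a xi * cos (xi * y) + b xi * sin (xi * y))) =
  \int[mu]_x (f x * poisson e (x - y)).
Proof.
move=> e0 [Lf La Lb [f_ [f_12 ff fa fb]]].
have mc : measurable_fun setT (fun xi : R => cos (xi * y)).
  by have := measurable_cos_lin y; under eq_fun do rewrite mulrC.
have ms : measurable_fun setT (fun xi : R => sin (xi * y)).
  by have := measurable_sin_lin y; under eq_fun do rewrite mulrC.
have Lc : isL2 (fun xi => expR (- (e * `|xi|)) * cos (xi * y)).
  by apply: isL2_mul1 => //; [exact: isL2_decay|move=> x; exact: normr_cos].
have Ls : isL2 (fun xi => expR (- (e * `|xi|)) * sin (xi * y)).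
  by apply: isL2_mul1 => //; [exact: isL2_decay|move=> x; exact: normr_sin].
have split_ u v : isL2 u -> isL2 v ->
    \int[mu]_xi (expR (- (e * `|xi|)) * (u xi * cos (xi * y) + v xi * sin (xi * y))) =
    \int[mu]_xi (u xi * (expR (- (e * `|xi|)) * cos (xi * y))) +
    \int[mu]_xi (v xi * (expR (- (e * `|xi|)) * sin (xi * y))).
  move=> Lu Lv; rewrite -RintegralD//; [|exact: isL2_mul|exact: isL2_mul].
  by apply: eq_Rintegral => xi _; ring.
have L2c n : isL2 (cosint (f_ n)) /\ isL2 (sinint (f_ n)).
  have [f1 f2] := f_12 n; have := plancherel_le f1 f2 => H.
  have fin : ((2 * pi)%:E * sqint (f_ n) < +oo)%E.
    by rewrite lte_mul_pinfty// ?lee_fin ?mulr_ge0 ?pi_ge0//; exact: f2.2.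
  split; split; [exact: measurable_cosint| |exact: measurable_sinint|];
    apply: le_lt_trans fin; apply: le_trans H.
  - by rewrite leeDl// sqint_ge0.
  - by rewrite leeDr// sqint_ge0.
have C1 := L2cvg_Rintegral (fun n => (f_12 n).2) Lf (isL2_poisson y e0) ff.
have C2 := L2cvg_Rintegral (fun n => (L2c n).1) La Lc fa.
have C3 := L2cvg_Rintegral (fun n => (L2c n).2) Lb Ls fb.
rewrite split_//; apply: (cvg_unique _ _ C1) => //.
have E n : \int[mu]_x (f_ n x * poisson e (x - y)) =
    \int[mu]_x (cosint (f_ n) x * (expR (- (e * `|x|)) * cos (x * y))) +
    \int[mu]_x (sinint (f_ n) x * (expR (- (e * `|x|)) * sin (x * y))).
  by rewrite -(cosint_poisson _ _ (f_12 n).1)// split_//; [exact: (L2c n).1|exact: (L2c n).2].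
by rewrite /= (funext E); exact: cvgD C2 C3.
Qed.

Lemma isL2_indic (al be : R) : isL2 (\1_`[al, be] : R -> R).
Proof.
split; first exact: measurable_indic.
have -> : sqint (\1_`[al, be] : R -> R) = (\int[mu]_x (\1_`[al, be] x)%:E)%E.
  by apply: eq_integral => x _; rewrite indicE; case: (x \in _); rewrite ?expr1n ?expr0n.
rewrite integral_indic// setIT; have := lebesgue_measure_itv `[al, be].
by move=> /= ->; case: ifP => _; rewrite ltry.
Qed.

Lemma L2_integrable_itv f (al be : R) : isL2 f -> mu.-integrable `[al, be] (EFin \o f).
Proof.
move=> Lf; have := isL2_mul Lf (isL2_indic al be) => H.
apply: (integrable_mkcond _ _).2 => //.
apply: eq_integrable H => // x _ /=; rewrite patchE indicE.
by case: (x \in _); rewrite ?mulr1 ?mulr0.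
Qed.

Lemma Rintegral_itvE f (al be : R) :
  \int[mu]_(x in `[al, be]) f x = \int[mu]_x (f x * \1_`[al, be] x).
Proof.
rewrite /Rintegral; congr fine; rewrite integral_mkcond; apply: eq_integral => x _.
by rewrite patchE indicE; case: (x \in _); rewrite ?mulr1 ?mulr0.
Qed.

Lemma L2_locally_integrable f : isL2 f -> locally_integrable setT f.
Proof.
move=> Lf; split; [exact: Lf.1|exact: openT|move=> K _ cK].
have [M [_ HM]] := compact_bounded cK.
have KM : K `<=` `[- (M + 1), M + 1].
  move=> x Kx; have := HM (M + 1) (ltac:(by rewrite ltrDl)) x Kx.
  by rewrite /= in_itv/= ler_norml.
have /integrableP[_ H] := L2_integrable_itv (- (M + 1)) (M + 1) Lf.
apply: le_lt_trans H; apply: ge0_subset_integral => //.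
- by apply: closed_measurable; apply: compact_closed => //; exact: Rhausdorff.
- apply/measurable_EFinP; apply: measurable_funTS; apply: measurableT_comp => //.
  exact: Lf.1.
Qed.

(** By Lebesgue's differentiation theorem f is almost everywhere the derivative of its primitive
    from -n, and that primitive vanishes identically. *)
Lemma L2_ae0 f : isL2 f ->
  (forall al be : R, al < be -> \int[mu]_(x in `[al, be]) f x = 0) -> {ae mu, forall x, f x = 0}.
Proof.
move=> Lf H.
have key (n : nat) : {ae mu, forall x, - n%:R < x -> f x = 0}.
  have /= HF := @FTC1 R f (BLeft (- n%:R)) (fun y => L2_integrable_itv _ _ Lf) (L2_locally_integrable Lf).
  apply: (@filterS _ _ (ae_filter_ringOfSetsType mu)) HF => x /= Hx nx.
  have [|_ <-] := Hx; first by rewrite lte_fin.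
  have -> : (fun x : R => \int[mu]_(t in [set` Interval (BLeft (- n%:R)) (BRight x)]) f t) = cst 0.
    apply/funext => y; have [ny|] := ltP (- n%:R) y; first exact: H.
    rewrite le_eqVlt => /orP[/eqP ->|yn].
      by rewrite set_itv1 /Rintegral integral_set1.
    by rewrite set_itv_ge ?bnd_simp -?ltNge// /Rintegral integral_set0.
  by rewrite derive1_cst.
apply: (@filterS _ _ (ae_filter_ringOfSetsType mu)) (ae_foralln key) => x Hx.
apply: (Hx (Num.bound `|x|)); have := archi_boundP (normr_ge0 x).
by rewrite ltr_norml => /andP[].
Qed.

Lemma cvg_atanM (c : R) : atan (c * n.+1%:R) @[n --> \oo] --> Num.sg c * (pi / 2).
Proof.
have pos (d : R) : 0 < d -> atan (d * n.+1%:R) @[n --> \oo] --> pi / 2.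
  move=> d0; apply: (cvg_comp _ _ _ (@cvgy_atan R)).
  apply/cvgryPge => A; near=> n.
  rewrite -ler_pdivrMl//; apply: (@le_trans _ _ n%:R); last by rewrite ler_nat.
  near: n; exact: nbhs_infty_ger.
have [c0|c0|->] := ltgtP c 0.
- rewrite ltr0_sg// mulN1r.
  have E n : atan (c * n.+1%:R) = - atan (- c * n.+1%:R) by rewrite mulNr atanN opprK.
  by rewrite (funext E); apply: cvgN; apply: pos; rewrite oppr_gt0.
- by rewrite gtr0_sg// mul1r; exact: pos.
- rewrite sgr0 mul0r; under eq_fun do rewrite mul0r atan0; exact: cvg_cst.
Unshelve. all: by end_near. Qed.

Lemma integral_poisson_itv (e x al be : R) : 0 < e -> al < be ->
  \int[mu]_(y in `[al, be]) poisson e (x - y) = 2 * (atan ((be - x) / e) - atan ((al - x) / e)).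
Proof.
move=> e0 ab.
have dF (y : R) : is_derive y 1 (fun y => 2 * atan ((y - x) * e^-1)) (poisson e (x - y)).
  eapply is_derive_eq; [by ider|rewrite /GRing.scale/= /poisson].
  have h1 : 0 < e ^+ 2 + (x - y) ^+ 2 by rewrite ltr_pwDl ?sqr_ge0// exprn_gt0.
  have h2 : 0 < 1 + ((y - x) / e) ^+ 2 by rewrite ltr_pwDl ?sqr_ge0.
  field; rewrite !gt_eqF//=.
have cF : continuous (fun y => 2 * atan ((y - x) * e^-1)) by move=> y; apply: ider_continuous (dF y).
have cp : continuous (fun y => poisson e (x - y)).
  move=> y; rewrite /poisson; apply: cvgM; first exact: cvg_cst.
  apply: cvgV; first by rewrite gt_eqF// ltr_pwDl ?sqr_ge0// exprn_gt0.
  have d2 : is_derive y 1 (fun y => e ^+ 2 + (x - y) * (x - y)) (0 + ((0 - 1) * (x - y) + (x - y) * (0 - 1))).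
    by ider.
  exact: (ider_continuous d2).
rewrite /Rintegral (@continuous_FTC2 _ _ (fun y => 2 * atan ((y - x) * e^-1)))//.
- by rewrite /= mulrBr.
- exact: continuous_subspaceT.
- split.
  + by move=> t _; apply: ider_derivable (dF t).
  + exact/cvg_at_right_filter/cF.
  + exact/cvg_at_left_filter/cF.
- by move=> t _; apply: ider_derive1.
Qed.

(** As f is only square-integrable, Fubini's theorem does not apply to it directly. The factor
    [poisson 1] makes f integrable, and is divided out of the kernel. *)
Lemma Rintegral_window f (e al be : R) : 0 < e -> isL2 f -> al < be ->
  \int[mu]_(y in `[al, be]) (\int[mu]_x (f x * poisson e (x - y))) =
  \int[mu]_x (f x * \int[mu]_(y in `[al, be]) poisson e (x - y)).
Proof.
move=> e0 Lf ab.
have p0 (x : R) : 0 < poisson 1 (x - 0).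
  by rewrite /poisson divr_gt0 ?mulr_gt0// ltr_pwDl ?sqr_ge0// expr1n.
pose m : R := `|al| + `|be|.
(* For y in the window, 1 + x^2 <= 1 + 2 (x - y)^2 + 2 m^2, so that the quotient of the two Poisson
   kernels is bounded there. *)
pose k (z : R * R) := poisson e (z.2 - z.1) / poisson 1 (z.2 - 0) * \1_`[al, be] z.1.
pose M := 2 * e * (1 + 2 * m ^+ 2) / (2 * e ^+ 2) + 2 * e.
have fp : L1 (fun x => f x * poisson 1 (x - 0)) by apply: isL2_mul => //; exact: isL2_poisson.
have ip : L1 (\1_`[al, be] : R -> R).
  have := isL2_integrable (isL2_indic al be); apply: eq_integrable => // x _ /=.
  by rewrite indicE; case: (x \in _); rewrite ?expr1n ?expr0n.
have mk : measurable_fun setT k.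
  apply: measurable_funM; last by apply: measurableT_comp => //; exact: measurable_indic.
  apply: measurable_funM.
    apply: measurableT_comp; first exact: measurable_poisson.
    exact: measurable_funB.
  apply: (measurableT_comp (f := fun x : R => (poisson 1 (x - 0))^-1)) => //.
  have -> : (fun x : R => (poisson 1 (x - 0))^-1) = (fun x : R => (1 + x ^+ 2) / 2).
    apply/funext => x; rewrite /poisson subr0 expr1n mulr1 invf_div//.
  by apply: measurable_funM => //; apply: measurable_funD.
have kM z : `|k z| <= M.
  rewrite /k indicE; case: (boolP (z.1 \in _)) => [|_]; last first.
    have m2 : 0 <= 2 * m ^+ 2 by rewrite mulr_ge0 ?sqr_ge0.
    by rewrite mulr0 normr0 /M addr_ge0 ?divr_ge0 ?mulr_ge0 ?addr_ge0 ?sqr_ge0 ?(ltW e0).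
  case: z => y x /=; rewrite inE/= in_itv/= mulr1 subr0 => /andP[ya yb].
  have ym : `|y| <= m.
    rewrite /m; have := ler_norm (- al); have := ler_norm be; rewrite normrN.
    have := normr_ge0 al; have := normr_ge0 be; rewrite ler_norml; move=> *; apply/andP; split; lra.
  have ym2 : y ^+ 2 <= m ^+ 2 by rewrite -(real_normK (num_real y)) lerXn2r ?nnegrE// (le_trans _ ym).
  have e2 : 0 < e ^+ 2 by rewrite exprn_gt0.
  rewrite ger0_norm; last by rewrite divr_ge0 ?poisson_ge0.
  rewrite /poisson expr1n mulr1 invf_div mulrA ler_pdivrMr//.
  have d0 : 0 < e ^+ 2 + (x - y) ^+ 2 by rewrite ltr_pwDl ?sqr_ge0.
  rewrite mulrAC ler_pdivrMr//.
  have h1 : 1 + x ^+ 2 <= 1 + 2 * (x - y) ^+ 2 + 2 * m ^+ 2.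
    have := sqr_ge0 (x - 2 * y); have : (x - 2 * y) ^+ 2 = 2 * (x - y) ^+ 2 - x ^+ 2 + 2 * y ^+ 2 by ring.
    lra.
  apply: (@le_trans _ _ (2 * e * (1 + 2 * (x - y) ^+ 2 + 2 * m ^+ 2))).
    by rewrite ler_wpM2l// mulr_ge0// ltW.
  have -> : M * 2 * (e ^+ 2 + (x - y) ^+ 2) = 2 * e * ((1 + 2 * m ^+ 2) +
      (1 + 2 * m ^+ 2) * (x - y) ^+ 2 / e ^+ 2 + 2 * e ^+ 2 + 2 * (x - y) ^+ 2).
    by rewrite /M; field; rewrite gt_eqF.
  rewrite ler_wpM2l ?mulr_ge0 ?(ltW e0)//.
  have : 0 <= (1 + 2 * m ^+ 2) * (x - y) ^+ 2 / e ^+ 2.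
    have m2 : 0 <= 2 * m ^+ 2 by rewrite mulr_ge0 ?sqr_ge0.
    by apply: divr_ge0; [apply: mulr_ge0; [exact: addr_ge0|exact: sqr_ge0]|exact: ltW].
  move: ((1 + 2 * m ^+ 2) * (x - y) ^+ 2 / e ^+ 2) ((x - y) ^+ 2) (m ^+ 2) => u v w; lra.
have kE x y : f x * poisson 1 (x - 0) * k (y, x) = f x * poisson e (x - y) * \1_`[al, be] y.
  by rewrite /k /=; move: (p0 x) (\1__ _); move: (poisson _ _) (poisson _ _) => u v u0 w; field; rewrite gt_eqF.
rewrite Rintegral_itvE.
transitivity (\int[mu]_y (\1_`[al, be] y * \int[mu]_x (f x * poisson 1 (x - 0) * k (y, x)))).
  apply: eq_Rintegral => y _; under [in RHS]eq_Rintegral do rewrite kE.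
  rewrite indicE; case: (y \in _); last by rewrite mulr0 mul0r.
  by rewrite mulr1 mul1r; apply: eq_Rintegral => x _; rewrite mulr1.
rewrite (Rintegral_exchange fp ip mk kM); apply: eq_Rintegral => x _.
have ik : L1 (fun y => \1_`[al, be] y * k (y, x)).
  apply: (integrable_mul_bounded ip _ (fun y => kM (y, x))).
  exact: (measurable_fun_pair1 x mk).
have ipx : L1 (fun y => poisson e (x - y) * \1_`[al, be] y).
  have := isL2_mul (isL2_poisson x e0) (isL2_indic al be); apply: eq_integrable => // y _ /=.
  by rewrite -poissonN opprB.
rewrite Rintegral_itvE -(RintegralZl _ measurableT ik) -(RintegralZl _ measurableT ipx).
apply: eq_Rintegral => y _.
transitivity (\1_`[al, be] y * (f x * poisson 1 (x - 0) * k (y, x))); first by rewrite mulrCA.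
rewrite kE indicE; case: (y \in _); last by rewrite !mulr0.
by rewrite !mulr1 mul1r.
Qed.

(** A bound uniform in e, for dominated convergence as e tends to 0. In (1 + x^2) times the kernel,
    the part with (x - y)^2 is bounded by a constant, and the rest integrates to at most a multiple
    of 2 pi. *)
Lemma window_le (e x al be : R) : 0 < e <= 1 -> al < be ->
  `|\int[mu]_(y in `[al, be]) poisson e (x - y)| <=
  ((1 + 2 * (`|al| + `|be|) ^+ 2) * pi + 2 * (be - al)) * poisson 1 x.
Proof.
move=> /andP[e0 e1] ab.
set m := `|al| + `|be|; set W := Rintegral _ _ _.
have ip : mu.-integrable `[al, be] (EFin \o (fun y => poisson e (x - y))).
  have := L2_integrable_itv al be (isL2_poisson x e0); apply: eq_integrable => // y _ /=.
  by rewrite -poissonN opprB.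
have W0 : 0 <= W.
  apply: fine_ge0; apply: integral_ge0 => y _; rewrite lee_fin; exact: poisson_ge0.
have W2 : W <= 2 * pi.
  rewrite -lee_fin /W /Rintegral fineK; last exact: integrable_fin_num.
  rewrite -(integral_poisson x e0).
  have -> : (\int[mu]_y (poisson e (y - x))%:E = \int[mu]_y (poisson e (x - y))%:E)%E.
    by apply: eq_integral => y _; rewrite -poissonN opprB.
  apply: ge0_subset_integral => //.
  - apply/measurable_EFinP; have := measurable_poissonB x e0.
    by under eq_fun do rewrite -poissonN opprB.
  - by move=> y _; rewrite lee_fin poisson_ge0.
rewrite ger0_norm//.
have x1 : 0 < 1 + x ^+ 2 by rewrite ltr_pwDl ?sqr_ge0.
have ic : mu.-integrable `[al, be] (EFin \o (fun=> 2 : R)).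
  have := L2_integrable_itv al be (isL2Z 2 (isL2_indic al be)).
  apply: eq_integrable => // y yab /=; rewrite indicE.
  by rewrite yab mulr1.
have key : (1 + x ^+ 2) * W <= (1 + 2 * m ^+ 2) * W + 2 * (2 * (be - al)).
  have r3 : \int[mu]_(t in `[al, be]) (2 : R) = 2 * (be - al).
    rewrite Rintegral_cst//; congr (_ * _).
    have := lebesgue_measure_itv `[al, be]; rewrite /= lte_fin ab => mI.
    exact: (congr1 fine mI).
  rewrite -r3 -!RintegralZl// -RintegralD//; last 2 first.
  - exact: integrableZl ip.
  - exact: integrableZl ic.
  apply: le_Rintegral => //.
  - exact: integrableZl ip.
  - by have := integrableD _ (integrableZl _ (1 + 2 * m ^+ 2) ip) (integrableZl _ 2 ic); apply.
  move=> y /=; rewrite in_itv/= => /andP[ya yb].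
  have ym : `|y| <= m.
    rewrite /m; have := ler_norm (- al); have := ler_norm be; rewrite normrN.
    have := normr_ge0 al; have := normr_ge0 be; rewrite ler_norml; move=> *; apply/andP; split; lra.
  have ym2 : y ^+ 2 <= m ^+ 2 by rewrite -(real_normK (num_real y)) lerXn2r ?nnegrE// (le_trans _ ym).
  have h1 : 1 + x ^+ 2 <= 1 + 2 * m ^+ 2 + 2 * (x - y) ^+ 2.
    have := sqr_ge0 (x - 2 * y); have : (x - 2 * y) ^+ 2 = 2 * (x - y) ^+ 2 - x ^+ 2 + 2 * y ^+ 2 by ring.
    lra.
  apply: (@le_trans _ _ ((1 + 2 * m ^+ 2 + 2 * (x - y) ^+ 2) * poisson e (x - y))).
    by rewrite ler_wpM2r ?poisson_ge0.
  rewrite mulrDl lerD2l /poisson.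
  have d0 : 0 < e ^+ 2 + (x - y) ^+ 2 by rewrite ltr_pwDl ?sqr_ge0// exprn_gt0.
  rewrite mulrA ler_pdivrMr//.
  apply: (@le_trans _ _ (2 * (x - y) ^+ 2 * 2)).
    by apply: ler_wpM2l; [rewrite mulr_ge0 ?sqr_ge0|lra].
  have := sqr_ge0 e; move: (e ^+ 2) ((x - y) ^+ 2) => u v; lra.
have -> : poisson 1 x = 2 / (1 + x ^+ 2) by rewrite /poisson expr1n mulr1.
rewrite mulrA ler_pdivlMr// mulrC; apply: le_trans key _.
have m2 : 0 <= 1 + 2 * m ^+ 2 by rewrite addr_ge0// mulr_ge0// sqr_ge0.
have := ler_wpM2l m2 W2; move: (m ^+ 2) => w; lra.
Qed.

Lemma Rintegral_dominated_cvg (D : set R) (f_ : nat -> R -> R) (f g : R -> R) :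
  measurable (D : set (measurableTypeR R)) ->
  (forall n, measurable_fun D (f_ n)) -> measurable_fun D f ->
  {ae mu, forall x, D x -> f_ n x @[n --> \oo] --> f x} ->
  mu.-integrable D (EFin \o g) -> (forall n x, D x -> `|f_ n x| <= g x) ->
  \int[mu]_(x in D) f_ n x @[n --> \oo] --> \int[mu]_(x in D) f x.
Proof.
move=> mD mf_ mf ff ig le.
have [||||If _ H] := @dominated_convergence _ _ R mu D mD (fun n => EFin \o f_ n) (EFin \o f) (EFin \o g) _ _ _ ig.
- by move=> n; apply/measurable_EFinP; exact: mf_.
- by apply/measurable_EFinP; exact: mf.
- apply: (@filterS _ _ (ae_filter_ringOfSetsType mu)) ff => x Hx Dx.
  by apply: cvg_EFin; [exact: nearW|exact: Hx].
- by apply: aeW => x n Dx; rewrite lee_fin; exact: le.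
apply: fine_cvg; rewrite fineK//; exact: integrable_fin_num.
Qed.

(** The Abel means D n of the inverse transform are integrated over an arbitrary window and the
    limit is computed twice: pointwise convergence of D n gives the integral of F, the Poisson form
    of D n gives that of f. Functions with equal integrals over all windows agree almost
    everywhere. *)
Lemma ft_inverse_ae f a b : ft f a b -> L1 a -> L1 b ->
  let F y := (2 * pi)^-1 * \int[mu]_xi (a xi * cos (xi * y) + b xi * sin (xi * y)) in
  isL2 F -> {ae mu, forall x, f x = F x}.
Proof.
move=> fab a1 b1 F LF; have [Lf _ _ _] := fab.
suff H : {ae mu, forall x, f x - F x = 0}.
  by apply: (@filterS _ _ (ae_filter_ringOfSetsType mu)) H => x /eqP; rewrite subr_eq0 => /eqP.
apply: L2_ae0; first exact: isL2B.
move=> al be ab; rewrite RintegralB//; try exact: L2_integrable_itv.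
apply/eqP; rewrite subr_eq0; apply/eqP.
pose e (n : nat) : R := n.+1%:R^-1.
have e0 n : 0 < e n by rewrite invr_gt0.
have e1 n : 0 < e n <= 1 by rewrite e0/= invf_le1// ler1n.
pose G y xi := a xi * cos (xi * y) + b xi * sin (xi * y).
have mcs y : measurable_fun setT (fun xi : R => cos (xi * y)) /\ measurable_fun setT (fun xi : R => sin (xi * y)).
  by split; [have := measurable_cos_lin y|have := measurable_sin_lin y]; under eq_fun do rewrite mulrC.
have [[/measurable_EFinP ma _] [/measurable_EFinP mb _]] := (integrableP _ _ _ a1, integrableP _ _ _ b1).
have mG y : measurable_fun setT (G y).
  by have [mc ms] := mcs y; apply: measurable_funD; exact: measurable_funM.
have iab : L1 (fun xi => `|a xi| + `|b xi|).
  by have := integrableD measurableT (integrable_norm a1) (integrable_norm b1).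
have Gle y xi : `|G y xi| <= `|a xi| + `|b xi|.
  apply: le_trans (ler_normD _ _) _; rewrite !normrM.
  by apply: lerD; rewrite ler_piMr// ?normr_cos ?normr_sin.
pose D n y := \int[mu]_xi (expR (- (e n * `|xi|)) * G y xi).
have dec1 n (xi : R) : `|expR (- (e n * `|xi|))| <= 1.
  by rewrite ger0_norm ?expR_ge0// -expR0 ler_expR oppr_le0 mulr_ge0// ltW.
have DE n y : D n y = \int[mu]_x (f x * poisson (e n) (x - y)) by exact: ft_poisson.
have mDG n y : measurable_fun setT (fun xi : R => expR (- (e n * `|xi|)) * G y xi).
  by apply: measurable_funM => //; exact: measurable_decay.
have iD n y : L1 (fun xi => expR (- (e n * `|xi|)) * G y xi).
  apply: (le_integrable measurableT _ _ iab) => /=.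
    by apply/measurable_EFinP; exact: mDG.
  move=> xi _; rewrite lee_fin normrM [leRHS]ger0_norm ?addr_ge0//.
  by apply: le_trans (Gle y xi); rewrite ler_piMl.
set N := \int[mu]_xi (`|a xi| + `|b xi|).
have Dle n y : `|D n y| <= N.
  apply: le_trans (le_normr_Rintegral measurableT (iD n y)) _.
  apply: le_Rintegral => //; first exact: (integrable_norm (iD n y)).
  by move=> xi _; apply: le_trans (Gle y xi); rewrite normrM ler_piMl.
have Dlim y : D n y @[n --> \oo] --> 2 * pi * F y.
  have -> : 2 * pi * F y = \int[mu]_xi G y xi by rewrite /F mulrA mulfV ?mul1r// mulf_neq0// gt_eqF// pi_gt0.
  apply: (@Rintegral_dominated_cvg setT _ _ (fun xi => `|a xi| + `|b xi|)) => //.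
  - apply: aeW => xi _; rewrite -[X in _ --> X]mul1r; apply: cvgM; last exact: cvg_cst.
    have h : - (e n * `|xi|) @[n --> \oo] --> - (0 * `|xi|).
      by apply: cvgN; apply: cvgM; [exact: cvg_harmonic|exact: cvg_cst].
    have := cvg_comp _ _ h (@continuous_expR R (- (0 * `|xi|))).
    by rewrite mul0r oppr0 expR0.
  - by move=> n xi _; rewrite normrM; apply: le_trans (Gle y xi); rewrite ler_piMl.
have mitv : measurable (`[al, be]%classic : set (measurableTypeR R)) by exact: measurable_itv.
have wlim : \int[mu]_(y in `[al, be]) D n y @[n --> \oo] --> 2 * pi * \int[mu]_(y in `[al, be]) F y.
  rewrite -RintegralZl//; last exact: L2_integrable_itv.
  apply: (@Rintegral_dominated_cvg `[al, be] _ _ (fun=> N)) => //.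
  - move=> n; apply: measurable_funTS.
    have i1 := integrable_mul_bounded a1 (measurable_decay (e n)) (dec1 n).
    have i2 := integrable_mul_bounded b1 (measurable_decay (e n)) (dec1 n).
    have -> : D n = fun y => cosint (fun xi => a xi * expR (- (e n * `|xi|))) y +
        sinint (fun xi => b xi * expR (- (e n * `|xi|))) y.
      apply/funext => y; rewrite /cosint /sinint -RintegralD//;
        [|exact: integrable_mul_cos|exact: integrable_mul_sin].
      by apply: eq_Rintegral => xi _; rewrite /G (mulrC y); ring.
    by apply: measurable_funD; [exact: measurable_cosint|exact: measurable_sinint].
  - by apply: measurable_funTS; apply: measurable_funM => //; exact: LF.1.
  - by apply: aeW => y _; exact: Dlim.
  - have := L2_integrable_itv al be (isL2Z N (isL2_indic al be)).
    by apply: eq_integrable => // y yab /=; rewrite indicE yab mulr1.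
(* After Fubini the window integral falls on the kernel and, away from the two endpoints, tends to 2
   pi times the indicator of the window. *)
have flim : \int[mu]_(y in `[al, be]) D n y @[n --> \oo] --> 2 * pi * \int[mu]_(y in `[al, be]) f y.
  rewrite Rintegral_itvE -RintegralZl//; last by apply: isL2_mul => //; exact: isL2_indic.
  have -> : (fun n => \int[mu]_(y in `[al, be]) D n y) =
      (fun n => \int[mu]_x (f x * \int[mu]_(y in `[al, be]) poisson (e n) (x - y))).
    apply/funext => n; rewrite -(Rintegral_window (e0 n) Lf ab).
    by apply: eq_Rintegral => y _; exact: DE.
  set C := (1 + 2 * (`|al| + `|be|) ^+ 2) * pi + 2 * (be - al).
  apply: (@Rintegral_dominated_cvg setT _ _ (fun x => C * `|f x * poisson 1 (x - 0)|)) => //.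
  - move=> n; apply: measurable_funM; first exact: Lf.1.
    have -> : (fun x => \int[mu]_(y in `[al, be]) poisson (e n) (x - y)) =
        (fun x => 2 * (atan ((be - x) * (e n)^-1) - atan ((al - x) * (e n)^-1))).
      by apply/funext => x; rewrite integral_poisson_itv.
    apply: continuous_measurable_fun => x; apply: ider_continuous; ider.
  - apply: measurable_funM => //; apply: measurable_funM; first exact: Lf.1.
    exact: measurable_indic.
  - exists [set al; be]; split => //.
    + by apply: measurableU; exact: measurable_set1.
    + by apply: countable_lebesgue_measure0; apply: finite_set_countable; exact: finite_set2.
    + move=> x /= Hx; apply: contrapT => xab; apply: Hx => _.
      have xa : x != al by apply/eqP => xE; apply: xab; left.
      have xb : x != be by apply/eqP => xE; apply: xab; right.
      rewrite mulrCA; apply: cvgM; first exact: cvg_cst.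
      have -> : (fun n => \int[mu]_(y in `[al, be]) poisson (e n) (x - y)) =
          (fun n => 2 * (atan ((be - x) * n.+1%:R) - atan ((al - x) * n.+1%:R))).
        by apply/funext => n; rewrite integral_poisson_itv// /e invrK.
      have -> : 2 * pi * \1_`[al, be] x =
          2 * (Num.sg (be - x) * (pi / 2) - Num.sg (al - x) * (pi / 2)).
        rewrite indicE mem_setE in_itv/=.
        have [ax|xa'] := ltP al x.
          rewrite (ltr0_sg (_ : al - x < 0)) ?subr_lt0// (ltW ax)/=.
          have [xb'|bx] := ltP x be.
            by rewrite (ltW xb')/= mulr1n (gtr0_sg (_ : 0 < be - x)) ?subr_gt0//; field.
          have bx' : be < x by rewrite lt_neqAle eq_sym xb.
          by rewrite leNgt bx'/= (ltr0_sg (_ : be - x < 0)) ?subr_lt0//; ring.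
        have xa'' : x < al by rewrite lt_neqAle xa.
        rewrite leNgt xa''/= (gtr0_sg (_ : 0 < al - x)) ?subr_gt0//.
        by rewrite (gtr0_sg (_ : 0 < be - x)) ?subr_gt0 ?(lt_trans xa'')//; ring.
      apply: cvgM; first exact: cvg_cst.
      by apply: cvgB; exact: cvg_atanM.
  - have fp : L1 (fun x => f x * poisson 1 (x - 0)) by apply: isL2_mul => //; exact: isL2_poisson.
    by have := integrableZl measurableT C (integrable_norm fp).
  - move=> n x _; rewrite normrM [in leRHS]normrM subr0 [leRHS]mulrCA ler_wpM2l//.
    by rewrite [in leRHS]ger0_norm ?poisson_ge0//; exact: window_le.
have p2 : 2 * pi != 0 :> R by rewrite mulf_neq0// gt_eqF// pi_gt0.
by apply: (mulfI p2); exact: cvg_unique flim wlim.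
Qed.

(** The coefficients are those of the inversion integral. The factor 1 / (2 pi) absorbs the
    constants of the cosine and sine parts: the sup bounds need 2 <= 2 pi and the L^2 bounds 2 / pi
    <= 1, so that c is kept. *)
Lemma ft_tower f a b (rho sigma c : R) : 0 < rho < sigma -> 0 < c -> ft f a b ->
  (\int[mu]_xi (expR (sigma * `|xi|) ^+ 2 * (a xi ^+ 2 + b xi ^+ 2))%:E <= (c ^+ 2)%:E)%E ->
  exists f_ : nat -> R -> R, [/\ tower f_,
    {ae mu, forall x, f x = f_ 0%N x},
    forall n x, `|f_ n x| <= inverse_const rho sigma * c * rho^-1 ^+ n &
    forall n, (sqint (f_ n) <= ((c * rho^-1 ^+ n) ^+ 2)%:E)%E].
Proof.
move=> /andP[rho0 rs] c0 fab H; have [_ [ma _] [mb _] _] := fab.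
have mexp : measurable_fun setT (fun xi : R => expR (sigma * `|xi|)).
  by have := measurable_decay (- sigma); under eq_fun do rewrite mulNr opprK.
have key (u : R -> R) : measurable_fun setT u -> (forall xi, u xi ^+ 2 <= a xi ^+ 2 + b xi ^+ 2) ->
    (sqint (fun xi => expR (sigma * `|xi|) * u xi)%R <= (c ^+ 2)%:E)%E.
  move=> mu_ le; apply: le_trans H; apply: ge0_le_integral => //.
  - by move=> xi _; rewrite lee_fin sqr_ge0.
  - by apply: measurable_sqr; exact: measurable_funM.
  - apply/measurable_EFinP; apply: measurable_funM; first exact: measurable_funX.
    by apply: measurable_funD; exact: measurable_funX.
  - by move=> xi _; rewrite lee_fin exprMn ler_wpM2l ?sqr_ge0.
have ha : (sqint (fun xi => expR (sigma * `|xi|) * a xi)%R <= (c ^+ 2)%:E)%E.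
  by apply: key => // xi; rewrite lerDl sqr_ge0.
have hb : (sqint (fun xi => expR (sigma * `|xi|) * b xi)%R <= (c ^+ 2)%:E)%E.
  by apply: key => // xi; rewrite lerDr sqr_ge0.
pose A := inverse_coeff a 0; pose B := inverse_coeff b (- (pi / 2)).
pose f_ n x := (2 * pi)^-1 * (A n x + B n x).
have pi0 : 0 < pi :> R by exact: pi_gt0.
have pi2 : 2 <= pi :> R by exact: pi_ge2.
have tA : tower A by exact: inverse_coeff_tower rho0 rs c0 ma ha _.
have tB : tower B by exact: inverse_coeff_tower rho0 rs c0 mb hb _.
have sA n := sqint_inverse_coeff rho0 rs c0 ma ha 0 n.
have sB n := sqint_inverse_coeff rho0 rs c0 mb hb (- (pi / 2)) n.
have tf : tower f_.
  move=> n x; have := iderM (ider_cst (2 * pi)^-1 x) (iderD (tA n x) (tB n x)).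
  by move=> d; eapply is_derive_eq; [exact: d|rewrite mul0r add0r /f_; ring].
have sf n : (sqint (f_ n) <= ((c * rho^-1 ^+ n) ^+ 2)%:E)%E.
  have mA := tower_measurable n tA; have mB := tower_measurable n tB.
  rewrite sqintZ; last exact: measurable_funD.
  have p0 : (0 <= (((2 * pi)^-1 : R) ^+ 2)%:E)%E by rewrite lee_fin sqr_ge0.
  apply: le_trans (lee_wpmul2l p0 (sqintD mA mB)) _.
  have h2 : (0 <= 2%:E :> \bar R)%E by rewrite lee_fin.
  apply: le_trans (lee_wpmul2l p0 (leeD (lee_wpmul2l h2 (sA n)) (lee_wpmul2l h2 (sB n)))) _.
  rewrite -!(EFinM 2) -EFinD -EFinM lee_fin.
  have := sqr_ge0 (c * rho^-1 ^+ n); move: ((c * rho^-1 ^+ n) ^+ 2) => z z0.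
  have -> : (2 * pi)^-1 ^+ 2 * (2 * (2 * pi * z) + 2 * (2 * pi * z)) = 2 / pi * z.
    by move: pi0; move: (pi : R) => p p0'; field; rewrite gt_eqF.
  by rewrite ler_piMl// ler_pdivrMr// mul1r.
exists f_; split => //.
- have a1 : mu.-integrable setT (EFin \o a).
    have := integrable_inverse_coeff rho0 rs c0 ma ha 0.
    by apply: eq_integrable => // xi _ /=; rewrite fact0 expr0 invr1 mulr1 mul1r.
  have b1 : mu.-integrable setT (EFin \o b).
    have := integrable_inverse_coeff rho0 rs c0 mb hb 0.
    by apply: eq_integrable => // xi _ /=; rewrite fact0 expr0 invr1 mulr1 mul1r.
  have L0 : isL2 (f_ 0%N).
    by split; [exact: tower_measurable tf|apply: le_lt_trans (sf 0%N) _; rewrite ltry].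
  have E : (fun y => (2 * pi)^-1 * \int[mu]_xi (a xi * cos (xi * y) + b xi * sin (xi * y))) = f_ 0%N.
    apply/funext => y; rewrite /f_; congr (_ * _).
    have mcs : measurable_fun setT (fun xi : R => cos (xi * y)) /\ measurable_fun setT (fun xi : R => sin (xi * y)).
      by split; [have := measurable_cos_lin y|have := measurable_sin_lin y]; under eq_fun do rewrite mulrC.
    rewrite RintegralD//.
    + congr (_ + _); apply: eq_Rintegral => xi _; rewrite fact0 expr0 invr1 mulr1 mul1r mul0r.
        by rewrite !addr0.
      by rewrite addr0 cosBpihalf.
    + by apply: (integrable_mul_bounded a1 mcs.1) => xi; exact: normr_cos.
    + by apply: (integrable_mul_bounded b1 mcs.2) => xi; exact: normr_sin.
  by move: (ft_inverse_ae fab a1 b1); cbv zeta; rewrite E => /(_ L0).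
- move=> n x.
  have hA := inverse_coeff_le rho0 rs c0 ma ha 0 n x.
  have hB := inverse_coeff_le rho0 rs c0 mb hb (- (pi / 2)) n x.
  rewrite /f_ normrM ger0_norm ?invr_ge0 ?mulr_ge0 ?(ltW pi0)//.
  rewrite ler_pdivrMl ?mulr_gt0//; apply: le_trans (ler_normD _ _) _.
  apply: le_trans (lerD hA hB) _.
  have : 0 <= rho^-1 ^+ n * (inverse_const rho sigma * c) by exact: le_trans hA.
  have -> : inverse_const rho sigma * c * rho^-1 ^+ n = rho^-1 ^+ n * (inverse_const rho sigma * c).
    by rewrite mulrC.
  move: (rho^-1 ^+ n * (inverse_const rho sigma * c)) => z z0; nra.
Qed.

End InverseTransform.

(** * Majorant series *)

Section Majorant.
Context {R : realType}.
Variables (lam q : R).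
Hypotheses (lam0 : 0 <= lam) (q0 : 0 <= q).

Definition invsq (N : nat) : R := (N.+1%:R ^+ 2)^-1.

(* Coefficient of [T^k X^n] in [phi (lam T + q X)], where
   [phi z = \sum_N z^N / (N+1)^2] satisfies [phi^2 << 8 phi]. *)
Definition majorant k n := 'C(k + n, k)%:R * (lam ^+ k * q ^+ n * invsq (k + n)).

Lemma invsq_gt0 N : 0 < invsq N.
Proof. by rewrite invr_gt0 exprn_gt0. Qed.

Lemma sum_invsq N : \sum_(i < N.+1) invsq i <= 2 - N.+1%:R^-1.
Proof.
elim: N => [|N IH]; first by rewrite big_ord1 /invsq expr1n invr1; lra.
rewrite big_ord_recr/=; apply: le_trans (lerD IH (lexx _)) _.
rewrite -addrA lerD2l /invsq -(natr1 N.+1).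
have : 0 < N.+1%:R :> R by [].
move: (N.+1%:R : R) => x x0; rewrite -subr_ge0.
have -> : - (x + 1)^-1 - (- x^-1 + ((x + 1) ^+ 2)^-1) = (x * (x + 1) ^+ 2)^-1.
  by field; rewrite !gt_eqF// addr_gt0.
by rewrite invr_ge0 mulr_ge0 ?sqr_ge0// ltW.
Qed.

(** For a + b = N + 2, 1/(a^2 b^2) is at most 2 (1/a^2 + 1/b^2) / (a + b)^2, and each of the two
    resulting sums is at most 2. *)
Lemma invsq_conv N : \sum_(s < N.+1) invsq s * invsq (N - s) <= 8 * invsq N.
Proof.
have N2 : 0 < N.+2%:R :> R by [].
apply: (@le_trans _ _ (\sum_(s < N.+1) (2 / N.+2%:R ^+ 2 * (invsq s + invsq (N - s))))).
  apply: ler_sum => s _; rewrite /invsq.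
  have -> : N.+2%:R = s.+1%:R + (N - s).+1%:R :> R.
    by rewrite -natrD; congr _%:R; have := ltn_ord s; lia.
  have : 0 < s.+1%:R :> R by [].
  have : 0 < (N - s).+1%:R :> R by [].
  move: ((N - s).+1%:R : R) (s.+1%:R : R) => b a b0 a0.
  rewrite -subr_ge0.
  have -> : 2 / (a + b) ^+ 2 * ((a ^+ 2)^-1 + (b ^+ 2)^-1) - (a ^+ 2)^-1 * (b ^+ 2)^-1 =
    (a - b) ^+ 2 / (a * b * (a + b)) ^+ 2.
    by field; rewrite !gt_eqF// addr_gt0.
  by rewrite divr_ge0 ?sqr_ge0.
rewrite -mulr_sumr big_split/=.
have -> : \sum_(i < N.+1) invsq (N - i) = \sum_(i < N.+1) invsq i.
  rewrite (reindex_inj rev_ord_inj)/=; apply: eq_bigr => i _.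
  by congr invsq; have := ltn_ord i; lia.
have S2 : \sum_(i < N.+1) invsq i <= 2.
  by apply: le_trans (sum_invsq _) _; rewrite gerBl invr_ge0.
apply: (@le_trans _ _ (2 / N.+2%:R ^+ 2 * 4)).
  by apply: ler_wpM2l; [rewrite divr_ge0 ?exprn_ge0|lra].
have -> : 2 / N.+2%:R ^+ 2 * 4 = 8 * invsq N.+1 by rewrite /invsq; field; rewrite gt_eqF.
by rewrite ler_wpM2l// lef_pV2 ?posrE ?exprn_gt0// lerXn2r ?nnegrE// ler_nat.
Qed.

Lemma majorant_ge0 k n : 0 <= majorant k n.
Proof. by rewrite mulr_ge0// !mulr_ge0 ?exprn_ge0// ltW// invsq_gt0. Qed.

(** Grouping the terms by total degree s = i + m, Vandermonde's identity collapses the binomials to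
    C(k+n, k) and leaves the convolution of [invsq_conv]. *)
Lemma majorant_conv k n :
  \sum_(i < k.+1) \sum_(m < n.+1) majorant i m * majorant (k - i) (n - m) <= 8 * majorant k n.
Proof.
set N := (k + n)%N.
pose F i s : R := ('C(s, i) * 'C(N - s, k - i))%:R * (invsq s * invsq (N - s)).
have F0 i s : 0 <= F i s by rewrite mulr_ge0// mulr_ge0// ltW// invsq_gt0.
have P0 : 0 <= lam ^+ k * q ^+ n by rewrite mulr_ge0// exprn_ge0.
have -> : \sum_(i < k.+1) \sum_(m < n.+1) majorant i m * majorant (k - i) (n - m) =
    lam ^+ k * q ^+ n * \sum_(i < k.+1) \sum_(m < n.+1) F i (i + m)%N.
  rewrite mulr_sumr; apply: eq_bigr => i _; rewrite mulr_sumr; apply: eq_bigr => m _.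
  have ik : (i <= k)%N by rewrite -ltnS.
  have mn : (m <= n)%N by rewrite -ltnS.
  rewrite /majorant /F.
  have -> : (N - (i + m) = (k - i) + (n - m))%N by rewrite /N; lia.
  have -> : lam ^+ k = lam ^+ i * lam ^+ (k - i) by rewrite -exprD subnKC.
  have -> : q ^+ n = q ^+ m * q ^+ (n - m) by rewrite -exprD subnKC.
  by rewrite natrM; ring.
have -> : 8 * majorant k n = lam ^+ k * q ^+ n * ('C(N, k)%:R * (8 * invsq N)).
  by rewrite /majorant -/N; ring.
rewrite ler_wpM2l//.
apply: (@le_trans _ _ (\sum_(i < k.+1) \sum_(s < N.+1) F i s)).
  apply: ler_sum => i _; have ik : (i <= k)%N by rewrite -ltnS.
  rewrite -(big_mkord xpredT (fun m => F i (i + m)%N)) -(big_mkord xpredT (F i)).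
  rewrite (@big_cat_nat _ _ _ i 0 N.+1)//=; last by rewrite /N; lia.
  rewrite (@big_cat_nat _ _ _ (i + n.+1) i N.+1)//=; [|lia|rewrite /N; lia].
  have -> : \sum_(i <= s < i + n.+1) F i s = \sum_(0 <= m < n.+1) F i (i + m)%N.
    rewrite -{1}[i : nat]add0n big_addn addKn; apply: eq_bigr => m _; by rewrite addnC.
  by rewrite addrCA lerDl addr_ge0// sumr_ge0.
rewrite exchange_big/=.
have -> : \sum_(s < N.+1) \sum_(i < k.+1) F i s = 'C(N, k)%:R * \sum_(s < N.+1) invsq s * invsq (N - s).
  rewrite mulr_sumr; apply: eq_bigr => s _; rewrite /F -mulr_suml; congr (_ * _).
  by rewrite -natr_sum binomial.Vandermonde subnKC// -ltnS.
by rewrite ler_wpM2l// invsq_conv.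
Qed.

(** A function of lam T + q X satisfies q d/dT = lam d/dX. An X-derivative is thus exchanged for a
    T-derivative at the cost q / lam, which a large lam makes small. *)
Lemma majorant_shift k n : k.+1%:R * majorant k.+1 n * q = lam * (n.+1%:R * majorant k n.+1).
Proof.
rewrite /majorant addSn addnS.
have E : (k.+1 * 'C((k + n).+1, k.+1) = n.+1 * 'C((k + n).+1, k))%N.
  have := mul_bin_left (k + n).+1 k; rewrite subSn ?leq_addr// addKn.
  by move=> ->.
have E' : k.+1%:R * 'C((k + n).+1, k.+1)%:R = n.+1%:R * 'C((k + n).+1, k)%:R :> R.
  by rewrite -!natrM E.
transitivity (k.+1%:R * 'C((k + n).+1, k.+1)%:R * (lam ^+ k.+1 * q ^+ n.+1 * invsq (k + n).+1)).
  by rewrite !exprS; ring.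
by rewrite E' !exprS; ring.
Qed.

(** One term of the binomial expansion of (y + (1 - y))^(k+n) = 1. The parameter y divides the joint
    domain of convergence between time and space. *)
Lemma majorant_le (y : R) k n : 0 < y < 1 -> majorant k n <= (lam / y) ^+ k * (q / (1 - y)) ^+ n.
Proof.
move=> /andP[y0 y1].
have z0 : 0 < 1 - y by rewrite subr_gt0.
have B : 'C(k + n, k)%:R * (y ^+ k * (1 - y) ^+ n) <= 1.
  have := exprDn (1 - y) y (k + n); rewrite subrK expr1n => E; rewrite [leRHS]E.
  have kN : (k < (k + n).+1)%N by rewrite ltnS leq_addr.
  rewrite (bigD1 (Ordinal kN))//= addKn -[X in _ <= X + _]mulr_natl (mulrC (y ^+ k)) lerDl.
  apply: sumr_ge0 => i _; rewrite mulrn_wge0// mulr_ge0// exprn_ge0// ltW//.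
have I1 : invsq (k + n) <= 1.
  by rewrite /invsq invf_le1 ?exprn_gt0// expr_ge1// ler1n.
rewrite /majorant !expr_div_n.
apply: (@le_trans _ _ ('C(k + n, k)%:R * (lam ^+ k * q ^+ n))).
  by rewrite ler_wpM2l// ler_piMr// mulr_ge0// exprn_ge0.
have yk : 0 < y ^+ k by rewrite exprn_gt0.
have zn : 0 < (1 - y) ^+ n by rewrite exprn_gt0.
have -> : lam ^+ k / y ^+ k * (q ^+ n / (1 - y) ^+ n) =
   (lam ^+ k * q ^+ n) / (y ^+ k * (1 - y) ^+ n) by field; rewrite !gt_eqF.
rewrite ler_pdivlMr ?mulr_gt0// mulrAC ler_piMl// mulr_ge0// exprn_ge0//.
Qed.

Definition conv2 (F G : nat -> nat -> R) k n :=
  \sum_(i < k.+1) \sum_(m < n.+1) F i m * G (k - i)%N (n - m)%N.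

Lemma conv2_le F G (a b : R) k n : 0 <= a -> 0 <= b ->
  (forall i m, (i <= k)%N -> (m <= n)%N -> `|F i m| <= a * majorant i m) ->
  (forall i m, (i <= k)%N -> (m <= n)%N -> `|G i m| <= b * majorant i m) ->
  `|conv2 F G k n| <= 8 * a * b * majorant k n.
Proof.
move=> a0 b0 hF hG.
apply: (@le_trans _ _ (a * b * \sum_(i < k.+1) \sum_(m < n.+1) majorant i m * majorant (k - i) (n - m))).
  rewrite mulr_sumr; apply: le_trans (ler_norm_sum _ _ _) _; apply: ler_sum => i _.
  rewrite mulr_sumr; apply: le_trans (ler_norm_sum _ _ _) _; apply: ler_sum => m _.
  rewrite normrM mulrACA ler_pM//; [apply: hF|apply: hG].
  - by rewrite -ltnS.
  - by rewrite -ltnS.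
  - by rewrite leq_subr.
  - by rewrite leq_subr.
have -> : 8 * a * b * majorant k n = a * b * (8 * majorant k n) by ring.
by rewrite ler_wpM2l ?mulr_ge0// majorant_conv.
Qed.

(** Up to absolute values, F times dG/dX has smaller coefficients than the X-derivative of F G,
    since m + 1 <= n + 1 in each term; the derivative therefore falls on the majorant of the
    product. [conv2_time_le] is the same argument in T. *)
Lemma conv2_space_le F G (a b : R) k n : 0 <= a -> 0 <= b ->
  (forall i m, (i <= k)%N -> `|F i m| <= a * majorant i m) ->
  (forall i m, (i <= k)%N -> `|G i m| <= b * majorant i m) ->
  `|conv2 F (fun i m => m.+1%:R * G i m.+1) k n| <= 8 * a * b * (n.+1%:R * majorant k n.+1).
Proof.
move=> a0 b0 hF hG.
have H := @conv2_le (fun i m => `|F i m|) (fun i m => `|G i m|) a b k n.+1 a0 b0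
  (fun i m ik _ => ltac:(rewrite normr_id; exact: hF)) (fun i m ik _ => ltac:(rewrite normr_id; exact: hG)).
have -> : 8 * a * b * (n.+1%:R * majorant k n.+1) = n.+1%:R * (8 * a * b * majorant k n.+1) by ring.
apply: le_trans (ler_wpM2l _ H) => //; apply: le_trans (ler_wpM2l _ (ler_norm _)) => //.
rewrite /conv2 mulr_sumr; apply: le_trans (ler_norm_sum _ _ _) _; apply: ler_sum => i _.
rewrite [X in _ <= _ * X]big_ord_recr/= mulrDr; apply: le_trans (ler_norm_sum _ _ _) _.
rewrite -[leLHS]addr0 lerD ?mulr_ge0// mulr_sumr; apply: ler_sum => m _.
have mn : (m <= n)%N by rewrite -ltnS.
rewrite subSn// !normrM mulrCA (ger0_norm (ler0n _ _)) ler_wpM2r ?mulr_ge0// ler_nat.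
by rewrite ltnS leq_subr.
Qed.

Lemma conv2_time_le F G (a b : R) k n : 0 <= a -> 0 <= b ->
  (forall i m, (i <= k)%N -> `|F i m| <= a * majorant i m) ->
  (forall i m, (i <= k)%N -> `|G i m| <= b * (i.+1%:R * majorant i.+1 m)) ->
  `|conv2 F G k n| <= 8 * a * b * (k.+1%:R * majorant k.+1 n).
Proof.
move=> a0 b0 hF hG.
have P0 i m : 0 <= a * majorant i m by rewrite mulr_ge0// majorant_ge0.
have Q0 i m : 0 <= b * majorant i m by rewrite mulr_ge0// majorant_ge0.
have H := @conv2_le (fun i m => a * majorant i m) (fun i m => b * majorant i m) a b k.+1 n a0 b0
  (fun i m _ _ => ltac:(by rewrite ger0_norm)) (fun i m _ _ => ltac:(by rewrite ger0_norm)).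
have -> : 8 * a * b * (k.+1%:R * majorant k.+1 n) = k.+1%:R * (8 * a * b * majorant k.+1 n) by ring.
apply: le_trans (ler_wpM2l _ H) => //; apply: le_trans (ler_wpM2l _ (ler_norm _)) => //.
rewrite /conv2 mulr_sumr [leRHS]big_ord_recr/=; apply: le_trans (ler_norm_sum _ _ _) _.
rewrite -[leLHS]addr0 lerD//; last by rewrite mulr_ge0// sumr_ge0// => m _; rewrite mulr_ge0.
apply: ler_sum => i _; have ik : (i <= k)%N by rewrite -ltnS.
rewrite mulr_sumr; apply: le_trans (ler_norm_sum _ _ _) _; apply: ler_sum => m _.
rewrite subSn// normrM mulrCA ler_pM//; first exact: hF.
apply: le_trans (hG _ _ (leq_subr _ _)) _.
by rewrite mulrCA ler_wpM2r// ler_nat ltnS leq_subr.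
Qed.

End Majorant.

(** * Series with geometrically bounded terms *)

Section GeometricSeries.
Context {R : realType}.
Implicit Types (a b : nat -> R) (B C s t : R).

Definition sums a s := \sum_(k < N) a k @[N --> \oo] --> s.
Definition sig a := limn (fun N => \sum_(k < N) a k).
(** The fixed ratio 1/4 keeps sums below 2 B and leaves room for a linear factor: N 4^-N <= 2^-N. *)
Definition geo B a := forall k, `|a k| <= B * 4^-1 ^+ k.

Lemma sums_unique a s t : sums a s -> sums a t -> s = t.
Proof. exact: cvg_unique. Qed.

Lemma sumsD a b s t : sums a s -> sums b t -> sums (fun k => a k + b k) (s + t).
Proof.
by move=> sa sb; rewrite /sums; under eq_fun do rewrite big_split/=; exact: cvgD.
Qed.

Lemma sumsZ a s t : sums a s -> sums (fun k => t * a k) (t * s).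
Proof.
by move=> sa; rewrite /sums; under eq_fun do rewrite -mulr_sumr; apply: cvgM => //; exact: cvg_cst.
Qed.

Lemma sumsB a b s t : sums a s -> sums b t -> sums (fun k => a k - b k) (s - t).
Proof.
by move=> sa sb; rewrite /sums; under eq_fun do rewrite sumrB; exact: cvgB.
Qed.

Lemma sums_bounded (q B : R) a : 0 <= q < 1 -> (forall k, `|a k| <= B * q ^+ k) ->
  sums a (sig a) /\ forall N, `|sig a - \sum_(k < N) a k| <= B * q ^+ N / (1 - q).
Proof.
move=> q01 ha; have B0 : 0 <= B by have := ha 0%N; rewrite mulr1; exact: le_trans.
have [k|l al bl] := @geometric_limit R (fun N => \sum_(k < N) a k) B q B0 q01.
  by rewrite big_ord_recr/= addrAC subrr add0r; exact: ha.
have E : sig a = l by exact: cvg_lim al.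
by rewrite E; split => // N; rewrite distrC.
Qed.

Lemma geo_bounded B a : geo B a -> sums a (sig a) /\
  forall N, `|sig a - \sum_(k < N) a k| <= 2 * B * 4^-1 ^+ N.
Proof.
move=> ga; have [|sa H] := @sums_bounded 4^-1 B a _ ga.
  by rewrite invr_ge0 ler0n/= invf_lt1// ltr1n.
split => // N; apply: le_trans (H N) _.
have : 0 <= B * 4^-1 ^+ N by exact: le_trans (ga N).
move: (B * 4^-1 ^+ N) (mulrA 2 B (4^-1 ^+ N)) => z <- z0.
rewrite -subr_ge0 (_ : _ - _ = 2 / 3 * z); last by field.
by rewrite mulr_ge0.
Qed.

Lemma geo_sums B a : geo B a -> sums a (sig a).
Proof. by case/geo_bounded. Qed.

Lemma sums_le B a s : geo B a -> sums a s -> `|s| <= 2 * B.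
Proof.
move=> ga sa; have [sa' /(_ 0%N)] := geo_bounded ga.
by rewrite -(sums_unique sa' sa) big_ord0 subr0 mulr1.
Qed.

Lemma conv_partial a b N : \sum_(k < N) \sum_(i < k.+1) a i * b (k - i)%N =
  \sum_(i < N) a i * \sum_(j < N - i) b j.
Proof.
elim: N => [|N IH]; first by rewrite !big_ord0.
rewrite big_ord_recr/= IH [in RHS]big_ord_recr/= subSnn big_ord1 [in LHS]big_ord_recr/= subnn.
rewrite addrA -big_split/=; congr (_ + _); apply: eq_bigr => i _.
by rewrite subSn ?(ltnW (ltn_ord i))// big_ord_recr/= mulrDr.
Qed.

(** The square partial product and the triangular one differ by terms a_i times a tail of b from N -
    i on; each is at most 2 B C 4^-N, and there are N of them. *)
Lemma sums_conv B C a b : geo B a -> geo C b ->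
  sums (fun k => \sum_(i < k.+1) a i * b (k - i)%N) (sig a * sig b).
Proof.
move=> ga gb.
have B0 : 0 <= B by have := ga 0%N; rewrite mulr1; exact: le_trans.
have C0 : 0 <= C by have := gb 0%N; rewrite mulr1; exact: le_trans.
have [sa _] := geo_bounded ga; have [sb hb] := geo_bounded gb.
have main : (\sum_(k < N) a k) * sig b @[N --> \oo] --> sig a * sig b.
  by apply: cvgM => //; exact: cvg_cst.
suff : (\sum_(k < N) a k) * sig b - \sum_(k < N) \sum_(i < k.+1) a i * b (k - i)%N @[N --> \oo] --> 0.
  move=> /(cvgB main); rewrite subr0; apply: cvg_trans; apply: near_eq_cvg.
  by apply: nearW => N /=; rewrite opprB addrCA subrr addr0.
apply/norm_cvg0P; apply: (@squeeze_cvgr _ _ _ _ (fun=> 0) (fun N : nat => 2 * B * C * 2^-1 ^+ N)).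
- apply: nearW => N; rewrite normr_ge0/= conv_partial mulr_suml -sumrB.
  apply: le_trans (ler_norm_sum _ _ _) _.
  apply: (@le_trans _ _ (\sum_(i < N) 2 * B * C * 4^-1 ^+ N)).
    apply: ler_sum => i _; rewrite -mulrBr normrM.
    apply: le_trans (ler_pM _ _ (ga i) (hb (N - i)%N)) _ => //.
    have -> : 4^-1 ^+ N = 4^-1 ^+ i * 4^-1 ^+ (N - i) :> R by rewrite -exprD subnKC// ltnW.
    by apply: le_of_eq; ring.
  rewrite sumr_const card_ord [leLHS](_ : _ = 2 * B * C * (4^-1 ^+ N * N%:R)); last first.
    by rewrite -[LHS]mulr_natr -!mulrA.
  rewrite ler_wpM2l ?mulr_ge0//.
  have -> : 4^-1 ^+ N = 2^-1 ^+ N * 2^-1 ^+ N :> R by rewrite -exprMn; congr (_ ^+ _); field.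
  rewrite -mulrA ler_piMr ?exprn_ge0// exprVn ler_pdivrMl ?exprn_gt0// mulr1.
  by rewrite -natrX ler_nat ltnW// ltn_expl.
- exact: cvg_cst.
- rewrite -[X in _ --> X](mulr0 (2 * B * C)); apply: cvgM; first exact: cvg_cst.
  by apply: cvg_expr; rewrite ger0_norm ?invr_ge0// invf_lt1// ltr1n.
Qed.

Lemma power_series_derive a (B lam t : R) : 0 < lam -> (forall k, `|a k| <= B * lam ^+ k) ->
  `|t| < (8 * lam)^-1 ->
  is_derive t 1 (fun t => sig (fun k => a k * t ^+ k)) (sig (fun k => k.+1%:R * a k.+1 * t ^+ k)).
Proof.
move=> lam0 ha ht.
have B0 : 0 <= B by have := ha 0%N; rewrite mulr1; exact: le_trans.
(* The differentiation theorem asks for convergence at K of the series and of its first two derived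
   series. There lam K = 1/8, and the factor (k+1)(k+2) <= 2 4^k still leaves the ratio 1/2. *)
pose K := (8 * lam)^-1.
have K0 : 0 < K by rewrite invr_gt0 mulr_gt0.
have KE : lam * K = 8^-1 by rewrite /K; field; rewrite gt_eqF.
have cv (c : nat -> R) D : (forall k, `|c k| <= D * (4^k)%:R * lam ^+ k) -> cvgn (pseries c K).
  move=> hc; have [|k|s _] := @sums_bounded 2^-1 D (fun k => c k * K ^+ k) _ _.
  - by rewrite invr_ge0 ler0n/= invf_lt1// ltr1n.
  - rewrite normrM (ger0_norm (exprn_ge0 _ (ltW K0))).
    apply: le_trans (ler_wpM2r (exprn_ge0 _ (ltW K0)) (hc k)) _.
    rewrite -!mulrA -exprMn KE natrX -exprMn.
    by have -> : 4 * 8^-1 = 2^-1 :> R by field.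
  apply/cvg_ex; exists (sig (fun k => c k * K ^+ k)).
  by move: s; rewrite /sums /pseries /series/=; under eq_fun do rewrite -(big_mkord xpredT (fun k => c k * K ^+ k)).
have E (c : nat -> R) x : limn (pseries c x) = sig (fun k => c k * x ^+ k).
  by rewrite /sig /pseries /series/=; congr (limn _); apply/funext => N; rewrite big_mkord.
have h1 : cvgn (pseries a K).
  apply: (cv _ B) => k; apply: le_trans (ha k) _; rewrite ler_wpM2r ?exprn_ge0 ?(ltW lam0)//.
  by rewrite ler_peMr// ler1n expn_gt0.
have h2 : cvgn (pseries (pseries_diffs a) K).
  apply: (cv _ (B * lam)) => k; rewrite /pseries_diffs normrM ger0_norm//.
  apply: le_trans (ler_wpM2l _ (ha k.+1)) _ => //.
  rewrite exprS [leLHS](_ : _ = B * lam * k.+1%:R * lam ^+ k); last by ring.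
  rewrite ler_wpM2r ?exprn_ge0 ?(ltW lam0)// ler_wpM2l ?mulr_ge0 ?(ltW lam0)// ler_nat.
  exact: ltn_expl.
have h3 : cvgn (pseries (pseries_diffs (pseries_diffs a)) K).
  apply: (cv _ (2 * B * lam ^+ 2)) => k; rewrite /pseries_diffs !normrM !(ger0_norm (ler0n _ _)).
  apply: le_trans (ler_wpM2l _ (ler_wpM2l _ (ha k.+2))) _ => //.
  rewrite !exprS [leLHS](_ : _ = B * (lam * lam) * (k.+1%:R * k.+2%:R) * lam ^+ k); last by ring.
  rewrite ler_wpM2r ?exprn_ge0 ?(ltW lam0)// expr0 mulr1.
  have -> : 2 * B * (lam * lam) * (4 ^ k)%:R = B * (lam * lam) * (2 * (4 ^ k)%:R) by ring.
  rewrite ler_wpM2l ?mulr_ge0 ?(ltW lam0)// -!natrM ler_nat.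
  have := ltn_expl k (isT : 1 < 2)%N; have -> : (4 ^ k = 2 ^ k * 2 ^ k)%N by rewrite -expnMn.
  by nia.
have h4 : `|t| < `|K| by rewrite (ger0_norm (ltW K0)).
by have := pseries_snd_diffs h1 h2 h3 h4; rewrite (funext (E a)) E.
Qed.

End GeometricSeries.

(** * Products, exponentials and series of Taylor towers *)

Section TowerAlgebra.
Context {R : realType}.
Implicit Types (f g : nat -> R -> R).

Definition tmul f g n x : R := \sum_(m < n.+1) f m x * g (n - m)%N x.
Definition tder f n x : R := n.+1%:R * f n.+1 x.

Lemma ider_sum (F : nat -> R -> R) (dF : nat -> R) n (x : R) :
  (forall i, is_derive x 1 (F i) (dF i)) ->
  is_derive x 1 (fun y => \sum_(i < n) F i y) (\sum_(i < n) dF i).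
Proof.
move=> H; elim: n => [|n IH].
  by rewrite big_ord0; under eq_fun do rewrite big_ord0; exact: ider_cst.
by rewrite big_ord_recr/=; under eq_fun do rewrite big_ord_recr/=; exact: iderD.
Qed.

Lemma towerD f g : tower f -> tower g -> tower (fun n x => f n x + g n x).
Proof. by move=> tf tg n x; rewrite mulrDr; exact: iderD. Qed.

Lemma towerZ f (k : R) : tower f -> tower (fun n x => k * f n x).
Proof.
move=> tf n x; have := iderM (ider_cst k x) (tf n x) => d.
by eapply is_derive_eq; [exact: d|rewrite mul0r add0r; ring].
Qed.

Lemma towerB f g : tower f -> tower g -> tower (fun n x => f n x - g n x).
Proof. by move=> tf tg n x; rewrite mulrBr; exact: iderB. Qed.

Lemma tower_der f : tower f -> tower (tder f).
Proof.
by move=> tf n x; have := towerZ n.+1%:R tf; rewrite /tder => /(_ n.+1 x) d; eapply is_derive_eq; [exact: d|ring].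
Qed.

Lemma tower_sum (F : nat -> nat -> R -> R) N : (forall i, tower (F i)) ->
  tower (fun n x => \sum_(i < N) F i n x).
Proof. move=> tF n x; rewrite mulr_sumr.
exact: (@ider_sum (fun i => F i n) (fun i => n.+1%:R * F i n.+1 x) N x (fun i => tF i n x)). Qed.

Lemma tower_mul f g : tower f -> tower g -> tower (tmul f g).
Proof.
move=> tf tg n x.
have H (m : nat) := iderM (tf m x) (tg (n - m)%N x).
have := @ider_sum _ _ n.+1 x H => d; eapply is_derive_eq; [exact: d|].
rewrite big_split/= /tmul.
(* Both halves of the product rule are written over the same n + 2 products; their weights m and n +
   1 - m add up to n + 1. *)
transitivity (\sum_(m < n.+2) m%:R * (f m x * g (n.+1 - m)%N x) +
    \sum_(m < n.+2) (n.+1 - m)%:R * (f m x * g (n.+1 - m)%N x)).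
  rewrite [X in _ = X + _]big_ord_recl/= mul0r add0r [X in _ = _ + X]big_ord_recr/= subnn mul0r addr0.
  congr (_ + _); apply: eq_bigr => m _; first by rewrite /bump/= subSS mulrA.
  have mn : (m <= n)%N by rewrite -ltnS.
  by rewrite (subSn mn) mulrCA.
rewrite -big_split mulr_sumr/=; apply: eq_bigr => m _.
by rewrite -mulrDl -natrD subnKC// -ltnS.
Qed.

(** Termwise differentiation: the bounds on the coefficients of order n + 2 sum to a quadratic
    remainder for those of order n. *)
Lemma tower_sig (c : nat -> nat -> R -> R) (B : nat -> R) : (forall k, tower (c k)) ->
  (forall n x, geo (B n) (fun k => c k n x)) -> tower (fun n x => sig (fun k => c k n x)).
Proof.
move=> tc gc n x.
have B0 m : 0 <= B m by have := gc m 0 0%N; rewrite mulr1; exact: le_trans.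
pose L := n.+1%:R * n.+2%:R * B n.+2.
apply: (@is_derive_quadratic _ _ _ (2 * L)) => h.
have s1 := geo_sums (gc n (x + h)); have s2 := geo_sums (gc n x).
have s3 := sumsZ (t := h * n.+1%:R) (geo_sums (gc n.+1 x)).
have S := sumsB (sumsB s1 s2) s3.
rewrite mulrA -mulrA (mulrC (2 * L)); rewrite [leRHS](_ : _ = 2 * (h ^+ 2 * L)); last by ring.
rewrite mulrA; apply: sums_le S => k.
rewrite -mulrA [leRHS](_ : _ = n.+1%:R * n.+2%:R * (B n.+2 * 4^-1 ^+ k) * h ^+ 2); last by rewrite /L; ring.
apply: (quadratic_bound (tc k n)) => y z.
have dn := towerZ n.+1%:R (tc k) n.+1.
apply: (@lipschitz_bound _ (fun y => n.+1%:R * c k n.+1 y) (fun y => n.+1%:R * n.+2%:R * c k n.+2 y)) => t.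
  by eapply is_derive_eq; [exact: dn|ring].
rewrite normrM ger0_norm// ler_wpM2l//; exact: gc.
Qed.

Lemma tower_one : tower (fun n (x : R) => (n == 0%N)%:R).
Proof. by move=> n x /=; rewrite mulr0; exact: ider_cst. Qed.

Fixpoint tpow f k : nat -> R -> R :=
  if k is k'.+1 then tmul (tpow f k') f else (fun n x => (n == 0%N)%:R).

Lemma tower_pow f k : tower f -> tower (tpow f k).
Proof. by move=> tf; elim: k => [|k IH] /=; [exact: tower_one|exact: tower_mul]. Qed.

Lemma tpow0 f k x : tpow f k 0%N x = f 0%N x ^+ k.
Proof. by elim: k => [|k IH] /=; [|rewrite /tmul big_ord1 IH exprSr]. Qed.

Lemma tmul_one f n x : tmul (fun n x => (n == 0%N)%:R) f n x = f n x.
Proof.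
rewrite /tmul big_ord_recl/= mul1r subn0 big1 ?addr0// => i _.
by rewrite mul0r.
Qed.

Section ExpTower.
Variables (q : R) (f : nat -> R -> R).
Hypothesis q0 : 0 <= q.
Let K := majorant 0 q 0.

Let K0 n : 0 <= K n. Proof. exact: majorant_ge0. Qed.

Lemma tmul_le f1 f2 (a b : R) n x : 0 <= a -> 0 <= b ->
  (forall m, (m <= n)%N -> `|f1 m x| <= a * K m) -> (forall m, (m <= n)%N -> `|f2 m x| <= b * K m) ->
  `|tmul f1 f2 n x| <= 8 * a * b * K n.
Proof.
move=> a0 b0 h1 h2.
have := @conv2_le _ 0 q (lexx 0) q0 (fun=> f1^~ x) (fun=> f2^~ x) a b 0 n a0 b0.
rewrite /conv2 big_ord1; apply => -[|//] m _; [exact: h1|exact: h2].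
Qed.

Lemma tpow_le (m : R) k n x : 0 <= m -> (forall n, `|f n x| <= m * K n) ->
  `|tpow f k.+1 n x| <= 8 ^+ k * m ^+ k.+1 * K n.
Proof.
move=> m0 hf; elim: k n => [|k IH] n; first by rewrite /= tmul_one mul1r.
have -> : 8 ^+ k.+1 * m ^+ k.+2 * K n = 8 * (8 ^+ k * m ^+ k.+1) * m * K n.
  by rewrite exprS [m ^+ k.+2]exprSr; ring.
by apply: tmul_le => [|//|i _|i _]; [rewrite mulr_ge0 ?exprn_ge0|exact: IH|exact: hf].
Qed.

(** The term of degree k + 1 of e^{2f} - 1. The shift leaves a factor m in every term, so that
    [expm1] is bounded linearly in the amplitude of f. *)
Definition expc k n x : R := 2 ^+ k.+1 / k.+1`!%:R * tpow f k.+1 n x.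

Definition expm1 n x := sig (fun k => expc k n x).

Let expc_geo (m M : R) n x : 0 <= m <= M -> (forall n, `|f n x| <= m * K n) ->
  geo (2 * m * expR (64 * M) * K n) (fun k => expc k n x).
Proof.
move=> /andP[m0 mM] hf k; have M0 := le_trans m0 mM.
have F1 : 0 < k.+1`!%:R :> R by rewrite ltr0n fact_gt0.
have F0 : 0 < k`!%:R :> R by rewrite ltr0n fact_gt0.
have c0 : 0 <= 2 ^+ k.+1 / k.+1`!%:R :> R by rewrite divr_ge0 ?exprn_ge0.
rewrite normrM (ger0_norm c0).
apply: le_trans (ler_wpM2l c0 (tpow_le k n m0 hf)) _.
have E := @exp_coeff_le R (64 * M) k (mulr_ge0 (ler0n _ 64) M0).
(* The 16 is 2 from the exponent times 8 from each product of majorants; replacing it by 64 frees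
   the factor 4^-k that [geo] requires. *)
have H : (16 * m) ^+ k / k.+1`!%:R <= expR (64 * M) * 4^-1 ^+ k.
  apply: (@le_trans _ _ ((64 * M) ^+ k / k`!%:R * 4^-1 ^+ k)); last first.
    by rewrite ler_wpM2r// exprn_ge0// invr_ge0.
  rewrite mulrAC -exprMn; apply: ler_pM.
  - by rewrite exprn_ge0// mulr_ge0.
  - by rewrite invr_ge0 ltW.
  - by apply: lerXn2r; rewrite ?nnegrE ?mulr_ge0// ?invr_ge0//; lra.
  - by rewrite lef_pV2 ?posrE// ler_nat factS leq_pmull.
rewrite [leLHS](_ : _ = 2 * m * K n * ((16 * m) ^+ k / k.+1`!%:R)); last first.
  have -> : 16 * m = 2 * 8 * m by ring.
  by rewrite !exprMn !exprS; ring.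
rewrite [leRHS](_ : _ = 2 * m * K n * (expR (64 * M) * 4^-1 ^+ k)); last by ring.
by rewrite ler_wpM2l// mulr_ge0// mulr_ge0.
Qed.

Lemma expm1_le (m M : R) n x : 0 <= m <= M -> (forall n, `|f n x| <= m * K n) ->
  `|expm1 n x| <= 4 * m * expR (64 * M) * K n.
Proof.
move=> mM hf; have g := expc_geo n mM hf.
apply: le_trans (sums_le g (geo_sums g)) _.
by apply: le_of_eq; ring.
Qed.

Lemma expm10 (m : R) x : (forall n, `|f n x| <= m * K n) -> expm1 0%N x = expR (2 * f 0%N x) - 1.
Proof.
move=> hf; have m0 : 0 <= m.
  have := le_trans (normr_ge0 _) (hf 0%N).
  by rewrite /K /majorant /invsq bin0 !expr0 expr1n invr1 !mulr1.
have g := @expc_geo m m 0%N x (ltac:(by rewrite m0 lexx)) hf.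
apply: (sums_unique (geo_sums g)).
have h : \sum_(k < N.+1) (2 * f 0%N x) ^+ k / k`!%:R @[N --> \oo] --> expR (2 * f 0%N x).
  rewrite (cvg_shiftS (fun N => \sum_(k < N) (2 * f 0%N x) ^+ k / k`!%:R)).
  have := is_cvg_series_exp_coeff (2 * f 0%N x).
  by move=> h; under eq_fun do rewrite -(big_mkord xpredT (fun k => (2 * f 0%N x) ^+ k / k`!%:R)); apply: h.
have H : \sum_(k < N.+1) (2 * f 0%N x) ^+ k / k`!%:R - 1 @[N --> \oo] --> expR (2 * f 0%N x) - 1.
  by apply: cvgB => //; exact: cvg_cst.
rewrite /sums; apply: cvg_trans H; apply: near_eq_cvg; apply: nearW => N /=.
rewrite big_ord_recl/= fact0 expr0 divr1 addrAC subrr add0r; apply: eq_bigr => k _.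
by rewrite /expc tpow0 /bump/= add1n exprMn mulrAC.
Qed.

(** Taking m = M in the geometric bound makes it uniform in x, as [tower_sig] requires; the bound
    with a pointwise amplitude is [expm1_le]. *)
Lemma tower_expm1 (M : R) : tower f -> (forall n x, `|f n x| <= M * K n) -> tower expm1.
Proof.
move=> tf hf; have M0 : 0 <= M.
  have := le_trans (normr_ge0 _) (hf 0%N 0).
  by rewrite /K /majorant /invsq bin0 !expr0 expr1n invr1 !mulr1.
apply: (@tower_sig expc (fun n => 2 * M * expR (64 * M) * K n)).
  by move=> k; apply: towerZ; exact: tower_pow.
by move=> n x; apply: expc_geo; rewrite ?M0 ?lexx.
Qed.

End ExpTower.

End TowerAlgebra.

Section PowersLipschitz.
Context {R : realType}.

(** The factor T on the left replaces T^(k-1) by T^k, so that k = 0 is not a special case. *)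
Lemma pow_lipschitz (T t t' : R) k : 0 <= T -> `|t| <= T -> `|t'| <= T ->
  T * `|t ^+ k - t' ^+ k| <= `|t - t'| * (k%:R * T ^+ k).
Proof.
move=> T0 tT tT'; elim: k => [|k IH]; first by rewrite !expr0 subrr normr0 mulr0 mul0r mulr0.
have -> : t ^+ k.+1 - t' ^+ k.+1 = t * (t ^+ k - t' ^+ k) + (t - t') * t' ^+ k.
  by rewrite !exprS; ring.
apply: le_trans (ler_wpM2l T0 (ler_normD _ _)) _; rewrite mulrDr !normrM.
have E : `|t - t'| * (k.+1%:R * T ^+ k.+1) = T * (`|t - t'| * (k%:R * T ^+ k)) + T * (`|t - t'| * T ^+ k).
  by rewrite -natr1 exprS; ring.
rewrite E; apply: lerD; last first.
  by rewrite ler_wpM2l// ler_wpM2l// normrX; apply: lerXn2r; rewrite ?nnegrE.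
rewrite mulrCA; apply: ler_pM => //; exact: mulr_ge0.
Qed.

End PowersLipschitz.

(** * Power series in time *)

Section PowerSeriesSolution.
Context {R : realType}.
Local Notation field := (bool -> nat -> R -> R).

(* [fr], [fv] and [fP] stand for the r_j, the v_j and the P_j = e^{2 r_j} - 1, with
   j ranging over bool.  Treating the P_j as independent unknowns, governed by
   P_T = 2 (1 + P) r_T, makes the system quadratic. *)
Inductive unknown := fr | fv | fP.
Local Notation level := (unknown -> field).

Variables (A : bool -> bool -> R) (u0 : level).

Definition tconv (F G : nat -> nat -> R -> R) k n x : R :=
  \sum_(i < k.+1) tmul (F i) (G (k - i)%N) n x.

(** The time derivative of r_j, namely -2 v r_X - v_X. It is set apart because the equation for P_j
    contains its product with 1 + P_j. *)
Definition rate (h : nat -> level) j k n x : R :=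
  - 2 * tconv (fun i => h i fv j) (fun i => tder (h i fr j)) k n x - tder (h k fv j) n x.

Definition rhs (h : nat -> level) k (c : unknown) j n x : R :=
  match c with
  | fr => rate h j k n x
  | fP => 2 * (rate h j k n x + tconv (fun i => h i fP j) (rate h j) k n x)
  | fv => A j false * (tder (h k fr false) n x +
            tconv (fun i => h i fP false) (fun i => tder (h i fr false)) k n x) +
          A j true * (tder (h k fr true) n x +
            tconv (fun i => h i fP true) (fun i => tder (h i fr true)) k n x) -
          2 * tconv (fun i => h i fv j) (fun i => tder (h i fv j)) k n x
  end.

Definition next (h : nat -> level) k : level := fun c j n x => k.+1%:R^-1 * rhs h k c j n x.

(** Each coefficient depends on all earlier ones, so the structural recursion returns the whole
    table up to k; [coeffs] is its diagonal. *)
Fixpoint history k : nat -> level :=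
  if k is k'.+1 then fun i => if (i <= k')%N then history k' i else next (history k') k'
  else fun=> u0.

Definition coeffs k := history k k.

Lemma historyE k i : (i <= k)%N -> history k i = coeffs i.
Proof.
elim: k => [|k IH]; first by rewrite leqn0 => /eqP ->.
rewrite leq_eqVlt => /orP[/eqP -> //|]; rewrite ltnS => ik.
by rewrite /= ik IH.
Qed.

Lemma tconv_ext F G F' G' k n x : (forall i, (i <= k)%N -> F i = F' i) ->
  (forall i, (i <= k)%N -> G i = G' i) -> tconv F G k n x = tconv F' G' k n x.
Proof.
move=> hF hG; apply: eq_bigr => i _; rewrite hF ?hG ?leq_subr//.
by rewrite -ltnS.
Qed.

Lemma rate_ext h h' j k n x : (forall i, (i <= k)%N -> h i = h' i) -> rate h j k n x = rate h' j k n x.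
Proof.
move=> H; rewrite /rate (H k)//; congr (_ * _ - _).
by apply: tconv_ext => i ik; rewrite H.
Qed.

Lemma rhs_ext h h' k c j n x : (forall i, (i <= k)%N -> h i = h' i) -> rhs h k c j n x = rhs h' k c j n x.
Proof.
move=> H; case: c => /=; rewrite ?(H k)//; first exact: rate_ext.
- by congr (_ * (_ + _) + _ * (_ + _) - _ * _); apply: tconv_ext => i ik; rewrite H.
- congr (_ * (_ + _)); first exact: rate_ext.
  apply: tconv_ext => i ik; first by rewrite H.
  apply/funext => m; apply/funext => y; apply: rate_ext => l li; apply: H; exact: leq_trans ik.
Qed.

Lemma coeffsS k : coeffs k.+1 = next coeffs k.
Proof.
rewrite /coeffs /= ltnn; apply/funext => c; apply/funext => j; apply/funext => n; apply/funext => x.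
by rewrite /next; congr (_ * _); apply: rhs_ext => i ik; rewrite historyE.
Qed.

Lemma coeffsE k c j n x : k.+1%:R * coeffs k.+1 c j n x = rhs coeffs k c j n x.
Proof. by rewrite coeffsS /next mulVKf. Qed.

Lemma tower_conv F G k : (forall i, (i <= k)%N -> tower (F i)) ->
  (forall i, (i <= k)%N -> tower (G i)) -> tower (tconv F G k).
Proof.
move=> tF tG n x; rewrite /tconv.
(* Beyond k, where nothing is known of F and G, the trivial tower is substituted; these indices do
   not occur in the sum. *)
pose F' i := if (i <= k)%N then F i else fun n x => (n == 0%N)%:R.
pose G' i := if (i <= k)%N then G i else fun n x => (n == 0%N)%:R.
have tF' i : tower (F' i) by rewrite /F'; case: ifP => [/tF //|_]; exact: tower_one.
have tG' i : tower (G' i) by rewrite /G'; case: ifP => [/tG //|_]; exact: tower_one.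
have E m y : tconv F G k m y = \sum_(i < k.+1) tmul (F' i) (G' (k - i)%N) m y.
  apply: eq_bigr => i _; rewrite /F' /G' leq_subr.
  by have -> : (i <= k)%N by rewrite -ltnS.
have := tower_sum k.+1 (fun i => tower_mul (tF' i) (tG' (k - i)%N)) => /(_ n x).
by rewrite -E; under eq_fun do rewrite -E.
Qed.

Lemma tower_rate h j k : (forall i, (i <= k)%N -> forall c j, tower (h i c j)) -> tower (rate h j k).
Proof.
move=> th; apply: towerB; last by apply: tower_der; exact: th.
by apply: towerZ; apply: tower_conv => i ik; [exact: th|apply: tower_der; exact: th].
Qed.

Lemma tower_coeffs : (forall c j, tower (u0 c j)) -> forall k c j, tower (coeffs k c j).
Proof.
move=> t0; elim/ltn_ind => -[|k] IH c j; first exact: t0.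
have IH' i : (i <= k)%N -> forall c j, tower (coeffs i c j) by move=> ik; apply: IH; rewrite ltnS.
rewrite coeffsS; apply: towerZ; case: c => /=.
- exact: tower_rate.
- have tc l : tower (fun n x => A j l * (tder (coeffs k fr l) n x +
      tconv (fun i => coeffs i fP l) (fun i => tder (coeffs i fr l)) k n x)).
    apply: towerZ; apply: towerD; first by apply: tower_der; exact: IH'.
    by apply: tower_conv => i ik; [exact: IH'|apply: tower_der; exact: IH'].
  apply: towerB; first exact: towerD.
  by apply: towerZ; apply: tower_conv => i ik; [exact: IH'|apply: tower_der; exact: IH'].
- apply: towerZ; apply: towerD; first exact: tower_rate.
  apply: tower_conv => i ik; first exact: IH'.
  by apply: tower_rate => l li; apply: IH'; exact: leq_trans ik.
Qed.

(** * Domination of the coefficients by the majorant *)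

Section Bounds.
Variables (lam q a mu : R) (x : R).
Hypotheses (q0 : 0 < q) (lamq : (4 * a + 8) * q <= lam) (a0 : 0 <= a) (hA : forall j l, `|A j l| <= a).
Hypotheses (mu0 : 0 <= mu) (mu16 : mu <= 16^-1).
Hypothesis hu0 : forall c j n, `|u0 c j n x| <= mu * majorant lam q 0 n.

Let K := majorant lam q.
Let lam0 : 0 < lam.
Proof. by apply: lt_le_trans lamq; rewrite mulr_gt0// ltr_wpDl// mulr_ge0. Qed.

Let K0 k n : 0 <= K k n. Proof. by apply: majorant_ge0; exact: ltW. Qed.

Let shift k n : n.+1%:R * K k n.+1 = q / lam * (k.+1%:R * K k.+1 n).
Proof.
apply: (mulfI (lt0r_neq0 lam0)); rewrite /K -majorant_shift.
by field; rewrite gt_eqF.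
Qed.

(** With 8 mu <= 1/2, a product with one X-derivative is at most half as large as a linear term, and
    each X-derivative yields e = q / lam by [majorant_shift]. The totals are 2 e for r, 6 e for P
    and (3 a + 1) e for v, all at most (4 a + 8) e <= 1. The product P r_T is estimated by
    [conv2_time_le], as its second factor is already a time derivative. *)
Lemma coeffs_le k c j n : `|coeffs k c j n x| <= mu * K k n.
Proof.
elim/ltn_ind: k c j n => -[|k] IH c j n; first exact: hu0.
have IH' i c' j' m : (i <= k)%N -> `|coeffs i c' j' m x| <= mu * K i m.
  by move=> ik; apply: IH; rewrite ltnS.
have lamge : (4 * a + 8) * q <= lam by exact: lamq.
have qn : 0 <= q by exact: ltW.
have ln : 0 <= lam by exact: ltW.
have conv_le c1 j1 c2 j2 i m : (i <= k)%N ->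
    `|tconv (fun i => coeffs i c1 j1) (fun i => tder (coeffs i c2 j2)) i m x| <=
    8 * mu * mu * (m.+1%:R * K i m.+1).
  move=> ik; apply: (@conv2_space_le _ _ _ ln qn (fun i n => coeffs i c1 j1 n x)
    (fun i n => coeffs i c2 j2 n x)) => // l m' li; apply: IH'; exact: leq_trans ik.
have der_le i c' j' m : (i <= k)%N -> `|tder (coeffs i c' j') m x| <= mu * (m.+1%:R * K i m.+1).
  by move=> ik; rewrite normrM ger0_norm// mulrCA ler_wpM2l//; exact: IH'.
pose e := q / lam.
have e0 : 0 <= e by rewrite divr_ge0.
have e1 : (4 * a + 8) * e <= 1 by rewrite mulrA ler_pdivrMr// mul1r.
have ae : 0 <= a * e by rewrite mulr_ge0.
have rate_le i j' m : (i <= k)%N -> `|rate coeffs j' i m x| <= 2 * mu * e * (i.+1%:R * K i.+1 m).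
  move=> ik; rewrite -(mulrA _ e) /e -shift.
  apply: le_trans (ler_normB _ _) _; apply: le_trans (lerD (lexx _) (der_le _ _ _ _ ik)) _.
  rewrite normrM normrN (ger0_norm (ler0n _ 2)).
  apply: le_trans (lerD (ler_wpM2l _ (conv_le _ _ _ _ _ _ ik)) (lexx _)) _ => //.
  have : 0 <= mu * (m.+1%:R * K i m.+1) by rewrite mulr_ge0// mulr_ge0.
  have -> : 8 * mu * mu * (m.+1%:R * K i m.+1) = 8 * mu * (mu * (m.+1%:R * K i m.+1)) by rewrite !mulrA.
  have -> : 2 * mu * (m.+1%:R * K i m.+1) = 2 * (mu * (m.+1%:R * K i m.+1)) by ring.
  move: (mu * (_ * _)) => z z0; have := ler_wpM2r z0 mu16; lra.
rewrite coeffsS /next normrM ger0_norm ?invr_ge0// ler_pdivrMl// mulrCA.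
have Z0 : 0 <= mu * (k.+1%:R * K k.+1 n) by rewrite mulr_ge0// mulr_ge0.
have DE : mu * (n.+1%:R * K k n.+1) = e * (mu * (k.+1%:R * K k.+1 n)) by rewrite shift -/e mulrCA.
have R1 := rate_le k j n (leqnn k).
have eZ : 0 <= e * (mu * (k.+1%:R * K k.+1 n)) by rewrite mulr_ge0.
have eZ1 : (4 * a + 8) * (e * (mu * (k.+1%:R * K k.+1 n))) <= mu * (k.+1%:R * K k.+1 n).
  by rewrite mulrA ler_piMl.
have aeZ : 0 <= a * (e * (mu * (k.+1%:R * K k.+1 n))) by rewrite mulr_ge0.
have REw : 2 * mu * e * (k.+1%:R * K k.+1 n) = 2 * (e * (mu * (k.+1%:R * K k.+1 n))) by ring.
case: c => /=.
- apply: le_trans R1 _; rewrite REw.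
  move: (e * (mu * _)) eZ eZ1 aeZ => z z0; move: (mu * _) => w; nra.
- have C1 l : `|A j l * (tder (coeffs k fr l) n x +
      tconv (fun i => coeffs i fP l) (fun i => tder (coeffs i fr l)) k n x)| <=
      a * (3 / 2 * (e * (mu * (k.+1%:R * K k.+1 n)))).
    rewrite normrM; apply: ler_pM => //.
    apply: le_trans (ler_normD _ _) _.
    apply: le_trans (lerD (der_le _ _ _ _ (leqnn k)) (conv_le _ _ _ _ _ _ (leqnn k))) _.
    have -> : 8 * mu * mu * (n.+1%:R * K k n.+1) = 8 * mu * (mu * (n.+1%:R * K k n.+1)) by rewrite !mulrA.
    rewrite DE; move: (e * _) eZ => z z0; have := ler_wpM2r z0 mu16; lra.
  have C2 := conv_le fv j fv j k n (leqnn k).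
  have C3 : 8 * mu * mu * (n.+1%:R * K k n.+1) <= 1 / 2 * (e * (mu * (k.+1%:R * K k.+1 n))).
    have -> : 8 * mu * mu * (n.+1%:R * K k n.+1) = 8 * mu * (mu * (n.+1%:R * K k n.+1)) by rewrite !mulrA.
    rewrite DE; move: (e * _) eZ => z z0; have := ler_wpM2r z0 mu16; lra.
  apply: le_trans (ler_normB _ _) _; apply: le_trans (lerD (ler_normD _ _) (lexx _)) _.
  rewrite [X in _ + X]normrM (ger0_norm (ler0n _ 2)).
  apply: le_trans (lerD (lerD (C1 _) (C1 _)) (ler_wpM2l (ler0n _ 2) (le_trans C2 C3))) _.
  move: (e * (mu * _)) eZ eZ1 aeZ => z z0; move: (mu * _) => w; nra.
- have C4 : `|tconv (fun i => coeffs i fP j) (rate coeffs j) k n x| <=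
      8 * mu * (2 * mu * e) * (k.+1%:R * K k.+1 n).
    apply: (@conv2_time_le _ _ _ ln qn (fun i n => coeffs i fP j n x) (fun i n => rate coeffs j i n x)) => //.
    - by rewrite mulr_ge0// mulr_ge0.
    - by move=> i m; exact: IH'.
    - by move=> i m; exact: rate_le.
  have C5 : 8 * mu * (2 * mu * e) * (k.+1%:R * K k.+1 n) <= e * (mu * (k.+1%:R * K k.+1 n)).
    have -> : 8 * mu * (2 * mu * e) * (k.+1%:R * K k.+1 n) = 16 * mu * (e * (mu * (k.+1%:R * K k.+1 n))) by ring.
    move: (e * _) eZ => z z0; have := ler_wpM2r z0 mu16; lra.
  rewrite normrM (ger0_norm (ler0n _ 2)).
  apply: le_trans (ler_wpM2l (ler0n _ 2) (le_trans (ler_normD _ _) (lerD R1 (le_trans C4 C5)))) _.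
  rewrite REw; move: (e * (mu * _)) eZ eZ1 aeZ => z z0; move: (mu * _) => w; nra.
Qed.

End Bounds.

(** The ratio 1/16 in time, rather than 1/4, leaves room for the factor k + 1 produced by time
    derivatives and by Lipschitz bounds. *)
Lemma coeffs_time_le (lam q a mu T y : R) (x t : R) c j k n : 0 < q -> (4 * a + 8) * q <= lam ->
  0 <= a -> (forall j l, `|A j l| <= a) -> 0 <= mu -> mu <= 16^-1 ->
  (forall c j n, `|u0 c j n x| <= mu * majorant lam q 0 n) ->
  0 < y < 1 -> 0 <= T -> lam / y * T <= 16^-1 -> `|t| <= T ->
  `|coeffs k c j n x| * T ^+ k <= mu * (q / (1 - y)) ^+ n * 16^-1 ^+ k.
Proof.
move=> q0 lamq a0 hA mu0 mu16 hu y01 T0 lT tT.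
have lam0 : 0 < lam by apply: lt_le_trans lamq; rewrite mulr_gt0// ltr_wpDl// mulr_ge0.
have /andP[y0 y1] := y01.
have B := le_trans (coeffs_le q0 lamq a0 hA mu0 mu16 hu k c j n)
  (ler_wpM2l mu0 (majorant_le (ltW lam0) (ltW q0) k n y01)).
apply: le_trans (ler_wpM2r (exprn_ge0 _ T0) B) _.
have -> : mu * ((lam / y) ^+ k * (q / (1 - y)) ^+ n) * T ^+ k =
  mu * (q / (1 - y)) ^+ n * (lam / y * T) ^+ k by rewrite [(lam / y * T) ^+ k]exprMn; ring.
rewrite ler_wpM2l ?mulr_ge0 ?exprn_ge0 ?divr_ge0 ?subr_ge0 ?(ltW q0) ?(ltW y1)//.
by apply: lerXn2r; rewrite ?nnegrE ?mulr_ge0 ?invr_ge0 ?(ltW lam0) ?(ltW y0).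
Qed.

(** * Summation of the power series in time *)

Section TimeSum.
Implicit Types (c : unknown) (j : bool) (k n : nat) (x t : R).
Variables (lam q a T y : R) (mu : R -> R).
Hypotheses (q0 : 0 < q) (lamq : (4 * a + 8) * q <= lam) (a0 : 0 <= a) (hA : forall j l, `|A j l| <= a).
Hypotheses (mu0 : forall x, 0 <= mu x) (mu16 : forall x, mu x <= 16^-1).
Hypothesis hu0 : forall c j n x, `|u0 c j n x| <= mu x * majorant lam q 0 n.
Hypothesis tu0 : forall c j, tower (u0 c j).
Hypotheses (y01 : 0 < y < 1) (T0 : 0 < T) (lT : lam / y * T <= 16^-1).

Definition solution c j t n x := sig (fun k => coeffs k c j n x * t ^+ k).

Let r := q / (1 - y).
Let r0 n : 0 <= r ^+ n.
Proof. by have /andP[_ y1] := y01; rewrite exprn_ge0// divr_ge0 ?subr_ge0 ?(ltW q0) ?(ltW y1). Qed.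

Let bound k c j n x t : `|t| <= T -> `|coeffs k c j n x| * T ^+ k <= mu x * r ^+ n * 16^-1 ^+ k.
Proof.
move=> tT; exact: (coeffs_time_le c j k n q0 lamq a0 hA (mu0 x) (mu16 x) (fun c j n => hu0 c j n x) y01 (ltW T0) lT tT).
Qed.

Let bound' k c j n x t : `|t| <= T -> `|coeffs k c j n x * t ^+ k| <= mu x * r ^+ n * 16^-1 ^+ k.
Proof.
move=> tT; apply: le_trans (@bound k c j n x _ tT); rewrite normrM normrX ler_wpM2l//.
by apply: lerXn2r; rewrite ?nnegrE// ltW.
Qed.

Let le164 k : 16^-1 ^+ k <= 4^-1 ^+ k :> R.
Proof. by apply: lerXn2r; rewrite ?nnegrE ?invr_ge0// lef_pV2 ?posrE// ler_nat. Qed.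

Let le164n k : k.+1%:R * 16^-1 ^+ k <= 4^-1 ^+ k :> R.
Proof.
have -> : 16^-1 = 4^-1 * 4^-1 :> R by field.
rewrite exprMn mulrA ler_piMl ?exprn_ge0 ?invr_ge0// exprVn ler_pdivrMr ?exprn_gt0// mul1r.
by rewrite -natrX ler_nat ltn_expl.
Qed.

Lemma solution_geo c j n x t : `|t| <= T -> geo (mu x * r ^+ n) (fun k => coeffs k c j n x * t ^+ k).
Proof.
by move=> tT k; apply: le_trans (@bound' k c j n x _ tT) _; rewrite ler_wpM2l ?mulr_ge0.
Qed.

Lemma solution_sums c j n x t : `|t| <= T ->
  sums (fun k => coeffs k c j n x * t ^+ k) (solution c j t n x).
Proof. by move=> tT; exact: geo_sums (@solution_geo c j n x _ tT). Qed.

Lemma solution_le c j n x t : `|t| <= T -> `|solution c j t n x| <= 2 * mu x * r ^+ n.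
Proof.
by move=> tT; rewrite -mulrA; exact: sums_le (@solution_geo c j n x _ tT) (@solution_sums c j n x _ tT).
Qed.

Lemma solution_tower c j t : `|t| <= T -> tower (solution c j t).
Proof.
move=> tT; apply: (@tower_sig R (fun k n x => coeffs k c j n x * t ^+ k) (fun n => 16^-1 * r ^+ n)).
  move=> k n x; have := towerZ (t ^+ k) (tower_coeffs tu0 k c j) n x.
  by rewrite mulrCA mulrC -mulrA; under eq_fun do rewrite mulrC.
move=> n x k; apply: le_trans (@solution_geo c j n x _ tT k) _.
by rewrite ler_wpM2r ?exprn_ge0 ?invr_ge0// ler_wpM2r.
Qed.

(** The factor k from the difference of powers is absorbed by the spare 4^-k. As the bound is linear
    in mu x, it becomes a Lipschitz bound in the Gevrey norm after integration in x. *)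
Lemma solution_lipschitz c j n x t t' : `|t| <= T -> `|t'| <= T ->
  `|solution c j t n x - solution c j t' n x| <= 2 / T * mu x * r ^+ n * `|t - t'|.
Proof.
move=> tT tT'; have S := sumsB (@solution_sums c j n x _ tT) (@solution_sums c j n x _ tT').
have -> : 2 / T * mu x * r ^+ n * `|t - t'| = 2 * (mu x * r ^+ n * (T^-1 * `|t - t'|)).
  by rewrite !mulrA; ring.
apply: sums_le S => k; rewrite -mulrBr normrM.
have H := pow_lipschitz k (ltW T0) tT tT'.
rewrite -ler_pdivlMl// in H.
apply: le_trans (ler_wpM2l (normr_ge0 _) H) _.
rewrite [leLHS](_ : _ = T^-1 * `|t - t'| * (k%:R * (`|coeffs k c j n x| * T ^+ k))); last by ring.
rewrite [leRHS](_ : _ = T^-1 * `|t - t'| * (mu x * r ^+ n * 4^-1 ^+ k)); last by ring.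
rewrite ler_wpM2l ?mulr_ge0 ?invr_ge0 ?(ltW T0)//.
apply: le_trans (ler_wpM2l (ler0n _ k) (@bound k c j n x _ tT)) _.
rewrite mulrCA ler_wpM2l ?mulr_ge0//; apply: le_trans (le164n k).
by rewrite ler_wpM2r ?exprn_ge0 ?invr_ge0// ler_nat.
Qed.

Lemma solution0 c j n x : solution c j 0 n x = u0 c j n x.
Proof.
have T00 : `|0 : R| <= T by rewrite normr0 ltW.
apply: (sums_unique (@solution_sums c j n x 0 T00)).
apply: cvg_near_cst; exists 1%N => // N /= N1.
case: N N1 => // N _; rewrite big_ord_recl/= expr0 mulr1 big1 ?addr0// => i _.
by rewrite expr0n/= mulr0.
Qed.

(** The power series converges beyond T: T is at most y / (16 lam), below the y / (8 lam) that
    [power_series_derive] allows. The derivative is therefore two-sided, even at the ends of the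
    time interval. *)
Lemma solution_derive c j x t : `|t| <= T ->
  is_derive t 1 (fun t => solution c j t 0%N x) (sig (fun k => rhs coeffs k c j 0%N x * t ^+ k)).
Proof.
move=> tT; have /andP[y0 y1] := y01.
have lam0 : 0 < lam by apply: lt_le_trans lamq; rewrite mulr_gt0// ltr_wpDl// mulr_ge0.
have ly0 : 0 < lam / y by rewrite divr_gt0.
have := @power_series_derive R (fun k => coeffs k c j 0%N x) (mu x) (lam / y) t ly0.
have -> : (fun k => rhs coeffs k c j 0%N x * t ^+ k) = (fun k => k.+1%:R * coeffs k.+1 c j 0%N x * t ^+ k).
  by apply/funext => k; rewrite coeffsE.
apply.
- move=> k; have h0 : 0 <= mu x by [].
  have B := coeffs_le q0 lamq a0 hA h0 (mu16 x) (fun c j n => hu0 c j n x) k c j 0%N.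
  apply: le_trans B _; rewrite ler_wpM2l//.
  by have := majorant_le (ltW lam0) (ltW q0) k 0 y01; rewrite expr0 mulr1.
- apply: le_lt_trans tT _; rewrite -[ltRHS]div1r ltr_pdivlMr ?mulr_gt0 ?invr_gt0//.
  move: lT; move: (lam / y) ly0 => l l0; lra.
Qed.

Section Equations.
Variables (x t : R).
Hypothesis tT : `|t| <= T.
Let S c j := solution c j t 0%N x.
Let S1 c j := solution c j t 1%N x.

Lemma sums_tder c j : sums (fun k => tder (coeffs k c j) 0%N x * t ^+ k) (S1 c j).
Proof.
have -> : (fun k => tder (coeffs k c j) 0%N x * t ^+ k) = (fun k => coeffs k c j 1%N x * t ^+ k).
  by apply/funext => k; rewrite /tder mul1r.
exact: solution_sums.
Qed.

Lemma sums_tconv (F G : nat -> nat -> R -> R) (B C s u : R) :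
  geo B (fun k => F k 0%N x * t ^+ k) -> geo C (fun k => G k 0%N x * t ^+ k) ->
  sums (fun k => F k 0%N x * t ^+ k) s -> sums (fun k => G k 0%N x * t ^+ k) u ->
  sums (fun k => tconv F G k 0%N x * t ^+ k) (s * u).
Proof.
move=> gF gG sF sG.
rewrite (sums_unique sF (geo_sums gF)) (sums_unique sG (geo_sums gG)).
have -> : (fun k => tconv F G k 0%N x * t ^+ k) =
    (fun k => \sum_(i < k.+1) (F i 0%N x * t ^+ i) * (G (k - i)%N 0%N x * t ^+ (k - i))).
  apply/funext => k; rewrite /tconv mulr_suml; apply: eq_bigr => i _.
  have -> : t ^+ k = t ^+ i * t ^+ (k - i) by rewrite -exprD subnKC// -ltnS.
  by rewrite /tmul big_ord1 subnn mulrACA.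
exact: sums_conv gF gG.
Qed.

Lemma sums_tconv_der c1 j1 c2 j2 :
  sums (fun k => tconv (fun i => coeffs i c1 j1) (fun i => tder (coeffs i c2 j2)) k 0%N x * t ^+ k)
    (S c1 j1 * S1 c2 j2).
Proof.
apply: (sums_tconv (@solution_geo c1 j1 0%N x _ tT) _ (@solution_sums c1 j1 0%N x _ tT) (@sums_tder c2 j2)).
by move=> k; have := @solution_geo c2 j2 1%N x _ tT k; rewrite /tder mul1r; exact.
Qed.

Definition rate_sum j := - 2 * (S fv j * S1 fr j) - S1 fv j.

Lemma sums_rate j : sums (fun k => rate coeffs j k 0%N x * t ^+ k) (rate_sum j).
Proof.
have := sumsB (sumsZ (t := - 2) (@sums_tconv_der fv j fr j)) (@sums_tder fv j).
by under eq_fun do rewrite mulrA -mulrBl.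
Qed.

(** By the recursion this coefficient is k + 1 times the next coefficient of r_j, so that the bound
    already proved for r_j applies and products need not be estimated again. *)
Lemma geo_rate j : geo (mu x / T) (fun k => rate coeffs j k 0%N x * t ^+ k).
Proof.
move=> k; have -> : rate coeffs j k 0%N x = k.+1%:R * coeffs k.+1 fr j 0%N x by rewrite coeffsE.
have := @bound k.+1 fr j 0%N x _ tT; rewrite expr0 mulr1 exprS (mulrC T) mulrA -ler_pdivlMr// => B.
apply: (@le_trans _ _ (k.+1%:R * (`|coeffs k.+1 fr j 0%N x| * T ^+ k))).
  rewrite normrM normrM (ger0_norm (ler0n _ _)) -mulrA ler_wpM2l// ler_wpM2l// normrX.
  by apply: lerXn2r; rewrite ?nnegrE// ltW.
apply: le_trans (ler_wpM2l (ler0n _ _) B) _.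
rewrite [leLHS](_ : _ = mu x / T * (16^-1 * (k.+1%:R * 16^-1 ^+ k))); last by rewrite exprS; ring.
rewrite ler_wpM2l ?divr_ge0 ?(ltW T0)//; apply: le_trans (le164n k).
by rewrite ler_piMl ?mulr_ge0 ?exprn_ge0 ?invr_ge0// invf_le1// ler1n.
Qed.

Lemma solution_derive_fr j : is_derive t 1 (fun t => solution fr j t 0%N x) (rate_sum j).
Proof.
rewrite (sums_unique (@sums_rate j) (geo_sums (@geo_rate j))).
exact: (@solution_derive fr j x t tT).
Qed.

Lemma solution_derive_fP j :
  is_derive t 1 (fun t => solution fP j t 0%N x) (2 * ((1 + S fP j) * rate_sum j)).
Proof.
have d := @solution_derive fP j x t tT.
have C := @sums_tconv (fun k => coeffs k fP j) (rate coeffs j) _ _ _ _ (@solution_geo fP j 0%N x _ tT) (@geo_rate j) (@solution_sums fP j 0%N x _ tT) (@sums_rate j).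
have := sumsZ (t := 2) (sumsD (@sums_rate j) C).
under eq_fun do rewrite -mulrDl mulrA.
move=> H; have E : sig (fun k => rhs coeffs k fP j 0%N x * t ^+ k) = 2 * (rate_sum j + S fP j * rate_sum j).
  exact: cvg_lim H.
by eapply is_derive_eq; [exact: d|rewrite E; ring].
Qed.

Lemma solution_derive_fv j : is_derive t 1 (fun t => solution fv j t 0%N x)
  (A j false * ((1 + S fP false) * S1 fr false) + A j true * ((1 + S fP true) * S1 fr true) -
   2 * (S fv j * S1 fv j)).
Proof.
have d := @solution_derive fv j x t tT.
have C l := sumsZ (t := A j l) (sumsD (@sums_tder fr l) (@sums_tconv_der fP l fr l)).
have := sumsB (sumsD (C false) (C true)) (sumsZ (t := 2) (@sums_tconv_der fv j fv j)).
move=> H; have E : sig (fun k => rhs coeffs k fv j 0%N x * t ^+ k) =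
    A j false * (S1 fr false + S fP false * S1 fr false) +
    A j true * (S1 fr true + S fP true * S1 fr true) - 2 * (S fv j * S1 fv j).
  apply: cvg_lim => //; move: H; rewrite /sums; apply: cvg_trans; apply: near_eq_cvg; apply: nearW => N /=.
  by apply: eq_bigr => k _ /=; ring.
by eapply is_derive_eq; [exact: d|rewrite E; ring].
Qed.

End Equations.

(* [(1 + P) e^{- 2 r}] does not depend on time. *)
Lemma solution_exp j x t : 0 <= t <= T -> u0 fP j 0%N x = expR (2 * u0 fr j 0%N x) - 1 ->
  1 + solution fP j t 0%N x = expR (2 * solution fr j t 0%N x).
Proof.
move=> /andP[t0 tT] H0.
pose W t := (1 + solution fP j t 0%N x) * expR (- (2 * solution fr j t 0%N x)).
have dW (s : R) : `|s| <= T -> is_derive s 1 W 0.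
  move=> sT; have d1 := iderD (ider_cst 1 s) (@solution_derive_fP x s sT j).
  have d2 := ider_expR (iderN (iderM (ider_cst 2 s) (@solution_derive_fr x s sT j))).
  have d := iderM d1 d2.
  by eapply is_derive_eq; [exact: d|rewrite /=; ring].
have inT s : 0 <= s <= t -> `|s| <= T.
  by move=> /andP[s0 st]; rewrite ger0_norm// (le_trans st).
have E : W t = W 0.
  have [] := @MVT_segment R W (fun=> 0) 0 t t0.
  - move=> s; rewrite in_itv/= => /andP[s0 st]; apply: dW; apply: inT.
    by rewrite (ltW s0) (ltW st).
  - apply: derivable_within_continuous => s; rewrite in_itv/= => st.
    by apply: ider_derivable (dW s _); exact: inT.
  - by move=> s _; rewrite mul0r => /eqP; rewrite subr_eq0 => /eqP.
move: E; rewrite /W !solution0 H0 [X in _ = X * _]addrCA subrr addr0 -expRD subrr expR0 => E.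
have e0 : 0 < expR (2 * solution fr j t 0%N x) by exact: expR_gt0.
by move/(congr1 (fun z => z * expR (2 * solution fr j t 0%N x))): E; rewrite expRN mul1r mulfVK// gt_eqF.
Qed.

End TimeSum.
End PowerSeriesSolution.

(** * Uniqueness *)

Section Uniqueness.
Context {R : realType}.
Implicit Types (f : nat -> R -> R) (y z : R -> R) (h x X T t : R).

(** The mean value theorem for iterated differences: one application for each difference, on the
    derived tower. *)
Lemma incr_mvt f h n m x : 0 < h -> tower f ->
  exists2 xi, x <= xi <= x + n%:R * h &
    incr h n (f m) x = h ^+ n * ((m + n)`!%:R / m`!%:R) * f (m + n)%N xi.
Proof.
move=> h0 tf; elim: n m x => [|n IH] m x.
  exists x; first by rewrite mul0r addr0 lexx.
  by rewrite addn0 divff ?pnatr_eq0 -?lt0n ?fact_gt0// !mul1r.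
have xh : x <= x + h by rewrite lerDl ltW.
have dg := incr_derive h n (tf m).
have [] := @MVT_segment R (incr h n (f m)) _ x (x + h) xh (fun t _ => dg t).
  by apply: continuous_subspaceT; apply: incr_continuous; exact: tower_continuous.
move=> c; rewrite in_itv/= => /andP[xc cx] E.
have [xi /andP[cxi xix] E'] := IH m.+1 c.
exists xi.
  rewrite (le_trans xc cxi)/= (le_trans xix)// -natr1 mulrDl mul1r addrCA addrC lerD2r//.
rewrite /= E incrZ E' addSnnS (_ : x + h - x = h); last by ring.
rewrite exprS factS natrM.
have hA : m.+1%:R != 0 :> R by rewrite pnatr_eq0.
have hB : m`!%:R != 0 :> R by rewrite pnatr_eq0 -lt0n fact_gt0.
move: hA hB; move: (m.+1%:R : R) (m`!%:R : R) ((m + n.+1)`!%:R : R) (h ^+ n) (f _ xi) => A B C D F hA hB.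
by field; rewrite hA hB.
Qed.

Lemma ider_expB t0 k t : is_derive t 1 (fun s => (s - t0) ^+ k.+1) (k.+1%:R * (t - t0) ^+ k).
Proof.
have dt : is_derive t 1 (fun s : R => s - t0) 1.
  by eapply is_derive_eq; [by ider|rewrite subr0].
elim: k => [|k IH]; first by under eq_fun do rewrite expr1; rewrite expr0 mulr1.
have -> : (fun s => (s - t0) ^+ k.+2) = (fun s => (s - t0) * (s - t0) ^+ k.+1).
  by apply/funext => s; rewrite exprS.
eapply is_derive_eq; [exact: iderM dt IH|].
by rewrite -[k.+2%:R]natr1 exprS; ring.
Qed.

(** y' = z inside ]0, T0[, with y continuous up to the ends. The notion is closed under subtraction,
    hence passes to [incr] in the space variable. *)
Definition dsol T0 y z :=
  (forall T, 0 < T < T0 -> is_derive T 1 y (z T)) /\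
  (forall T, 0 <= T <= T0 -> y T' @[T' --> within `[0, T0] (nbhs T)] --> y T).

Lemma dsolB T0 y z y' z' : dsol T0 y z -> dsol T0 y' z' ->
  dsol T0 (fun T => y T - y' T) (fun T => z T - z' T).
Proof.
move=> [d c] [d' c']; split => T hT; first by apply: iderB; [exact: d|exact: d'].
by apply: cvgB; [exact: c|exact: c'].
Qed.

Lemma dsol_ext T0 y z y' z' : (forall T, 0 <= T <= T0 -> y T = y' T) ->
  (forall T, 0 < T < T0 -> z T = z' T) -> dsol T0 y z -> dsol T0 y' z'.
Proof.
move=> yy zz [d c]; split => T HT.
  rewrite -zz//; apply: near_eq_is_derive (d T HT); near=> s; apply: yy.
  have : s \in `]0, T0[ by near: s; apply: near_in_itvoo; rewrite in_itv.
  by rewrite in_itv/= => /andP[/ltW -> /ltW ->].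
rewrite -yy//; apply: cvg_trans (c T HT); apply: near_eq_cvg.
by rewrite near_withinE; apply: nearW => s; rewrite /= in_itv/= => /yy.
Unshelve. all: by end_near. Qed.

Lemma dsol_incr T0 (F G : R -> R -> R) h n : (forall X, dsol T0 (F^~ X) (G^~ X)) ->
  forall X, dsol T0 (fun T => incr h n (F T) X) (fun T => incr h n (G T) X).
Proof. by move=> H; elim: n => [|n IH] X //=; apply: dsolB. Qed.

(** The mean value inequality with a comparison function g; no integral of z is needed, and z may be
    irregular in time. *)
Lemma dsol_le T0 y z (g g' : R -> R) t0 t1 : 0 <= t0 -> t0 <= t1 -> t1 <= T0 -> dsol T0 y z ->
  (forall T : R, is_derive T 1 g (g' T)) -> (forall T, t0 < T < t1 -> `|z T| <= g' T) ->
  `|y t1 - y t0| <= g t1 - g t0.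
Proof.
move=> t00; rewrite le_eqVlt => /orP[/eqP <-|t01 t1T [dy cy] dg zg].
  by rewrite !subrr normr0.
(* The function g - s y is nondecreasing for both signs s; the mean value theorem requires its
   derivative in the interior only. *)
have key (s : R) : `|s| = 1 -> s * (y t1 - y t0) <= g t1 - g t0.
  move=> s1; pose F T := g T - s * y T.
  have dF T : t0 < T < t1 -> is_derive T 1 F (g' T - s * z T).
    move=> /andP[tT Tt]; apply: iderB => //.
    have d := iderM (ider_cst s T) (dy T (ltac:(by rewrite (le_lt_trans t00 tT) (lt_le_trans Tt t1T)))).
    by eapply is_derive_eq; [exact: d|rewrite mul0r add0r].
  have [|c /andP[c0 c1] E] := @MVT R F (fun T => g' T - s * z T) t0 t1 t01.
  - apply/subspace_continuousP => T; rewrite /= in_itv/= => /andP[tT Tt].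
    apply: cvgB.
      apply: cvg_within_filter; exact: (ider_continuous (dg T)).
    apply: cvgM; first exact: cvg_cst.
    have := cy T (ltac:(by rewrite (le_trans t00 tT) (le_trans Tt t1T))).
    move=> c; apply: (cvg_trans _ c); apply: cvg_app; apply: within_subset => u /=.
    by rewrite !in_itv/= => /andP[u0 u1]; rewrite (le_trans t00 u0) (le_trans u1 t1T).
  - have : 0 <= F t1 - F t0.
      rewrite E mulr_ge0 ?subr_ge0 ?(ltW t01)//.
      apply: le_trans (zg c _); last by move: c0 c1; rewrite !bnd_simp => -> ->.
      by apply: le_trans (ler_norm _) _; rewrite normrM s1 mul1r.
    by rewrite /F; move: (g t1) (g t0) (y t1) (y t0) => a b c' d H; lra.
have k1 := key 1 (normr1 _); have k2 := key (-1) (normrN1 _).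
by rewrite ler_norml; apply/andP; split; lra.
Qed.

(** * Vanishing of solutions of a first-order differential inequality *)

Section Abstract.
Variables (I : finType) (d Phi : I -> R -> nat -> R -> R) (T0 b M r0 : R).
Hypotheses (b0 : 0 <= b) (M0 : 0 < M) (r00 : 0 < r0).
Local Notation inT T := (0 <= T <= T0).
Hypothesis td : forall i T, inT T -> tower (d i T).
Hypothesis tPhi : forall i T, inT T -> tower (Phi i T).
Hypothesis dd : forall i X, dsol T0 (fun T => d i T 0%N X) (fun T => Phi i T 0%N X).
Hypothesis d_le : forall i T n X, inT T -> `|d i T n X| <= b * r0 ^+ n.
Hypothesis Phi_le : forall i T n X, inT T -> `|Phi i T n X| <=
  n.+1%:R * \sum_(l : I) \sum_(j < n.+2) M * r0 ^+ j * `|d l T (n.+1 - j)%N X|.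

(* Spatial differences of order [n] of [d i T 0] stand in for [d i T n], whose time
   derivative is not known to exist. *)
Lemma increment_le i n t0 t1 (C : R) (g g' : R -> R) : inT t0 -> inT t1 -> t0 <= t1 -> 0 <= C ->
  (forall X, d i t0 0%N X = 0) -> (forall T : R, is_derive T 1 g (g' T)) ->
  (forall T X, t0 < T < t1 -> `|Phi i T n X| <= C * g' T) ->
  forall X, `|d i t1 n X| <= C * (g t1 - g t0).
Proof.
move=> /andP[t00 t0T] Ht1 t01 C0 d0 dg H X; have /andP[t10 t1T] := Ht1.
have nf : 0 < n`!%:R :> R by rewrite ltr0n fact_gt0.
apply/ler_addgt0Pr => e e0.
(* The mean value theorem reaches the Taylor coefficient only at a point within n h of X. [Lip]
   times h bounds the resulting error, and h makes it at most e. *)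
pose Lip := n.+1%:R * (b * r0 ^+ n.+1) * n%:R.
have Lip0 : 0 <= Lip by rewrite !mulr_ge0// exprn_ge0// ltW.
pose h := e / (Lip + 1).
have h0 : 0 < h by rewrite divr_gt0// ltr_wpDl.
have hn : 0 < h ^+ n by rewrite exprn_gt0.
have [xi /andP[Xxi xiX] E] := incr_mvt n 0 X h0 (td i Ht1).
rewrite add0n fact0 divr1 in E.
have B : `|incr h n (d i t1 0%N) X| <= h ^+ n * n`!%:R * (C * (g t1 - g t0)).
  have z0 : incr h n (d i t0 0%N) X = 0.
    have -> : d i t0 0%N = fun x => 0 * d i t0 0%N x by apply/funext => x; rewrite d0 mulr0.
    by rewrite incrZ mul0r.
  have := @dsol_le T0 _ _ (fun T => h ^+ n * n`!%:R * C * g T) (fun T => h ^+ n * n`!%:R * C * g' T)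
    t0 t1 t00 t01 t1T (dsol_incr h n (dd i) X).
  rewrite z0 subr0 -mulrBr -!mulrA; apply.
  move=> T /andP[tT Tt].
  have Ti : inT T by rewrite (le_trans t00 (ltW tT)) (le_trans (ltW Tt) t1T).
  have [zeta _ ->] := incr_mvt n 0 X h0 (tPhi i Ti).
  rewrite add0n fact0 divr1 normrM ger0_norm ?mulr_ge0 ?(ltW hn)//.
  by rewrite -!mulrA ler_wpM2l ?(ltW hn)// ler_wpM2l//; apply: H; rewrite tT.
rewrite E normrM ger0_norm ?mulr_ge0 ?(ltW hn)// ler_pM2l ?mulr_gt0// in B.
have L := @lipschitz_bound R (d i t1 n) (fun x => n.+1%:R * d i t1 n.+1 x) (n.+1%:R * (b * r0 ^+ n.+1))
  (td i Ht1 n) _ X xi.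
have D : `|d i t1 n X - d i t1 n xi| <= e.
  apply: le_trans (L _) _.
    by move=> x; rewrite normrM ger0_norm// ler_wpM2l//; exact: d_le.
  apply: (@le_trans _ _ (Lip * h)).
    rewrite /Lip -[leRHS]mulrA ler_wpM2l ?mulr_ge0 ?exprn_ge0 ?(ltW r00)//.
    by rewrite distrC ger0_norm ?subr_ge0// lerBlDl.
  rewrite /h mulrCA ler_piMr ?(ltW e0)// ler_pdivrMr ?mul1r ?lerDl// ltr_wpDl//.
have -> : d i t1 n X = d i t1 n xi + (d i t1 n X - d i t1 n xi) by ring.
by apply: le_trans (ler_normD _ _) _; exact: lerD.
Qed.

Let N := #|I|.
(** With r twice r0, the factors (r0 / r)^j are 2^-j and sum to at most 2; N + 1 in place of the
    number N of unknowns keeps L positive. *)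
Let L := 2 * (N%:R + 1) * M.
Let r := 2 * r0.

Lemma sum_half m : \sum_(j < m) 2^-1 ^+ j <= 2 :> R.
Proof.
suff -> : \sum_(j < m) 2^-1 ^+ j = 2 - 2 * 2^-1 ^+ m :> R by rewrite gerBl mulr_ge0// exprn_ge0.
elim: m => [|m IH]; first by rewrite big_ord0 expr0; ring.
by rewrite big_ord_recr/= IH exprS; field.
Qed.

(* The right-hand side tends to 0 as [k] grows when [L * r * (T - t0)] is small. *)
Lemma local_bound t0 k : inT t0 -> (forall i X, d i t0 0%N X = 0) ->
  forall i T n X, inT T -> t0 <= T ->
  `|d i T n X| <= b * ((L * r * (T - t0)) ^+ k * 'C(n + k, k)%:R * r ^+ n).
Proof.
move=> Ht0 d0; have r0' : 0 < r by rewrite mulr_gt0.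
have L0 : 0 < L by rewrite !mulr_gt0// ltr_wpDl.
elim: k => [|k IH] i T n X HT tT.
  rewrite bin0 expr0 !mul1r; apply: le_trans (d_le _ _ _ HT) _; rewrite ler_wpM2l//.
  by apply: lerXn2r; rewrite ?nnegrE ?(ltW r00) ?(ltW r0')// /r ler_peMl ?(ltW r00)// ler1n.
pose C := b * (L * (L * r) ^+ k * 'C(n + k.+1, k.+1)%:R * r ^+ n.+1).
have Lrk : 0 <= (L * r) ^+ k by rewrite exprn_ge0// mulr_ge0 ?(ltW L0) ?(ltW r0').
have rn m : 0 <= r ^+ m by rewrite exprn_ge0// ltW.
have C0 : 0 <= C by apply: mulr_ge0 => //; apply: mulr_ge0 => //; apply: mulr_ge0 => //; apply: mulr_ge0 => //; exact: ltW.
have := @increment_le i n t0 T C (fun s => (s - t0) ^+ k.+1) (fun s => k.+1%:R * (s - t0) ^+ k)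
  Ht0 HT tT C0 (d0 i) _ _ X.
rewrite subrr expr0n/= subr0 => H; apply: le_trans (H _ _) _.
- by move=> s; exact: ider_expB.
- move=> s Y /andP[t0s sT].
  have Hs : inT s by move: Ht0 HT => /andP[h1 h2] /andP[h3 h4]; rewrite (le_trans h1 (ltW t0s)) (le_trans (ltW sT) h4).
  have s0 : 0 <= s - t0 by rewrite subr_ge0 ltW.
  apply: le_trans (Phi_le _ _ _ Hs) _.
  pose Q := b * ((L * r * (s - t0)) ^+ k * 'C(n.+1 + k, k)%:R * r ^+ n.+1).
  have Lrs : 0 <= (L * r * (s - t0)) ^+ k by rewrite exprn_ge0// mulr_ge0// mulr_ge0 ?(ltW L0) ?(ltW r0').
  have Q0 : 0 <= Q by apply: mulr_ge0 => //; apply: mulr_ge0 => //; exact: mulr_ge0.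
  apply: (@le_trans _ _ (n.+1%:R * \sum_(l : I) \sum_(j < n.+2) M * Q * 2^-1 ^+ j)).
    rewrite ler_wpM2l//; apply: ler_sum => l _; apply: ler_sum => j _.
    have jn : (j <= n.+1)%N by rewrite -ltnS.
    rewrite -mulrA -[leRHS]mulrA ler_wpM2l ?(ltW M0)//.
    apply: le_trans (ler_wpM2l _ (IH l s (n.+1 - j)%N Y Hs (ltW t0s))) _; first by rewrite exprn_ge0 ?ltW.
    have -> : Q * 2^-1 ^+ j = r0 ^+ j * (b * ((L * r * (s - t0)) ^+ k * 'C(n.+1 + k, k)%:R * r ^+ (n.+1 - j))).
      have -> : Q = b * ((L * r * (s - t0)) ^+ k * 'C(n.+1 + k, k)%:R * (r ^+ (n.+1 - j) * r ^+ j)).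
        by rewrite -exprD subnK.
      have -> : r ^+ j = 2 ^+ j * r0 ^+ j by rewrite exprMn.
      have : 2 ^+ j != 0 :> R by rewrite expf_neq0.
      by rewrite exprVn; move: (2 ^+ j : R) => w w0; field.
    rewrite ler_wpM2l ?exprn_ge0 ?(ltW r00)// ler_wpM2l// ler_wpM2r ?exprn_ge0 ?(ltW r0')//.
    rewrite ler_wpM2l// ler_nat.
    by apply: leq_bin2l; rewrite leq_add2r leq_subr.
  have S2 : \sum_(j < n.+2) M * Q * 2^-1 ^+ j <= 2 * (M * Q).
    rewrite -mulr_sumr mulrC ler_wpM2r ?sum_half// mulr_ge0// ltW//.
  apply: (@le_trans _ _ (n.+1%:R * (N%:R * (2 * (M * Q))))).
    rewrite ler_wpM2l//; apply: le_trans (ler_sum _ (fun l _ => S2)) _.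
    by rewrite sumr_const -[leLHS]mulr_natl.
  apply: (@le_trans _ _ (n.+1%:R * (L * Q))).
    rewrite ler_wpM2l// /L; have : 0 <= M * Q by rewrite mulr_ge0// ltW.
    by move: (M * Q) (N%:R : R) (mulrA (2 * (N%:R + 1)) M Q) => w u <- w0; lra.
  apply: le_of_eq; rewrite /Q /C exprMn addnS addSn.
  (* The factor n + 1 from the space derivative is converted here into the factor k + 1, which is
     part of the derivative of (s - t0)^(k+1). *)
  have E : n.+1%:R * 'C((n + k).+1, k)%:R = k.+1%:R * 'C((n + k).+1, k.+1)%:R :> R.
    rewrite -!natrM; congr _%:R.
    by have := mul_bin_left (n + k).+1 k; rewrite subSn ?leq_addl// addnK.
  transitivity (b * L * (L * r) ^+ k * r ^+ n.+1 * (s - t0) ^+ k * (n.+1%:R * 'C((n + k).+1, k)%:R)).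
    by ring.
  by rewrite E; ring.
- apply: le_of_eq; rewrite /C [in RHS]exprMn !exprS; ring.
Qed.

(** For n = 0 the binomial in [local_bound] equals 1, and on this interval L r (T - t0) is at most
    1/2, so that the bound is b 2^-k for every k. *)
Lemma local_zero t0 : inT t0 -> (forall i X, d i t0 0%N X = 0) ->
  forall i T X, inT T -> t0 <= T <= t0 + (2 * (L * r))^-1 -> d i T 0%N X = 0.
Proof.
move=> Ht0 d0 i T X HT /andP[tT Tt]; have r0' : 0 < r by rewrite mulr_gt0.
have L0 : 0 < L by rewrite !mulr_gt0// ltr_wpDl.
have Lr : 0 < L * r by rewrite mulr_gt0.
have B k : `|d i T 0%N X| <= b * 2^-1 ^+ k.
  apply: le_trans (local_bound k Ht0 d0 i 0 X HT tT) _.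
  rewrite ler_wpM2l// add0n binn expr0 !mulr1.
  apply: lerXn2r; rewrite ?nnegrE ?invr_ge0//; first by rewrite mulr_ge0 ?subr_ge0// ltW.
  move: Tt; rewrite -lerBlDl invfM => H; apply: le_trans (ler_wpM2l (ltW Lr) H) _.
  by rewrite mulrCA divff ?gt_eqF// mulr1.
have lim0 : b * 2^-1 ^+ k @[k --> \oo] --> 0.
  rewrite -[X in _ --> X](mulr0 b); apply: cvgM; first exact: cvg_cst.
  by apply: cvg_expr; rewrite ger0_norm ?invr_ge0// invf_lt1// ltr1n.
apply/eqP; rewrite -normr_le0.
by apply: (cvgr_to_ge lim0); exact: nearW.
Qed.

Lemma global_zero : (forall i X, d i 0 0%N X = 0) -> forall i T X, inT T -> d i T 0%N X = 0.
Proof.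
move=> d0; have r0' : 0 < r by rewrite mulr_gt0.
have L0 : 0 < L by rewrite !mulr_gt0// ltr_wpDl.
pose del := (2 * (L * r))^-1.
have del0 : 0 < del by rewrite invr_gt0 mulr_gt0// mulr_gt0.
suff H (m : nat) i T X : inT T -> T <= m%:R * del -> d i T 0%N X = 0.
  move=> i T X HT; apply: (H (Num.bound (T / del))) => //.
  have /andP[T00 _] := HT.
  have : 0 <= T / del by rewrite divr_ge0// ltW.
  by move=> /archi_boundP /ltW; rewrite ler_pdivrMr.
elim: m i T X => [|m IH] i T X HT.
  rewrite mul0r => T0'; have /andP[T00 _] := HT.
  by have -> : T = 0 by apply/le_anti; rewrite T0' T00.
move=> Tm; have [Tm'|/ltW mT] := leP T (m%:R * del); first exact: IH.
have /andP[T00 TT0] := HT.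
have Hm : inT (m%:R * del) by rewrite (le_trans mT TT0) mulr_ge0// ltW.
apply: (local_zero Hm) => //; last by rewrite mT -/del -[X in _ + X]mul1r -mulrDl natr1.
by move=> l Y; apply: IH.
Qed.

End Abstract.

(** What uniqueness retains of a solution: towers in X with a bound uniform in time, and the
    equations for the zeroth coefficients alone. *)
Definition tower_solution (A : bool -> bool -> R) T0 M q (rt vt : bool -> R -> nat -> R -> R) :=
  [/\ forall j T, 0 <= T <= T0 -> tower (rt j T) /\ tower (vt j T),
      forall j T n X, 0 <= T <= T0 -> `|rt j T n X| <= M * q ^+ n /\ `|vt j T n X| <= M * q ^+ n,
      forall j X, dsol T0 (fun T => rt j T 0%N X)
        (fun T => - 2 * (vt j T 0%N X * rt j T 1%N X) - vt j T 1%N X) &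
      forall j X, dsol T0 (fun T => vt j T 0%N X)
        (fun T => A j false * (expR (2 * rt false T 0%N X) * rt false T 1%N X) +
                  A j true * (expR (2 * rt true T 0%N X) * rt true T 1%N X) -
                  2 * (vt j T 0%N X * vt j T 1%N X))].

Lemma tmulC f g n x : tmul f g n x = tmul g f n x.
Proof.
rewrite /tmul (reindex_inj rev_ord_inj)/=; apply: eq_bigr => i _.
by rewrite mulrC !subSS subKn// -ltnS.
Qed.

Lemma tmulB f g f' g' n x : tmul f g n x - tmul f' g' n x =
  tmul (fun n x => f n x - f' n x) g n x + tmul (fun n x => g n x - g' n x) f' n x.
Proof.
rewrite [X in _ = _ + X]tmulC /tmul -sumrB -big_split/=; apply: eq_bigr => i _; ring.
Qed.

Lemma tmul_bound f g (M q : R) n x : (forall m, `|g m x| <= M * q ^+ m) ->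
  `|tmul f g n x| <= M * \sum_(j < n.+1) q ^+ j * `|f (n - j)%N x|.
Proof.
move=> hg; rewrite tmulC /tmul mulr_sumr; apply: le_trans (ler_norm_sum _ _ _) _.
by apply: ler_sum => j _; rewrite normrM mulrA ler_wpM2r.
Qed.

(** As n + 1 <= 2^n, the divisor (n+1)^2 is absorbed by enlarging q four times. This carries
    geometric bounds to the majorants for which [expm1] is estimated. *)
Lemma expn_majorant (q : R) n : 0 <= q -> q ^+ n <= majorant 0 (4 * q) 0 n.
Proof.
move=> q0; rewrite /majorant bin0 expr0 !mul1r exprMn add0n.
have -> : 4 ^+ n * q ^+ n * invsq n = q ^+ n * (4 ^+ n / n.+1%:R ^+ 2) by rewrite /invsq; ring.
rewrite ler_peMr ?exprn_ge0// ler_pdivlMr ?exprn_gt0// mul1r.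
have -> : 4 ^+ n = (2 ^+ n) ^+ 2 :> R by rewrite exprAC; congr (_ ^+ _); ring.
by apply: lerXn2r; rewrite ?nnegrE ?exprn_ge0// -natrX ler_nat ltn_expl.
Qed.

Lemma majorant_expn (q : R) n : 0 <= q -> majorant 0 q 0 n <= q ^+ n.
Proof.
move=> q0; rewrite /majorant bin0 expr0 !mul1r add0n ler_piMr ?exprn_ge0//.
by rewrite /invsq invf_le1 ?exprn_gt0// expr_ge1// ler1n.
Qed.

(** * Uniqueness in the unknowns P_j and v_j *)

Section Solutions.
Variables (A : bool -> bool -> R) (T0 M q : R).
Hypothesis q0 : 0 < q.

(** The index (true, j) stands for P_j and (false, j) for v_j. In these unknowns P_T is the
    X-derivative of -2 (1 + P) v, and e^{2r} r_X becomes P_X / 2: the exponentials disappear and the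
    flux is quadratic. *)
Definition comp_tower (rt vt : bool -> R -> nat -> R -> R) (c : bool * bool) T : nat -> R -> R :=
  if c.1 then expm1 (rt c.2 T) else vt c.2 T.

(* In the unknowns (P_j, v_j) the system is the conservation law [V_T = flux V]. *)
Definition flux (V : bool * bool -> nat -> R -> R) (c : bool * bool) : nat -> R -> R :=
  if c.1 then tder (fun n x => - 2 * (V (false, c.2) n x + tmul (V (false, c.2)) (V (true, c.2)) n x))
  else tder (fun n x => A c.2 false / 2 * V (true, false) n x + A c.2 true / 2 * V (true, true) n x -
         tmul (V (false, c.2)) (V (false, c.2)) n x).

Lemma tower_flux V c : (forall c, tower (V c)) -> tower (flux V c).
Proof.
move=> tV; rewrite /flux; case: c => -[] j /=; apply: tower_der.
  by apply: towerZ; apply: towerD => //; exact: tower_mul.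
by apply: towerB; [apply: towerD; exact: towerZ|exact: tower_mul].
Qed.

(** The difference of two quadratic fluxes is linear in V - V' with coefficients bounded by M1. The
    outer derivative gives the factor n + 1; the constant collects 2 and 4 M1 from the equation for
    P_j, and the entries of A from that for v_j. *)
Lemma fluxB_le V V' c (M1 p : R) n x : 0 < p -> 0 <= M1 ->
  (forall c n, `|V c n x| <= M1 * p ^+ n) -> (forall c n, `|V' c n x| <= M1 * p ^+ n) ->
  `|flux V c n x - flux V' c n x| <= n.+1%:R * \sum_(l : bool * bool) \sum_(j < n.+2)
     (2 + 4 * M1 + \sum_(e : bool * bool) `|A e.1 e.2|) * p ^+ j * `|V l (n.+1 - j)%N x - V' l (n.+1 - j)%N x|.
Proof.
move=> p0 M10 hV hV'.
pose S l := \sum_(j < n.+2) p ^+ j * `|V l (n.+1 - j)%N x - V' l (n.+1 - j)%N x|.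
have S0 l : 0 <= S l by apply: sumr_ge0 => j _; rewrite mulr_ge0// exprn_ge0// ltW.
have Sle l : S l <= \sum_(l : bool * bool) S l by rewrite (bigD1 l)//= lerDl sumr_ge0.
have S1 l : `|V l n.+1 x - V' l n.+1 x| <= S l.
  rewrite /S big_ord_recl/= expr0 mul1r subn0 lerDl; apply: sumr_ge0 => j _.
  by rewrite mulr_ge0// exprn_ge0// ltW.
set be := \sum_(e : bool * bool) `|A e.1 e.2|.
have be_le j l : `|A j l| <= be by rewrite /be (bigD1 (j, l))//= lerDl sumr_ge0.
have be0 : 0 <= be by exact: sumr_ge0.
set SS := \sum_(l : bool * bool) S l in Sle.
have SS0 : 0 <= SS by exact: sumr_ge0.
have -> : \sum_(l : bool * bool) \sum_(j < n.+2) (2 + 4 * M1 + be) * p ^+ j *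
    `|V l (n.+1 - j)%N x - V' l (n.+1 - j)%N x| = (2 + 4 * M1 + be) * SS.
  rewrite /SS mulr_sumr; apply: eq_bigr => l _; rewrite /S mulr_sumr; apply: eq_bigr => j _.
  by rewrite mulrA.
have T1 c1 c2 : `|tmul (V c1) (V c2) n.+1 x - tmul (V' c1) (V' c2) n.+1 x| <= 2 * M1 * SS.
  rewrite tmulB; apply: le_trans (ler_normD _ _) _.
  have h1 := @tmul_bound (fun n x => V c1 n x - V' c1 n x) (V c2) M1 p n.+1 x (hV c2).
  have h2 := @tmul_bound (fun n x => V c2 n x - V' c2 n x) (V' c1) M1 p n.+1 x (hV' c1).
  apply: le_trans (lerD h1 h2) _; rewrite -/(S c1) -/(S c2).
  have := ler_wpM2l M10 (Sle c1); have := ler_wpM2l M10 (Sle c2); lra.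
case: c => -[] j; rewrite /flux /tder /= -mulrBr normrM ger0_norm// ler_wpM2l//.
- rewrite -mulrBr normrM normrN (ger0_norm (ler0n _ 2)).
  rewrite opprD addrACA; have := T1 (false, j) (true, j); have := le_trans (S1 (false, j)) (Sle _).
  move: (V _ _ _ - V' _ _ _) (tmul _ _ _ _ - _) => u w h1 h2.
  have := ler_normD u w; have := mulr_ge0 be0 SS0; lra.
- have E : A j false / 2 * V (true, false) n.+1 x + A j true / 2 * V (true, true) n.+1 x -
      tmul (V (false, j)) (V (false, j)) n.+1 x - (A j false / 2 * V' (true, false) n.+1 x +
      A j true / 2 * V' (true, true) n.+1 x - tmul (V' (false, j)) (V' (false, j)) n.+1 x) =
      A j false / 2 * (V (true, false) n.+1 x - V' (true, false) n.+1 x) +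
      A j true / 2 * (V (true, true) n.+1 x - V' (true, true) n.+1 x) -
      (tmul (V (false, j)) (V (false, j)) n.+1 x - tmul (V' (false, j)) (V' (false, j)) n.+1 x) by ring.
  rewrite E; have h1 := T1 (false, j) (false, j).
  have h2 l : `|A j l / 2 * (V (true, l) n.+1 x - V' (true, l) n.+1 x)| <= be / 2 * SS.
    rewrite normrM; apply: ler_pM => //; last exact: le_trans (S1 _) (Sle _).
    by rewrite normrM (ger0_norm (_ : 0 <= 2^-1 :> R)) ?invr_ge0// ler_wpM2r// invr_ge0.
  apply: le_trans (ler_normB _ _) _; apply: le_trans (lerD (ler_normD _ _) (lexx _)) _.
  have := h2 false; have := h2 true; have := mulr_ge0 M10 SS0; lra.
Qed.

Lemma flux_dsol rt vt c X : tower_solution A T0 M q rt vt ->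
  dsol T0 (fun T => comp_tower rt vt c T 0%N X) (fun T => flux (fun c => comp_tower rt vt c T) c 0%N X).
Proof.
case=> tt bb dr dv.
have q4 : 0 <= 4 * q by rewrite mulr_ge0// ltW.
have hm j T n Y : 0 <= T <= T0 -> `|rt j T n Y| <= M * majorant 0 (4 * q) 0 n.
  move=> HT; apply: le_trans (bb j T n Y HT).1 _; apply: ler_wpM2l; last by apply: expn_majorant; exact: ltW.
  by have := (bb j T 0%N 0 HT).1; rewrite mulr1; exact: le_trans.
have P0 j T Y : 0 <= T <= T0 -> expm1 (rt j T) 0%N Y = expR (2 * rt j T 0%N Y) - 1.
  by move=> HT; apply: (@expm10 R (4 * q) (rt j T) q4 M) => n; exact: hm.
(* The first coefficient of [expm1] is obtained without expanding the series: it is the derivative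
   of the zeroth one, which is known in closed form. *)
have P1 j T : 0 <= T <= T0 -> expm1 (rt j T) 1%N X = 2 * expR (2 * rt j T 0%N X) * rt j T 1%N X.
  move=> HT; have tP := tower_expm1 q4 (tt j T HT).1 (fun n x => hm j T n x HT).
  have d1 := tP 0%N X; rewrite mul1r (funext (fun Y => P0 j T Y HT)) in d1.
  have d2 := iderB (ider_expR (iderM (ider_cst 2 X) ((tt j T HT).1 0%N X))) (ider_cst 1 X).
  have := @derive_val _ _ _ _ _ _ _ d1; rewrite (@derive_val _ _ _ _ _ _ _ d2) => <-.
  by rewrite mul1r; ring.
have inT T : 0 < T < T0 -> 0 <= T <= T0 by move=> /andP[/ltW -> /ltW ->].
case: c => -[] j; rewrite /comp_tower/=.
- have [d c] := dr j X.
  have D : dsol T0 (fun T => expR (2 * rt j T 0%N X) - 1)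
      (fun T => expR (2 * rt j T 0%N X) * (2 * (- 2 * (vt j T 0%N X * rt j T 1%N X) - vt j T 1%N X))).
    split => T HT.
      have d2 := iderB (ider_expR (iderM (ider_cst 2 T) (d T HT))) (ider_cst 1 T).
      by eapply is_derive_eq; [exact: d2|ring].
    apply: cvgB; last exact: cvg_cst.
    have c2 : 2 * rt j T' 0%N X @[T' --> within `[0, T0] (nbhs T)] --> 2 * rt j T 0%N X.
      by apply: cvgM; [exact: cvg_cst|exact: c].
    exact: (cvg_comp _ _ c2 (@continuous_expR R _)).
  apply: dsol_ext D => [T HT|T /inT HT]; first by rewrite P0.
  rewrite /flux/= /tder mul1r /tmul !big_ord_recl big_ord0/= /bump/= P1// P0//.
  by ring.
- apply: dsol_ext (dv j X) => // T /inT HT.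
  rewrite /flux/= /tder mul1r /tmul !big_ord_recl big_ord0/= !P1//.
  by rewrite /bump/=; field.
Qed.

(** [global_zero] is applied to the differences of the P_j and v_j; injectivity of the exponential
    then recovers r_j from P_j. *)
Lemma tower_solution_unique rt vt rt' vt' : 
  tower_solution A T0 M q rt vt -> tower_solution A T0 M q rt' vt' ->
  (forall j X, rt j 0 0%N X = rt' j 0 0%N X /\ vt j 0 0%N X = vt' j 0 0%N X) ->
  forall j T X, 0 <= T <= T0 -> rt j T 0%N X = rt' j T 0%N X /\ vt j T 0%N X = vt' j T 0%N X.
Proof.
move=> S S' I0 j T X HT.
have T00 : 0 <= T0 by move: HT => /andP[h1 h2]; exact: le_trans h2.
have M0 : 0 <= M.
  by case: S => _ b _ _; have := (b j T 0%N X HT).1; rewrite mulr1; exact: le_trans.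
have q4 : 0 <= 4 * q by rewrite mulr_ge0// ltW.
have q40 : 0 < 4 * q by rewrite mulr_gt0.
(* One constant for both kinds of unknown: M bounds the v_j, the other summand bounds [expm1] of the
   r_j. *)
pose M1 := M + 4 * M * expR (64 * M).
have E0 : 0 <= 4 * M * expR (64 * M) by rewrite mulr_ge0 ?expR_ge0// mulr_ge0.
have key r v : tower_solution A T0 M q r v ->
  [/\ forall c t, 0 <= t <= T0 -> tower (comp_tower r v c t),
     forall c t n x, 0 <= t <= T0 -> `|comp_tower r v c t n x| <= M1 * (4 * q) ^+ n &
     forall j t x, 0 <= t <= T0 -> comp_tower r v (true, j) t 0%N x = expR (2 * r j t 0%N x) - 1].
  case=> tt bb _ _.
  have hm l t n Y : 0 <= t <= T0 -> `|r l t n Y| <= M * majorant 0 (4 * q) 0 n.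
    move=> Ht; apply: le_trans (bb l t n Y Ht).1 _; apply: ler_wpM2l => //.
    by apply: expn_majorant; exact: ltW.
  split.
  - case=> -[] l t Ht; rewrite /comp_tower/=; last exact: (tt l t Ht).2.
    exact: (tower_expm1 q4 (tt l t Ht).1 (fun n x => hm l t n x Ht)).
  - case=> -[] l t n x Ht; rewrite /comp_tower/=.
      have MM : 0 <= M <= M by rewrite M0 lexx.
      apply: le_trans (@expm1_le R (4 * q) (r l t) q4 M M n x MM (fun n => hm l t n x Ht)) _.
      apply: ler_pM => //; [exact: majorant_ge0|by rewrite lerDr|exact: majorant_expn].
    apply: le_trans (bb l t n x Ht).2 _; apply: ler_pM; rewrite ?exprn_ge0 ?(ltW q0)// ?lerDl//.
    by apply: lerXn2r; rewrite ?nnegrE ?(ltW q0)// ler_peMl ?(ltW q0)// ler1n.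
  - by move=> l t x Ht; apply: (@expm10 R (4 * q) (r l t) q4 M) => n; exact: hm.
have [tV bV PV] := key _ _ S; have [tV' bV' PV'] := key _ _ S'.
have M10 : 0 <= M1 by rewrite addr_ge0.
have be0 : 0 <= \sum_(e : bool * bool) `|A e.1 e.2| by exact: sumr_ge0.
have Z : forall c t x, 0 <= t <= T0 -> comp_tower rt vt c t 0%N x - comp_tower rt' vt' c t 0%N x = 0.
  pose d c t n x := comp_tower rt vt c t n x - comp_tower rt' vt' c t n x.
  pose Phi c t n x := flux (comp_tower rt vt ^~ t) c n x - flux (comp_tower rt' vt' ^~ t) c n x.
  apply: (@global_zero _ d Phi T0 (2 * M1) (2 + 4 * M1 + \sum_(e : bool * bool) `|A e.1 e.2|) (4 * q)).
  - exact: mulr_ge0.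
  - by rewrite ltr_wpDr// ltr_wpDr// mulr_ge0.
  - exact: q40.
  - by move=> c t Ht; apply: towerB; [exact: tV|exact: tV'].
  - by move=> c t Ht; apply: towerB; apply: tower_flux => e; [exact: tV|exact: tV'].
  - by move=> c x; apply: dsolB; exact: flux_dsol.
  - move=> c t n x Ht; apply: le_trans (ler_normB _ _) _.
    by have := bV c t n x Ht; have := bV' c t n x Ht; lra.
  - move=> c t n x Ht; apply: (fluxB_le _ _ q40 M10) => e m; [exact: bV|exact: bV'].
  - move=> [[] l] x; have H0 : 0 <= (0 : R) <= T0 by rewrite lexx.
      by rewrite /d PV// PV'// (I0 l x).1 subrr.
    by rewrite /d /comp_tower/= (I0 l x).2 subrr.
split; last by have := Z (false, j) T X HT; rewrite /comp_tower/= => /eqP; rewrite subr_eq0 => /eqP.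
have := Z (true, j) T X HT; rewrite PV// PV'// => /eqP; rewrite subr_eq0 => /eqP /addIr /expR_inj.
by apply: mulfI.
Qed.

End Solutions.
End Uniqueness.

(** * Gevrey norms and Taylor coefficients *)

Section GevreyTowers.
Context {R : realType}.
Local Notation mu := (@lebesgue_measure R).

Lemma mx_cvgP (T : Type) (F : set_system T) (FF : Filter F) m n (f : T -> 'M[R]_(m, n)) (M : 'M[R]_(m, n)) :
  f x @[x --> F] --> M <-> forall i j, f x i j @[x --> F] --> M i j.
Proof.
split=> [H i j|H].
  exact: (cvg_comp _ _ H (@coord_continuous R m n i j M)).
apply/cvgrPdist_le => e e0; near=> x.
rewrite /Num.Def.normr/= mx_normrE (bigmax_le _ (ltW e0))//= => i _.
rewrite !mxE; move: i; near: x; apply: filter_forall => /= i.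
exact: (cvgrPdist_le _ _).1 (H i.1 i.2) e e0.
Unshelve. all: by end_near. Qed.

(** The set where two continuous functions differ is open, and a nonempty open set has positive
    measure. *)
Lemma continuous_ae_eq (f g : R -> R) : continuous f -> continuous g ->
  {ae mu, forall x, f x = g x} -> forall x, f x = g x.
Proof.
move=> cf cg [N [mN N0 fgN]] x; apply: contrapT => fgx.
pose h y := f y - g y.
have ch : continuous h by move=> y; apply: cvgB; [exact: cf|exact: cg].
have hx : h x != 0 by rewrite subr_eq0; apply/eqP.
have [e /= e0 eh] : nbhs x [set y | h y != 0].
  exact: (cvgr_neq0 _ (ch x) hx).
have : (0 < mu (ball x e))%E by rewrite lebesgue_measure_ball ?ltW// lte_fin mulrn_wgt0.
rewrite ltNge => /negP; apply.
rewrite -N0; apply: le_measure; rewrite ?inE//; first exact: measurable_ball.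
move=> y /eh /= hy; apply: fgN => /= E; move: hy; rewrite /h E ?subrr ?eqxx//.
Qed.

Lemma dnbhs_shift (T : R) : h + T @[h --> 0^'] --> T^'.
Proof.
move=> A; rewrite /dnbhs /within /= => /nbhs_ballP[e e0 H]; apply/nbhs_ballP; exists e => //= h.
rewrite /ball/= sub0r normrN => he h0; apply: H.
  by rewrite /ball/= opprD addrCA subrr addr0 normrN.
by rewrite -subr_eq0 addrK.
Qed.

Lemma dnbhs_unshift (T : R) : T' - T @[T' --> T^'] --> 0^'.
Proof.
move=> A; rewrite /dnbhs /within /= => /nbhs_ballP[e e0 H]; apply/nbhs_ballP; exists e => //= t.
rewrite /ball/= => te tT; apply: H; last by rewrite subr_eq0.
by rewrite /ball/= sub0r normrN distrC.
Qed.

(** At interior points the restricted quotient is the ordinary one. At the ends only continuity is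
    claimed, and it follows from boundedness of the difference quotient. *)
Lemma quotient_dsol T0 (y z : R -> R) :
  (forall T, 0 <= T <= T0 ->
    (T' - T)^-1 * (y T' - y T) @[T' --> within `[0, T0] T^'] --> z T) -> dsol T0 y z.
Proof.
move=> H; split=> T HT.
  have HT' : 0 <= T <= T0 by move: HT => /andP[/ltW -> /ltW ->].
  have Hq : (T' - T)^-1 * (y T' - y T) @[T' --> T^'] --> z T.
    move=> A zA; have HA := H T HT' A zA.
    have D : \forall s \near T^', s \in `[0, T0].
      near=> s; have : s \in `]0, T0[.
        by near: s; apply: nbhs_dnbhs; apply: near_in_itvoo; rewrite in_itv.
      by rewrite !in_itv/= => /andP[/ltW -> /ltW ->].
    have HA' : \forall t \near T^', t \in `[0, T0] -> A ((t - T)^-1 * (y t - y T)) by exact: HA.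
    near_simpl; near=> t; apply: (near HA' t) => //; exact: (near D t).
  have Hc : h^-1 *: ((y \o shift T) (h *: (1 : R)) - y T) @[h --> 0^'] --> z T.
    apply: cvg_trans (cvg_comp _ _ (@dnbhs_shift T) Hq); apply: near_eq_cvg.
    by apply: nearW => h /=; rewrite addrK /GRing.scale/= mulr1.
  split; first by apply/cvg_ex; exists (z T).
  exact: cvg_lim Hc.
apply/cvgrPdist_le => e e0.
have := (cvgrPdist_le _ _).1 (H T HT) 1 ltr01.
rewrite [X in _ -> X]near_withinE => H0.
have H1 : \forall t \near T, t != T -> `[0, T0]%classic t -> `|z T - (t - T)^-1 * (y t - y T)| <= 1.
  exact: H0.
have z1 : 0 < `|z T| + 1 by rewrite ltr_wpDl.
near=> t.
have [-> _|tT Dt] := eqVneq t T; first by rewrite subrr normr0 ltW.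
have Q : `|z T - (t - T)^-1 * (y t - y T)| <= 1 by apply: (near H1 t).
have tT0 : t - T != 0 by rewrite subr_eq0.
have -> : y T - y t = (t - T) * ((z T - (t - T)^-1 * (y t - y T)) - z T) by field.
rewrite normrM.
apply: (@le_trans _ _ (`|t - T| * (`|z T| + 1))).
  rewrite ler_wpM2l//; apply: le_trans (ler_normB _ _) _; rewrite [leRHS]addrC; exact: lerD.
rewrite -ler_pdivlMr// distrC; near: t; apply/nbhs_ballP.
exists (e / (`|z T| + 1)); first exact: divr_gt0.
by move=> t; rewrite /ball/= => /ltW.
Unshelve. all: by end_near. Qed.

Lemma derive_quotient T0 (y : R -> R) (T z : R) : is_derive T 1 y z ->
  (T' - T)^-1 * (y T' - y T) @[T' --> within `[0, T0] T^'] --> z.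
Proof.
move=> [/cvg_ex[l dl] <-]; apply: cvg_within_filter.
have -> : 'D_1 y T = l by exact: cvg_lim dl.
apply: cvg_trans (cvg_comp _ _ (@dnbhs_unshift T) dl); apply: near_eq_cvg.
by apply: nearW => t /=; rewrite /GRing.scale/= mulr1 subrK.
Qed.

(** * Gevrey weights compared with exponentials *)

Section Weight.
Variables (s : R).
Hypothesis s0 : 0 < s.

Lemma gevrey_weight_ge (sigma xi : R) : 0 <= sigma -> expR (sigma * `|xi|) <= gevrey_weight s sigma xi.
Proof.
move=> sg; rewrite /gevrey_weight -[leLHS]mulr1; apply: ler_pM => //.
- by rewrite ler_expR mulrDr mulr1 lerDl.
- by rewrite -[leLHS]sqrtr1 ler_sqrt ?lerDl ?powR_ge0// addr_ge0 ?powR_ge0.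
Qed.

(** The inequality ln z <= z at z = x del / s, multiplied by 2 s. *)
Lemma powR_le_exp (del x : R) : 0 < del -> 0 <= x -> x `^ (2 * s) <= (s / del) `^ (2 * s) * expR (2 * del * x).
Proof.
move=> d0; rewrite le_eqVlt => /orP[/eqP <-|x0].
  by rewrite powR0 ?mulr_ge0 ?powR_ge0 ?expR_ge0// mulf_neq0// gt_eqF.
have sd : 0 < s / del by rewrite divr_gt0.
have y0 : 0 < x / (s / del) by rewrite divr_gt0.
have -> : x `^ (2 * s) = (s / del) `^ (2 * s) * (x / (s / del)) `^ (2 * s).
  by rewrite -powRM ?(ltW sd) ?(ltW y0)//; congr (_ `^ _); field; rewrite !gt_eqF.
rewrite ler_wpM2l ?powR_ge0// /powR gt_eqF// ler_expR.
have -> : 2 * del * x = 2 * s * (x / (s / del)) by field; rewrite !gt_eqF.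
by rewrite ler_wpM2l ?mulr_ge0 ?(ltW s0)// ltW// ln_sublinear.
Qed.

Lemma gevrey_weight_le (sigma sigma' : R) : sigma < sigma' ->
  exists2 K : R, 0 < K & forall xi, gevrey_weight s sigma xi ^+ 2 <= K * expR (sigma' * `|xi|) ^+ 2.
Proof.
move=> ss; pose del := sigma' - sigma.
have d0 : 0 < del by rewrite subr_gt0.
exists (expR sigma ^+ 2 * (1 + (s / del) `^ (2 * s))).
  by rewrite mulr_gt0 ?exprn_gt0 ?expR_gt0// ltr_wpDr ?powR_ge0.
move=> xi; rewrite /gevrey_weight exprMn sqr_sqrtr ?addr_ge0 ?powR_ge0//.
have -> : expR (sigma * (`|xi| + 1)) ^+ 2 = expR sigma ^+ 2 * expR (sigma * `|xi|) ^+ 2.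
  by rewrite -exprMn -expRD; congr (expR _ ^+ _); ring.
rewrite -[leLHS]mulrA -[leRHS]mulrA ler_wpM2l ?sqr_ge0//.
have -> : expR (sigma' * `|xi|) ^+ 2 = expR (sigma * `|xi|) ^+ 2 * expR (2 * del * `|xi|).
  by rewrite !expr2 -!expRD; congr expR; rewrite /del; ring.
rewrite [leRHS]mulrCA ler_wpM2l ?sqr_ge0//.
have H := powR_le_exp d0 (normr_ge0 xi).
apply: le_trans (lerD (lexx 1) H) _; rewrite [leRHS]mulrDl mul1r lerD2r.
by rewrite -expR0 ler_expR !mulr_ge0// ltW.
Qed.

Lemma measurable_gevrey_weight sigma : measurable_fun setT (gevrey_weight s sigma).
Proof.
apply: measurable_funM.
  apply: measurableT_comp => //; apply: measurable_funM => //.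
  by apply: measurable_funD.
apply: (measurableT_comp (f := (fun x : R => Num.sqrt x))).
  by apply: continuous_measurable_fun; exact: sqrt_continuous.
apply: measurable_funD => //.
by apply: (measurableT_comp (f := @powR R ^~ (2 * s))) => //; exact: measurable_powR.
Qed.

Section Norm.
Context {n : nat}.
Implicit Types u : R -> 'cV[R]_n.

Lemma fourierP (f : R -> R) : (exists g, is_fourier f g) -> is_fourier f (fourier f).
Proof. exact: xgetPex. Qed.

Lemma gevrey_norm_sqint sigma u (c : R) : 0 <= c ->
  (gevrey_norm s sigma u <= c%:E)%E =
  (sqint (fun xi => gevrey_weight s sigma xi * fourier_modulus u xi)%R <= (c ^+ 2)%:E)%E.
Proof. by move=> c0; rewrite /gevrey_norm Lnorm2_le. Qed.

Lemma fourier_modulus_sqr u xi : fourier_modulus u xi ^+ 2 =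
  \sum_(i < n) (complex.Re (fourier (component u i) xi) ^+ 2 + complex.Im (fourier (component u i) xi) ^+ 2).
Proof.
rewrite /fourier_modulus sqr_sqrtr; last by apply: sumr_ge0 => i _; exact: sqr_ge0.
by apply: eq_bigr => i _; rewrite normc_sqr.
Qed.

Lemma measurable_fourier_modulus u : (forall i, exists g, is_fourier (component u i) g) ->
  measurable_fun setT (fourier_modulus u).
Proof.
move=> H; apply: (measurableT_comp (f := (fun x : R => Num.sqrt x))).
  by apply: continuous_measurable_fun; exact: sqrt_continuous.
apply: measurable_sum => i; apply: measurable_funX.
have /is_fourierP[_ [ma _] [mb _] _] := fourierP (H i).
have -> : (fun xi => Normc.normc (fourier (component u i) xi)) =
    (fun xi => Normc.normc (complex.Re (fourier (component u i) xi) +i* (- - complex.Im (fourier (component u i) xi)))%C).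
  by apply/funext => xi; rewrite opprK; case: (fourier _ _).
by apply: measurable_normc => //; exact: measurableT_comp.
Qed.

Lemma gevrey_ft sigma u (c : R) i : 0 <= sigma -> 0 <= c -> gevrey s sigma u ->
  (gevrey_norm s sigma u <= c%:E)%E -> exists a b, ft (component u i) a b /\
    (\int[mu]_xi (expR (sigma * `|xi|) ^+ 2 * (a xi ^+ 2 + b xi ^+ 2))%:E <= (c ^+ 2)%:E)%E.
Proof.
move=> sg c0 [H _]; rewrite gevrey_norm_sqint// => Hn.
have /is_fourierP F := fourierP (H i).
eexists; eexists; split; first exact: F.
have [_ [ma _] [mb _] _] := F.
have mm := measurable_fourier_modulus H.
apply: le_trans Hn; apply: ge0_le_integral => //.
- by move=> xi _; rewrite lee_fin mulr_ge0 ?sqr_ge0// addr_ge0 ?sqr_ge0.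
- apply/measurable_EFinP; apply: measurable_funM.
    apply: measurable_funX; have := measurable_decay (- sigma).
    by under eq_fun do rewrite mulNr opprK.
  by apply: measurable_funD; exact: measurable_funX.
- by apply: measurable_sqr; apply: measurable_funM => //; exact: measurable_gevrey_weight.
move=> xi _; rewrite lee_fin exprMn sqrrN.
apply: ler_pM; rewrite ?sqr_ge0 ?addr_ge0 ?sqr_ge0//.
  by apply: lerXn2r; rewrite ?nnegrE ?expR_ge0 ?gevrey_weight_ge// (le_trans _ (gevrey_weight_ge _ _))// expR_ge0.
rewrite fourier_modulus_sqr (bigD1 i)//= lerDl; apply: sumr_ge0 => j _.
by rewrite addr_ge0 ?sqr_ge0.
Qed.

(** An intermediate radius sigma' separates two losses: from rho to sigma' the Taylor series of the
    exponential is summed, from sigma' to sigma the factor 1 + |xi|^(2s) is absorbed. K does not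
    depend on u and the bound is linear in c, which makes small increments in time small in norm. *)
Lemma gevrey_tower (sigma rho : R) : 0 < sigma < rho -> exists2 K : R, 0 < K &
  forall u (f : 'I_n -> nat -> R -> R) (c : R), 0 <= c -> (forall i, tower (f i)) ->
    (forall i x, component u i x = f i 0%N x) ->
    (forall i m, sqint (f i m) <= ((c * rho^-1 ^+ m) ^+ 2)%:E)%E ->
    gevrey s sigma u /\ (gevrey_norm s sigma u <= (K * c)%:E)%E.
Proof.
move=> /andP[sg0 sr]; pose sg' := (sigma + rho) / 2.
have sg1 : sigma < sg' by rewrite /sg'; lra.
have sg2 : sg' < rho by rewrite /sg'; lra.
have [K1 K10 HK1] := gevrey_weight_le sg1.
pose K2 := n%:R * (K1 * (16 * pi * (1 - sg' / rho)^-1 ^+ 2)).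
have K20 : 0 <= K2.
  apply: mulr_ge0 => //; apply: mulr_ge0; first exact: ltW.
  by apply: mulr_ge0; [rewrite mulr_ge0 ?pi_ge0|exact: sqr_ge0].
exists (Num.sqrt K2 + 1); first by rewrite ltr_wpDl ?sqrtr_ge0.
move=> u f c c0 tf uf sf.
have uE i : component u i = f i 0%N by apply/funext => x; exact: uf.
have Hf i : exists g, is_fourier (component u i) g.
  have L2 : isL2 (component u i).
    rewrite uE; split; first exact: tower_measurable.
    by apply: le_lt_trans (sf i 0%N) _; rewrite ltry.
  have [a [b Hab]] := ft_exists L2.
  exists (fun xi => (a xi -i* b xi)%C); apply/is_fourierP => /=.
  by under [X in ft _ _ X]eq_fun do rewrite opprK.
have mm := measurable_fourier_modulus Hf.
have N : (gevrey_norm s sigma u <= ((Num.sqrt K2 + 1) * c)%:E)%E.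
  rewrite gevrey_norm_sqint ?mulr_ge0 ?addr_ge0 ?sqrtr_ge0//.
  pose T i xi := expR (sg' * `|xi|) ^+ 2 * ((complex.Re (fourier (component u i) xi)) ^+ 2 +
    (- complex.Im (fourier (component u i) xi)) ^+ 2).
  have mT i : measurable_fun setT (fun xi => (T i xi)%:E).
    have /is_fourierP[_ [ma _] [mb _] _] := fourierP (Hf i).
    apply/measurable_EFinP; apply: measurable_funM.
      apply: measurable_funX; have := measurable_decay (- sg').
      by under eq_fun do rewrite mulNr opprK.
    by apply: measurable_funD; exact: measurable_funX.
  have T0 i xi : (0 <= (T i xi)%:E)%E by rewrite lee_fin mulr_ge0 ?sqr_ge0// addr_ge0 ?sqr_ge0.
  have IT i : (\int[mu]_xi (T i xi)%:E <= (16 * pi * (1 - sg' / rho)^-1 ^+ 2 * c ^+ 2)%:E)%E.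
    have /is_fourierP F := fourierP (Hf i).
    rewrite uE in F; have sg'0 : 0 < sg' < rho by rewrite sg2 (lt_trans sg0 sg1).
    by have := ft_tower_exp sg'0 (tf i) F (sf i); rewrite -uE.
  apply: (@le_trans _ _ (\int[mu]_xi (K1%:E * \sum_(i < n) (T i xi)%:E))%E).
    apply: ge0_le_integral => //.
    - by move=> xi _; rewrite lee_fin sqr_ge0.
    - by apply: measurable_sqr; apply: measurable_funM => //; exact: measurable_gevrey_weight.
    - by apply: measurable_funeM; exact: emeasurable_sum.
    move=> xi _; rewrite sumEFin -EFinM lee_fin exprMn fourier_modulus_sqr.
    apply: le_trans (ler_wpM2r _ (HK1 xi)) _.
      by apply: sumr_ge0 => i _; rewrite addr_ge0 ?sqr_ge0.
    rewrite -mulrA ler_wpM2l ?(ltW K10)// mulr_sumr; apply: ler_sum => i _.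
    by rewrite /T sqrrN.
  have K1e : (0 <= K1%:E)%E by rewrite lee_fin ltW.
  rewrite (ge0_integralZl _ _ _ _ K1e)//; try by [exact: emeasurable_sum|move=> xi _; exact: sume_ge0].
  rewrite ge0_integral_sum//.
  apply: le_trans (lee_wpmul2l K1e (lee_sum _ (fun i _ => IT i))) _.
  rewrite sumEFin -EFinM lee_fin sumr_const card_ord -[X in K1 * X]mulr_natl.
  have -> : K1 * (n%:R * (16 * pi * (1 - sg' / rho)^-1 ^+ 2 * c ^+ 2)) = K2 * c ^+ 2 by rewrite /K2; ring.
  rewrite exprMn ler_wpM2r ?sqr_ge0// -[leLHS](sqr_sqrtr K20).
  by apply: lerXn2r; rewrite ?nnegrE ?addr_ge0 ?sqrtr_ge0// lerDl.
by split => //; split => //; apply: le_lt_trans N _; rewrite ltry.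
Qed.

End Norm.
End Weight.

(** Each of the n + 1 terms x^k with k <= n is at least x^n, and together they sum to at most 1/(1 -
    x). *)
Lemma expn_poly_le (x : R) n : 0 <= x < 1 -> n.+1%:R * x ^+ n <= (1 - x)^-1.
Proof.
move=> /andP[x0 x1]; have d0 : 0 < 1 - x by rewrite subr_gt0.
have H : n.+1%:R * x ^+ n * (1 - x) <= 1 - x ^+ n.+1.
  elim: n => [|n IH]; first by rewrite expr0 mulr1 mul1r expr1.
  have := ler_wpM2l x0 IH; have : x ^+ n.+1 <= 1 by rewrite exprn_ile1// ltW.
  rewrite -[n.+2%:R]natr1 !exprS; have := exprn_ge0 n x0.
  move: (x ^+ n) (n.+1%:R : R) => z N z0; nra.
rewrite -[leRHS]div1r ler_pdivlMr//; apply: le_trans H _.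
by rewrite gerBl exprn_ge0.
Qed.

(** * A square-integrable envelope of the Taylor coefficients *)

Section Envelope.
Variables (I : finType) (g : I -> nat -> R -> R) (x rho c k : R).
Hypotheses (x01 : 0 < x < 1) (rho0 : 0 < rho) (c0 : 0 <= c) (k0 : 0 <= k).
Hypothesis mg : forall i n, measurable_fun setT (g i n).
Hypothesis g_le : forall i n X, `|g i n X| <= k * c * rho^-1 ^+ n.
Hypothesis g_sqint : forall i n, (sqint (g i n) <= ((c * rho^-1 ^+ n) ^+ 2)%:E)%E.

(** The factor N counts the functions, (1-x)^-4 bounds ((n+1) x^n)^4, and 1/(1 - x^2) is the sum of
    the remaining geometric series. *)
Definition envelope_const (N : nat) (x : R) := Num.sqrt (N%:R * (1 - x)^-1 ^+ 4 / (1 - x ^+ 2)).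

Let q := (rho * x ^+ 3)^-1.
Let K := majorant 0 q 0.
Let E := #|I|%:R * (1 - x)^-1 ^+ 4 / (1 - x ^+ 2).

(* [m ^ 2] is the sum over [i] and [n] of the squares of [g i n / K n]. *)
Lemma envelope : exists m : R -> R, [/\ measurable_fun setT m,
  forall X, 0 <= m X <= envelope_const #|I| x * k * c,
  forall i n X, `|g i n X| <= m X * K n &
  (sqint m <= ((envelope_const #|I| x * c) ^+ 2)%:E)%E].
Proof.
have /andP[x0 x1] := x01; have d0 : 0 < 1 - x by rewrite subr_gt0.
have x20 : 0 < x ^+ 2 by rewrite exprn_gt0.
have x21 : x ^+ 2 < 1 by rewrite exprn_ilt1 ?(ltW x0).
have d2 : 0 < 1 - x ^+ 2 by rewrite subr_gt0.
have x2 : 0 <= x ^+ 2 < 1 by rewrite (ltW x20).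
have q0 : 0 < q by rewrite invr_gt0 mulr_gt0// exprn_gt0.
have KE n : K n = q ^+ n / n.+1%:R ^+ 2 by rewrite /K /majorant bin0 expr0 !mul1r add0n.
have K0 n : 0 < K n by rewrite KE divr_gt0// exprn_gt0.
pose W n := (K n)^-1.
have W0 n : 0 < W n by rewrite invr_gt0.
(* Shrinking the radius by x^3 gives x^(3n): two factors x^n absorb (n+1)^2, the reciprocal of the
   weight in the majorant, and the third leaves a convergent series. *)
have WE n : (W n * rho^-1 ^+ n) ^+ 2 <= (1 - x)^-1 ^+ 4 * (x ^+ 2) ^+ n.
  have -> : (W n * rho^-1 ^+ n) ^+ 2 = (n.+1%:R * x ^+ n) ^+ 4 * (x ^+ 2) ^+ n.
    rewrite /W KE /q exprVn [(rho * _) ^+ n]exprMn [(x ^+ 3) ^+ n]exprAC [(x ^+ 2) ^+ n]exprAC.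
    have : rho ^+ n != 0 by rewrite expf_neq0// gt_eqF.
    have : n.+1%:R != 0 :> R by [].
    have : x ^+ n != 0 by rewrite expf_neq0// gt_eqF.
    rewrite exprVn; move: (rho ^+ n) (x ^+ n) (n.+1%:R : R) => u v w h1 h2 h3; field.
    by rewrite h1 h2 h3.
  rewrite ler_wpM2r ?(exprn_ge0 _ (ltW x20))//.
  apply: lerXn2r; rewrite ?nnegrE ?invr_ge0 ?(ltW d0)//; first by rewrite mulr_ge0// exprn_ge0// ltW.
  by apply: expn_poly_le; rewrite (ltW x0).
pose h n X := \sum_(i : I) (W n * g i n X) ^+ 2.
have h0 n X : 0 <= h n X by apply: sumr_ge0 => i _; exact: sqr_ge0.
have hle n X : `|h n X| <= #|I|%:R * (k * c) ^+ 2 * (1 - x)^-1 ^+ 4 * (x ^+ 2) ^+ n.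
  rewrite ger0_norm//; apply: (@le_trans _ _ (\sum_(i : I) (k * c) ^+ 2 * ((1 - x)^-1 ^+ 4 * (x ^+ 2) ^+ n))).
    apply: ler_sum => i _; apply: le_trans (ler_wpM2l (sqr_ge0 (k * c)) (WE n)).
    rewrite -exprMn -[leLHS]real_normK ?num_real//; apply: lerXn2r; rewrite ?nnegrE//.
      apply: mulr_ge0; first exact: mulr_ge0.
      by apply: mulr_ge0; [exact: ltW|rewrite exprn_ge0// invr_ge0 ltW].
    by rewrite normrM (ger0_norm (ltW (W0 n))) [leRHS]mulrCA ler_wpM2l ?(ltW (W0 n)).
  by rewrite sumr_const -[leLHS]mulr_natl !mulrA.
have Sh X := sums_bounded x2 (fun n => hle n X).
pose S X := sig (fun n => h n X).
have hS n X : h n X <= S X.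
  apply: (cvgr_to_ge (Sh X).1); exists n.+1 => // N /= nN.
  by rewrite (bigD1 (Ordinal nN))//= lerDl sumr_ge0.
have S0 X : 0 <= S X by exact: le_trans (hS 0%N X).
have SE X : S X <= E * (k * c) ^+ 2.
  apply: le_trans (ler_norm _) _; have := (Sh X).2 0%N; rewrite big_ord0 subr0 mulr1 => /le_trans; apply.
  by apply: le_of_eq; rewrite /E; ring.
have E0 : 0 <= E by rewrite divr_ge0 ?mulr_ge0 ?exprn_ge0 ?invr_ge0 ?(ltW d0) ?(ltW d2).
have mh n : measurable_fun setT (h n).
  by apply: measurable_sum => i; apply: measurable_funX; apply: measurable_funM.
have mS : measurable_fun setT S.
  apply: (@measurable_fun_cvg _ _ _ _ (fun N X => \sum_(n < N) h n X)).
    by move=> N; apply: measurable_sum.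
  by move=> X _; exact: (Sh X).1.
exists (fun X => Num.sqrt (S X)); split.
- apply: (measurableT_comp (f := (fun x : R => Num.sqrt x))) => //.
  by apply: continuous_measurable_fun; exact: sqrt_continuous.
- move=> X; rewrite sqrtr_ge0/=.
  rewrite -mulrA -[X in _ * X](ger0_norm (mulr_ge0 k0 c0)) -sqrtr_sqr -sqrtrM//.
  by rewrite ler_sqrt ?SE// mulr_ge0 ?sqr_ge0.
- move=> i n X; rewrite -ler_pdivrMr// -[leLHS](@ger0_norm _ _) ?divr_ge0 ?(ltW (K0 n))//.
  rewrite -sqrtr_sqr ler_sqrt//; apply: le_trans (hS n X).
  rewrite /h (bigD1 i)//=; apply: ler_wpDr; first by apply: sumr_ge0 => j _; exact: sqr_ge0.
  by rewrite exprMn real_normK ?num_real// mulrC -exprMn.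
have -> : sqint (fun X => Num.sqrt (S X)) = (\int[mu]_X (S X)%:E)%E.
  by apply: eq_integral => X _; rewrite sqr_sqrtr.
have -> : (envelope_const #|I| x * c) ^+ 2 = E * c ^+ 2.
  by rewrite exprMn sqr_sqrtr.
apply: (@fatou_le _ _ R mu (fun N X => (\sum_(n < N) h n X)%:E) (fun X => (S X)%:E)).
- by move=> N; apply/measurable_EFinP; apply: measurable_sum => n; exact: mh.
- by move=> N X; rewrite lee_fin sumr_ge0.
- by move=> X; apply: cvg_EFin; [exact: nearW|exact: (Sh X).1].
move=> N.
have hI n : (\int[mu]_X (h n X)%:E <= (#|I|%:R * (1 - x)^-1 ^+ 4 * c ^+ 2 * (x ^+ 2) ^+ n)%:E)%E.
  have -> : (\int[mu]_X (h n X)%:E = \int[mu]_X \sum_(i : I) ((W n * g i n X) ^+ 2)%:E)%E.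
    by apply: eq_integral => X _; rewrite sumEFin.
  rewrite ge0_integral_sum//; last 2 first.
  - by move=> i; apply: measurable_sqr; exact: measurable_funM.
  - by move=> i X _; rewrite lee_fin sqr_ge0.
  apply: (@le_trans _ _ (\sum_(i : I) ((1 - x)^-1 ^+ 4 * c ^+ 2 * (x ^+ 2) ^+ n)%:E)%E).
    apply: lee_sum => i _; have := sqintZ (W n) (mg i n); rewrite /sqint => ->.
    have p0 : (0 <= ((W n) ^+ 2)%:E)%E by rewrite lee_fin sqr_ge0.
    apply: le_trans (lee_wpmul2l p0 (g_sqint i n)) _.
    rewrite -EFinM lee_fin; apply: le_trans _ (_ : (1 - x)^-1 ^+ 4 * (x ^+ 2) ^+ n * c ^+ 2 <= _); last first.
      by apply: le_of_eq; ring.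
    apply: le_trans (ler_wpM2r (sqr_ge0 c) (WE n)).
    by apply: le_of_eq; rewrite !exprMn; ring.
  rewrite sumEFin lee_fin sumr_const -[leLHS]mulr_natl.
  by apply: le_of_eq; ring.
have -> : (\int[mu]_X (\sum_(n < N) h n X)%:E = \sum_(n < N) \int[mu]_X (h n X)%:E)%E.
  rewrite -ge0_integral_sum//.
  - by apply: eq_integral => X _; rewrite sumEFin.
  - by move=> n; apply/measurable_EFinP; exact: mh.
  - by move=> n X _; rewrite lee_fin.
apply: (@le_trans _ _ (\sum_(n < N) (#|I|%:R * (1 - x)^-1 ^+ 4 * c ^+ 2 * (x ^+ 2) ^+ n)%:E)%E).
  by apply: lee_sum => n _; exact: hI.
rewrite sumEFin lee_fin -mulr_sumr.
have G : \sum_(n < N) (x ^+ 2) ^+ n <= (1 - x ^+ 2)^-1.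
  have -> : \sum_(i < N) (x ^+ 2) ^+ i = (1 - (x ^+ 2) ^+ N) / (1 - x ^+ 2).
    move: (x ^+ 2) d2 => z d2'; elim: N => [|N IH]; first by rewrite big_ord0 expr0 subrr mul0r.
    by rewrite big_ord_recr/= IH exprS; field; rewrite gt_eqF.
  by rewrite ler_piMl ?invr_ge0 ?(ltW d2)// gerBl exprn_ge0// ltW.
apply: le_trans (ler_wpM2l _ G) _.
  by rewrite mulr_ge0 ?sqr_ge0// mulr_ge0// exprn_ge0// invr_ge0 ltW.
by apply: le_of_eq; rewrite /E; ring.
Qed.

End Envelope.
End GevreyTowers.

(** * The Whitham system *)

Section WhithamSystem.
Context {R : realType}.
Local Notation mu := (@lebesgue_measure R).
Variables (gamma1 gamma2 alpha : R).

Definition coupling (j l : bool) : R :=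
  2 * (if j then if l then gamma2 else alpha else if l then alpha else gamma1).

(** The positions of r_j and v_j in the vector (r_1, v_1, r_2, v_2); [false] is the first phase and
    [true] the second. *)
Definition ir (j : bool) : 'I_4 := inord (if j then 2 else 0).
Definition iv (j : bool) : 'I_4 := inord (if j then 3 else 1).

Lemma ord4E (i : 'I_4) : (exists j, i = ir j) \/ (exists j, i = iv j).
Proof.
have H k : (k < 4)%N -> i = k :> nat -> i = inord k.
  by move=> k4 ik; apply: val_inj; rewrite /= inordK.
case: i H => -[|[|[|[|//]]]] i4 H; [left; exists false|right; exists false|left; exists true|right; exists true];
  exact: H.
Qed.

Lemma mul_whitham_matrix (p d : 'cV[R]_4) i :
  (whitham_matrix gamma1 gamma2 alpha p *m d) i 0 =
  \sum_(k < 4) whitham_matrix gamma1 gamma2 alpha p i k * d k 0.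
Proof. by rewrite mxE. Qed.

Lemma sum_ord4 (F : 'I_4 -> R) :
  \sum_(k < 4) F k = F (ir false) + F (iv false) + F (ir true) + F (iv true).
Proof.
rewrite !big_ord_recl big_ord0 addr0 !addrA.
by congr (F _ + F _ + F _ + F _); apply: val_inj; rewrite /= inordK.
Qed.

Lemma whitham_matrix_ir (p d : 'cV[R]_4) j :
  (whitham_matrix gamma1 gamma2 alpha p *m d) (ir j) 0 =
  - 2 * (p (iv j) 0 * d (ir j) 0) - d (iv j) 0.
Proof.
rewrite mul_whitham_matrix sum_ord4 !mxE.
by case: j; rewrite /ir /iv !inordK//=; ring.
Qed.

Lemma whitham_matrix_iv (p d : 'cV[R]_4) j :
  (whitham_matrix gamma1 gamma2 alpha p *m d) (iv j) 0 =
  coupling j false * (expR (2 * p (ir false) 0) * d (ir false) 0) +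
  coupling j true * (expR (2 * p (ir true) 0) * d (ir true) 0) - 2 * (p (iv j) 0 * d (iv j) 0).
Proof.
rewrite mul_whitham_matrix sum_ord4 !mxE.
by case: j; rewrite /coupling /ir /iv !inordK//=; ring.
Qed.

Lemma tower_solution_mono A T0 (M M' q : R) rt vt : 0 <= q -> M <= M' ->
  tower_solution A T0 M q rt vt -> tower_solution A T0 M' q rt vt.
Proof.
move=> q0 MM [tt bb dr dv]; split => // j T n X HT; have [h1 h2] := bb j T n X HT.
by split; [apply: le_trans h1 _|apply: le_trans h2 _]; rewrite ler_wpM2r ?exprn_ge0.
Qed.

(** * Taylor towers of an arbitrary solution *)

Section SolutionTowers.
Variables (s sigma T0 : R) (u0 : R -> 'cV[R]_4) (w : R -> R -> 'cV[R]_4).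
Hypotheses (s0 : 0 < s) (sigma0 : 0 < sigma) (T00 : 0 <= T0).
Hypothesis Hw : whitham_solution gamma1 gamma2 alpha s sigma T0 u0 w.

Let q := (sigma / 2)^-1.
Let k := inverse_const (sigma / 2) sigma.

Let q0 : 0 <= q. Proof. by rewrite invr_ge0 divr_ge0// ltW. Qed.
Let k0 : 0 <= k.
Proof. by rewrite divr_ge0// addr_ge0// invr_ge0 subr_ge0 ler_pdivrMr// ler_pMr// ler1n. Qed.

Definition entry_bound M T := forall i, exists f : nat -> R -> R,
  [/\ tower f, forall x, w T x i 0 = f 0%N x & forall n x, `|f n x| <= M * q ^+ n].

Lemma entry_continuous T i : 0 <= T <= T0 -> continuous (fun x => w T x i 0).
Proof.
move=> HT x; have [_ /(_ T x) + _] := Hw; rewrite in_itv => /(_ HT) [/derivable_mxP d _].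
by apply: differentiable_continuous; apply/derivable1_diffP; exact: d.
Qed.

(** [ft_tower] gives an analytic representative almost everywhere; continuity makes the equality
    hold at every point. Half of the radius is given up for pointwise bounds. *)
Lemma gevrey_entry (u : R -> 'cV[R]_4) (c : R) i : 0 < c -> gevrey s sigma u -> (gevrey_norm s sigma u <= c%:E)%E ->
  continuous (fun x => u x i 0) -> exists f : nat -> R -> R,
  [/\ tower f, forall x, u x i 0 = f 0%N x & forall n x, `|f n x| <= k * c * q ^+ n].
Proof.
move=> c0 gu Nu cu.
have [a [b [fab ab]]] := gevrey_ft i (ltW sigma0) (ltW c0) gu Nu.
have rs : 0 < sigma / 2 < sigma by rewrite divr_gt0//= ltr_pdivrMr// ltr_pMr// ltr1n.
have [f [tf fE fb _]] := ft_tower rs c0 fab ab.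
exists f; split => //; apply: continuous_ae_eq => //; exact: tower_continuous.
Qed.

Lemma entry_bound_ex T : 0 <= T <= T0 -> exists M, entry_bound M T.
Proof.
move=> HT; have [+ _ _] := Hw => /(_ T); rewrite in_itv => /(_ HT) [gw _].
have [_ Nw] := gw.
have N0 : (0 <= gevrey_norm s sigma (w T))%E by exact: Lnorm_ge0.
pose c := fine (gevrey_norm s sigma (w T)) + 1.
have c0 : 0 < c by rewrite ltr_wpDl// fine_ge0.
exists (k * c) => i; apply: gevrey_entry => //; last exact: entry_continuous.
by rewrite /c EFinD fineK ?ge0_fin_numE// leeDl.
Qed.

(** By continuity in time the solution stays within Gevrey distance 1 of its value at T. The
    difference then has a tower bounded by k q^n, which is added to the tower at T. *)
Lemma entry_bound_near T : 0 <= T <= T0 -> exists M, \forall T' \near T, T' \in `[0, T0] -> entry_bound M T'.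
Proof.
move=> HT; have [M HM] := entry_bound_ex HT.
have [Hg _ _] := Hw; have := Hg T; rewrite in_itv => /(_ HT) [[FT _] cT].
exists (M + k).
have near1 : \forall T' \near T, T' \in `[0, T0] -> (gevrey_norm s sigma (w T' \- w T)%R <= 1%:E)%E.
  have FF : Filter (within `[0, T0]%classic (nbhs T)) by exact: within_filter.
  have := (Lnorm2_cvg0 FF (fun T' xi => gevrey_weight s sigma xi * fourier_modulus (w T' \- w T)%R xi)).1 cT 1 ltr01.
  rewrite near_withinE; apply: filterS => T' H HT'.
  by rewrite gevrey_norm_sqint// expr1n; exact: H.
apply: filterS near1 => T' H1 HT'; have N1 := H1 HT'.
have HT'' : 0 <= T' <= T0 by move: HT'; rewrite in_itv.
move=> i; have [f [tf fE fb]] := HM i.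
(* Finiteness of the norm is not enough: a transform of the difference must exist, as otherwise
   [fourier] is a default value. It is the difference of the two transforms. *)
have gd : gevrey s sigma (w T' \- w T)%R.
  split; last by apply: le_lt_trans N1 _; rewrite ltry.
  move=> l; have [g1 /is_fourierP F1] := FT l.
  have := Hg T'; rewrite in_itv => /(_ HT'') [[/(_ l) [g2 /is_fourierP F2] _] _].
  have F := ftB F2 F1.
  eexists (fun xi => ((complex.Re (g2 xi) - complex.Re (g1 xi)) +i* (complex.Im (g2 xi) - complex.Im (g1 xi)))%C).
  apply/is_fourierP => /=.
  have -> : component (w T' \- w T)%R l = (fun x => component (w T') l x - component (w T) l x).
    by apply/funext => x; rewrite /component !mxE.
  have -> : (fun xi => - (complex.Im (g2 xi) - complex.Im (g1 xi))) =
      (fun xi => - complex.Im (g2 xi) - - complex.Im (g1 xi)) by apply/funext => xi; ring.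
  exact: F.
have cd : continuous (fun x => (w T' \- w T)%R x i 0).
  move=> x; have -> : (fun x => (w T' \- w T)%R x i 0) = (fun x => w T' x i 0 - w T x i 0).
    by apply/funext => y; rewrite !mxE.
  by apply: cvgB; exact: entry_continuous.
have [d [td dE db]] := gevrey_entry ltr01 gd N1 cd.
exists (fun n x => f n x + d n x); split.
- exact: towerD.
- by move=> x; rewrite -fE -dE !mxE [RHS]addrC subrK.
- move=> n x; rewrite mulrDl; apply: le_trans (ler_normD _ _) _; apply: lerD => //.
  by have := db n x; rewrite mulr1.
Qed.

Lemma entry_bound_mono M M' T : M <= M' -> entry_bound M T -> entry_bound M' T.
Proof.
move=> MM H i; have [f [tf fE fb]] := H i; exists f; split => // n x.
by apply: le_trans (fb n x) _; rewrite ler_wpM2r ?exprn_ge0.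
Qed.

(** Compactness of [0, T0], with the bound M as a parameter tending to infinity: local bounds at
    each time become one bound for all times. *)
Lemma entry_bound_uniform : exists M, forall T, 0 <= T <= T0 -> entry_bound M T.
Proof.
have H := (compact_near_coveringP _).1 (@segment_compact R 0 T0) R (+oo)
  (fun M T => T \in `[0, T0] -> entry_bound M T) _.
have : \forall M \near +oo, `[0, T0] `<=` (fun T => T \in `[0, T0] -> entry_bound M T).
  apply: H => T; rewrite /= in_itv/= => /entry_bound_near [M HM].
  exists ([set T' | T' \in `[0, T0] -> entry_bound M T'], [set M' | M <= M']) => /=.
    by split; [exact: HM|exact: (nbhs_pinfty_ge (num_real M))].
  by move=> [T' M'] /= [h1 h2] HT'; apply: (entry_bound_mono h2); exact: h1.
move=> /filter_ex [M HM]; exists M => T HT; apply: HM; by rewrite /= in_itv.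
Qed.

Lemma solution_towers : exists M rt vt, tower_solution coupling T0 M q rt vt /\
  forall j T X, 0 <= T <= T0 -> w T X (ir j) 0 = rt j T 0%N X /\ w T X (iv j) 0 = vt j T 0%N X.
Proof.
have [M HM] := entry_bound_uniform.
(* The property is conditional on the time, so that a tower can be chosen for every real T; outside
   [0, T0] the zero function is taken. *)
pose Pr (p : 'I_4 * R) (f : nat -> R -> R) := 0 <= p.2 <= T0 ->
  [/\ tower f, forall x, w p.2 x p.1 0 = f 0%N x & forall n x, `|f n x| <= M * q ^+ n].
have [F HF] : {F & forall p, Pr p (F p)}.
  apply: choice => -[i T]; rewrite /Pr /=.
  have [HT|HT] := boolP (0 <= T <= T0); last by exists (fun _ _ => 0).
  by have [f Hf] := HM T HT i; exists f.
have tF i T : 0 <= T <= T0 -> tower (F (i, T)) by move=> HT; have [] := HF (i, T) HT.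
have FE i T x : 0 <= T <= T0 -> w T x i 0 = F (i, T) 0%N x by move=> HT; have [] := HF (i, T) HT.
have Fb i T n x : 0 <= T <= T0 -> `|F (i, T) n x| <= M * q ^+ n by move=> HT; have [] := HF (i, T) HT.
have D i T X : 0 <= T <= T0 -> ('D_1 (w T) X) i 0 = F (i, T) 1%N X.
  move=> HT; have [_ /(_ T X) + _] := Hw; rewrite in_itv => /(_ HT) [d _].
  rewrite derive_mx// mxE; have -> : (fun t => w T t i 0) = F (i, T) 0%N by apply/funext => x; exact: FE.
  by rewrite (@derive_val _ _ _ _ _ _ _ (tF i T HT 0%N X)) mul1r.
have Hd i X : dsol T0 (fun T => F (i, T) 0%N X)
    (fun T => (whitham_matrix gamma1 gamma2 alpha (w T X) *m 'D_1 (w T) X) i 0).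
  apply: (@dsol_ext R T0 (fun T => w T X i 0) (fun T => (whitham_matrix gamma1 gamma2 alpha (w T X) *m 'D_1 (w T) X) i 0)) => //.
    by move=> T HT; exact: FE.
  apply: quotient_dsol => T HT; have [_ /(_ T X) + _] := Hw; rewrite in_itv => /(_ HT) [_ /mx_cvgP /(_ i 0)].
  by under eq_fun do rewrite !mxE.
exists M, (fun j T => F (ir j, T)), (fun j T => F (iv j, T)); split; last first.
  by move=> j T X HT; split; exact: FE.
have inT T : 0 < T < T0 -> 0 <= T <= T0 by move=> /andP[/ltW -> /ltW ->].
split.
- by move=> j T HT; split; exact: tF.
- by move=> j T n X HT; split; exact: Fb.
- move=> j X; apply: dsol_ext (Hd (ir j) X) => // T /inT HT.
  by rewrite whitham_matrix_ir !D// FE.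
- move=> j X; apply: dsol_ext (Hd (iv j) X) => // T /inT HT.
  by rewrite whitham_matrix_iv !D// !FE.
Qed.

End SolutionTowers.

(** Both solutions agree with u0 almost everywhere at time 0, hence with each other everywhere by
    continuity. The larger of their two bounds puts them into a common class for
    [tower_solution_unique]. *)
Lemma whitham_solution_unique (s sigma T0 : R) u0 u w : 0 < sigma -> 0 <= T0 ->
  whitham_solution gamma1 gamma2 alpha s sigma T0 u0 u ->
  whitham_solution gamma1 gamma2 alpha s sigma T0 u0 w ->
  forall T X : R, T \in `[0, T0] -> w T X = u T X.
Proof.
move=> sg T00 Hu Hw T X; rewrite in_itv/= => HT.
have [M [rt [vt [St Et]]]] := solution_towers sg Hu.
have [M' [rt' [vt' [St' Et']]]] := solution_towers sg Hw.
have q0 : 0 < (sigma / 2)^-1 by rewrite invr_gt0 divr_gt0.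
have S1 := tower_solution_mono (ltW q0) (_ : M <= Num.max M M') St.
have S2 := tower_solution_mono (ltW q0) (_ : M' <= Num.max M M') St'.
have Z0 : 0 <= (0 : R) <= T0 by rewrite lexx.
have I0 i Y : u 0 Y i 0 = w 0 Y i 0.
  apply: (@continuous_ae_eq R (fun Y => u 0 Y i 0) (fun Y => w 0 Y i 0) _ _ _ Y); [exact: (entry_continuous Hu)|exact: (entry_continuous Hw)|].
  have [_ _ Iu] := Hu; have [_ _ Iw] := Hw.
  by apply: (@filterS2 _ _ (ae_filter_ringOfSetsType mu)) Iu Iw => Z -> ->.
have U := @tower_solution_unique R coupling T0 (Num.max M M') _ q0 rt vt rt' vt'
  (S1 (ltac:(by rewrite le_max lexx))) (S2 (ltac:(by rewrite le_max lexx orbT))).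
apply/matrixP => i j; rewrite ord1 {j}.
have H j : rt j T 0%N X = rt' j T 0%N X /\ vt j T 0%N X = vt' j T 0%N X.
  apply: U => // l Y; have [<- <-] := Et l 0 Y Z0; have [<- <-] := Et' l 0 Y Z0.
  by rewrite !I0.
have [[j ->]|[j ->]] := ord4E i.
  by rewrite (Et j T X HT).1 (Et' j T X HT).1 (H j).1.
by rewrite (Et j T X HT).2 (Et' j T X HT).2 (H j).2.
Qed.

Lemma sqint_le_mul (f m : R -> R) (a b : R) : 0 <= a -> measurable_fun setT f -> measurable_fun setT m ->
  (forall x, `|f x| <= a * m x) -> (sqint m <= (b ^+ 2)%:E)%E -> (sqint f <= ((a * b) ^+ 2)%:E)%E.
Proof.
move=> a0 mf mm fm mb.
apply: (@le_trans _ _ (sqint (fun x => a * m x)%R)).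
  apply: le_sqint => //; first exact: measurable_funM.
  by move=> x; apply: le_trans (fm x) _; exact: ler_norm.
have a20 : (0 <= (a ^+ 2)%:E)%E by rewrite lee_fin sqr_ge0.
by rewrite sqintZ//; apply: le_trans (lee_wpmul2l a20 mb) _; rewrite -EFinM exprMn.
Qed.

(** * Construction of a solution *)

Section Existence.
Variables (s sigma0 : R).
Hypotheses (s1 : 1 < s) (sigma00 : 0 < sigma0).
Hypotheses (hg1 : `|gamma1| = 1) (hg2 : `|gamma2| = 1).

(* The radius of analyticity is [2 sigma0] for the datum, [rho1] for its pointwise
   Taylor bounds, [rho1 * x1 ^ 3] for the envelope and [rho] for the solution;
   [sigma0 < rho] because 7/4 (19/20)^3 (5/6) > 1. *)
Let rho1 := 7 / 4 * sigma0.
Let x1 : R := 19 / 20.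
Let q := (rho1 * x1 ^+ 3)^-1.
Let y : R := 1 / 6.
Let rho := (q / (1 - y))^-1.
Let a := 2 + 2 * `|alpha|.
Let lam := (4 * a + 8) * q.
(** The time at which the ratio lam / y times T0 of the series equals 1/16; lam itself is the least
    value allowed in [coeffs_le]. *)
Let T0 := y / (16 * lam).
Let k1 := inverse_const rho1 (2 * sigma0).
Let Env := envelope_const #|'I_4| x1.
(** The factor of [expm1_le] for amplitudes at most 1, so that D m bounds the initial r_j, v_j and
    P_j together. With C as below, the envelope satisfies D m <= 1/16, the smallness required by
    [coeffs_le]. *)
Let D := 4 * expR 64 : R.
Let C := (16 * D * (Env * k1 + 1))^-1.

Let rho10 : 0 < rho1. Proof. by rewrite /rho1 mulr_gt0. Qed.
Let q0 : 0 < q. Proof. by rewrite /q invr_gt0 mulr_gt0// exprn_gt0// /x1 divr_gt0. Qed.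
Let a0 : 0 <= a. Proof. by rewrite /a addr_ge0// mulr_ge0. Qed.
Let lam0 : 0 < lam. Proof. by rewrite /lam mulr_gt0// ltr_wpDl// mulr_ge0. Qed.
Let T00 : 0 < T0. Proof. by apply: divr_gt0; [rewrite /y divr_gt0|rewrite mulr_gt0]. Qed.
Let y01 : 0 < y < 1. Proof. by rewrite /y; apply/andP; split; lra. Qed.
Let lT : lam / y * T0 <= 16^-1.
Proof. by rewrite /T0; apply: le_of_eq; rewrite /y; field; rewrite gt_eqF. Qed.
Let k10 : 0 <= k1.
Proof. by rewrite divr_ge0// addr_ge0// invr_ge0 subr_ge0 ler_pM2r//; lra. Qed.
Let Env0 : 0 <= Env. Proof. exact: sqrtr_ge0. Qed.
Let D1 : 1 <= D.
Proof. by have := expR_ge1Dx (64 : R); rewrite /D; lra. Qed.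
Let C0 : 0 < C.
Proof.
by rewrite invr_gt0 mulr_gt0 ?mulr_gt0 ?(lt_le_trans ltr01 D1)// ltr_wpDl// mulr_ge0.
Qed.
Let CE : D * (Env * k1 * C) <= 16^-1.
Proof.
have D0 : 0 < D by exact: lt_le_trans D1.
have E0 : 0 <= Env * k1 by exact: mulr_ge0.
rewrite /C; move: (Env * k1) E0 => e e0.
have -> : D * (e * (16 * D * (e + 1))^-1) = 16^-1 * (e / (e + 1)).
  by field; rewrite !gt_eqF// ltr_wpDl.
by rewrite ler_piMr ?invr_ge0// ler_pdivrMr ?mul1r ?lerDl// ltr_wpDl.
Qed.
Let rhoE : sigma0 < rho.
Proof.
have -> : rho = (1 - 1 / 6) * (7 / 4 * (19 / 20) ^+ 3) * sigma0.
  by rewrite /rho /q /y /rho1 /x1; field; rewrite gt_eqF.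
by rewrite ltr_pMl//; lra.
Qed.

Let coupling_le j l : `|coupling j l| <= a.
Proof.
have a2 : 0 <= `|alpha| by [].
rewrite /coupling /a normrM ger0_norm//; case: j; case: l; rewrite ?hg1 ?hg2; lra.
Qed.

Section Datum.
Variable u0 : R -> 'cV[R]_4.
Hypotheses (gu0 : gevrey s (2 * sigma0) u0) (Nu0 : (gevrey_norm s (2 * sigma0) u0 <= C%:E)%E).

Lemma datum_towers : exists G : 'I_4 -> nat -> R -> R, [/\ forall i, tower (G i),
  {ae mu, forall X, forall i, u0 X i 0 = G i 0%N X},
  forall i n X, `|G i n X| <= k1 * C * rho1^-1 ^+ n &
  forall i n, (sqint (G i n) <= ((C * rho1^-1 ^+ n) ^+ 2)%:E)%E].
Proof.
pose Pr (i : 'I_4) (f : nat -> R -> R) := [/\ tower f, {ae mu, forall X, u0 X i 0 = f 0%N X},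
  forall n X, `|f n X| <= k1 * C * rho1^-1 ^+ n &
  forall n, (sqint (f n) <= ((C * rho1^-1 ^+ n) ^+ 2)%:E)%E].
have [G HG] : {G & forall i, Pr i (G i)}.
  apply: choice => i.
  have s20 : 0 <= 2 * sigma0 by rewrite mulr_ge0// ltW.
  have [a' [b' [fab ab]]] := gevrey_ft i s20 (ltW C0) gu0 Nu0.
  have rs : 0 < rho1 < 2 * sigma0 by rewrite rho10/= ltr_pM2r//; lra.
  have [f [tf fE fb fs]] := ft_tower rs C0 fab ab.
  by exists f.
exists G; split => [i||i n X|i n]; try by have [] := HG i.
apply: (@filter_forall _ _ _ _ (ae_filter_ringOfSetsType mu)) => i; by have [] := HG i.
Qed.

Lemma whitham_solution_exists : exists u, whitham_solution gamma1 gamma2 alpha s sigma0 T0 u0 u.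
Proof.
have [G [tG GE Gb Gs]] := datum_towers.
have x01 : 0 < x1 < 1 by rewrite /x1; apply/andP; split; lra.
have [m [mm mb Gm ms]] := envelope x01 rho10 (ltW C0) k10 (fun i n => tower_measurable n (tG i)) Gb Gs.
have D0 : 0 < D by exact: lt_le_trans D1.
have m0 X : 0 <= m X by have /andP[] := mb X.
have mC X : D * m X <= 16^-1.
  by apply: le_trans CE; rewrite ler_pM2l//; have /andP[] := mb X.
have m1 X : m X <= 1 by have := mC X; have := ler_wpM2r (m0 X) D1; lra.
(* P_j starts from the tower of e^{2 r_j} - 1; [solution_exp] propagates this relation, which turns
   the quadratic system back into the original one. *)
pose u00 (c : unknown) j := match c with fr => G (ir j) | fv => G (iv j) | fP => expm1 (G (ir j)) end.
have KE n : majorant lam q 0 n = majorant 0 q 0 n by rewrite /majorant !expr0.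
have tu00 c j : tower (u00 c j).
  case: c => /=; [exact: tG|exact: tG|].
  apply: (@tower_expm1 R q (G (ir j)) (ltW q0) 1) => // n X.
  by apply: le_trans (Gm _ _ _) _; rewrite ler_wpM2r ?m1// majorant_ge0// ltW.
have hu00 c j n X : `|u00 c j n X| <= D * m X * majorant lam q 0 n.
  rewrite KE; have K0 : 0 <= majorant 0 q 0 n by rewrite majorant_ge0// ltW.
  have h i : `|G i n X| <= D * m X * majorant 0 q 0 n.
    by apply: le_trans (Gm _ _ _) _; rewrite ler_wpM2r// ler_peMl.
  case: c => //=.
  have mM : 0 <= m X <= 1 by rewrite m0 m1.
  apply: le_trans (@expm1_le R q (G (ir j)) (ltW q0) (m X) 1 n X mM (fun n => Gm _ n X)) _.
  by apply: le_of_eq; rewrite mulr1 /D; ring.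
have mu0 X : 0 <= D * m X by rewrite mulr_ge0// ltW.
pose sol c j := solution coupling u00 c j.
(* Odd entries are the v_j, even ones the r_j; entries 2 and 3 belong to the second phase. *)
pose F (i : 'I_4) := sol (if odd i then fv else fr) (2 <= i)%N.
have Fr j : F (ir j) = sol fr j by rewrite /F /ir; case: j; rewrite inordK.
have Fv j : F (iv j) = sol fv j by rewrite /F /iv; case: j; rewrite inordK.
have inT t : t \in `[0, T0] -> `|t| <= T0 by rewrite in_itv/= => /andP[t0 tT]; rewrite ger0_norm.
have lamq := lexx lam.
pose muD X := D * m X.
have Fpr c j t : `|t| <= T0 -> tower (sol c j t) := @solution_tower R coupling u00 lam q a T0 y muD
  q0 lamq a0 coupling_le mu0 mC hu00 tu00 y01 T00 lT c j t.
have Flepr c j n X t : `|t| <= T0 -> `|sol c j t n X| <= 2 * muD X * (q / (1 - y)) ^+ n :=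
  @solution_le R coupling u00 lam q a T0 y muD q0 lamq a0 coupling_le mu0 mC hu00 y01 T00 lT c j n X t.
have Flip c j n X t t' : `|t| <= T0 -> `|t'| <= T0 ->
   `|sol c j t n X - sol c j t' n X| <= 2 / T0 * muD X * (q / (1 - y)) ^+ n * `|t - t'| :=
  @solution_lipschitz R coupling u00 lam q a T0 y muD q0 lamq a0 coupling_le mu0 mC hu00 y01 T00 lT c j n X t t'.
have F0 c j n X : sol c j 0 n X = u00 c j n X :=
  @solution0 R coupling u00 lam q a T0 y muD q0 lamq a0 coupling_le mu0 mC hu00 y01 T00 lT c j n X.
have dr X t (tT : `|t| <= T0) j :=
  @solution_derive_fr R coupling u00 lam q a T0 y muD q0 lamq a0 coupling_le mu0 mC hu00 y01 T00 lT X t tT j.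
have dv X t (tT : `|t| <= T0) j :=
  @solution_derive_fv R coupling u00 lam q a T0 y muD q0 lamq a0 coupling_le mu0 mC hu00 y01 T00 lT X t tT j.
have Fexp j X t : 0 <= t <= T0 -> 1 + sol fP j t 0%N X = expR (2 * sol fr j t 0%N X).
  move=> tT; apply: (@solution_exp R coupling u00 lam q a T0 y muD q0 lamq a0 coupling_le mu0 mC hu00 y01 T00 lT) => //.
  by apply: (@expm10 R q (G (ir j)) (ltW q0) (m X)) => n; exact: Gm.
pose u t X : 'cV[R]_4 := \col_i F i t 0%N X.
have rE : q / (1 - y) = rho^-1 by rewrite /rho invrK.
have [K K0 HK] := @gevrey_tower R s (lt_trans ltr01 s1) 4 sigma0 rho (ltac:(by rewrite sigma00)).
have rho_ge0 n : 0 <= rho^-1 ^+ n by rewrite exprn_ge0// invr_ge0 ltW// (lt_trans sigma00 rhoE).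
(* The pointwise bounds are linear in the envelope m, whose L^2 norm is at most Env C; integration
   gives L^2 bounds of radius rho. *)
have sqF i n t : `|t| <= T0 -> (sqint (F i t n) <= ((2 * D * (Env * C) * rho^-1 ^+ n) ^+ 2)%:E)%E.
  move=> tT; have := @sqint_le_mul (F i t n) m (2 * D * rho^-1 ^+ n) (Env * C).
  have -> : 2 * D * (Env * C) * rho^-1 ^+ n = 2 * D * rho^-1 ^+ n * (Env * C) by ring.
  apply => //.
  - by apply: mulr_ge0 => //; apply: mulr_ge0 => //; exact: ltW.
  - exact: tower_measurable (Fpr _ _ _ tT).
  - move=> X; rewrite -rE; apply: le_trans (Flepr _ _ _ _ _ tT) _.
    by apply: le_of_eq; rewrite /muD; ring.
have sqD i n t t' : `|t| <= T0 -> `|t'| <= T0 ->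
    (sqint (fun X => F i t n X - F i t' n X)%R <= ((2 / T0 * D * (Env * C) * `|t - t'| * rho^-1 ^+ n) ^+ 2)%:E)%E.
  move=> tT tT'; have := @sqint_le_mul (fun X => F i t n X - F i t' n X) m (2 / T0 * D * `|t - t'| * rho^-1 ^+ n) (Env * C).
  have -> : 2 / T0 * D * (Env * C) * `|t - t'| * rho^-1 ^+ n = 2 / T0 * D * `|t - t'| * rho^-1 ^+ n * (Env * C) by ring.
  apply => //.
  - apply: mulr_ge0 => //; apply: mulr_ge0 => //; apply: mulr_ge0; last exact: ltW.
    by apply: divr_ge0 => //; exact: ltW.
  - by apply: measurable_funB; apply: tower_measurable; exact: Fpr.
  - move=> X; rewrite -rE; apply: le_trans (Flip _ _ _ _ _ _ tT tT') _.
    by apply: le_of_eq; rewrite /muD; ring.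
have DEC : 0 <= D * (Env * C).
  by apply: mulr_ge0; [exact: ltW|apply: mulr_ge0 => //; exact: ltW].
have gu t : `|t| <= T0 -> gevrey s sigma0 (u t).
  move=> tT; have [|i|i x|i n|gut _] := HK (u t) (fun i => F i t) (2 * D * (Env * C)).
  - by rewrite -mulrA; apply: mulr_ge0.
  - exact: Fpr.
  - by rewrite /component mxE.
  - exact: sqF.
  - exact: gut.
have gd t t' : `|t| <= T0 -> `|t'| <= T0 ->
    (gevrey_norm s sigma0 (u t \- u t')%R <= (K * (2 / T0 * (D * (Env * C)) * `|t - t'|))%:E)%E.
  move=> tT tT'.
  have [|i|i x|i n|_ gut] := HK (u t \- u t')%R (fun i n X => F i t n X - F i t' n X) (2 / T0 * (D * (Env * C)) * `|t - t'|).
  - apply: mulr_ge0 => //; apply: mulr_ge0 => //.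
    by apply: divr_ge0 => //; exact: ltW.
  - by apply: towerB; exact: Fpr.
  - by rewrite /component !mxE.
  - by have := sqD i n t t' tT tT'; rewrite !mulrA.
  - exact: gut.
exists u; split.
- move=> t tT; split; first by apply: gu; exact: inT.
  (* The Gevrey norm of the increment is at most a constant times |t' - t|. *)
  apply: (@squeeze_cvge _ _ _ _ (cst 0%E) _ (fun t' => (K * (2 / T0 * (D * (Env * C)) * `|t' - t|))%:E)).
  + near=> t'.
    rewrite Lnorm_ge0/=; apply: gd; last exact: inT.
    by apply: inT; near: t'; exact: withinT.
  + exact: cvg_cst.
  + apply/cvg_EFin; first by near=> t'.
    apply: cvg_within_filter.
    have ct : (fun t' : R => K * (2 / T0 * (D * (Env * C)) * `|t' - t|)) @ t -->
        K * (2 / T0 * (D * (Env * C)) * `|t - t|).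
      by apply: cvgM; [exact: cvg_cst|]; apply: cvgM; [exact: cvg_cst|];
         apply: cvg_norm; apply: cvgB; [exact: cvg_id|exact: cvg_cst].
    by rewrite subrr normr0 !mulr0 in ct; exact: ct.
- move=> t X tT; have tT' := inT t tT.
  have dF i : is_derive X 1 (fun x => F i t 0%N x) (F i t 1%N X).
    by rewrite -[F i t 1%N X]mul1r; exact: (Fpr _ _ _ tT' 0%N X).
  have du : derivable (u t) X 1.
    apply/derivable_mxP => i j; rewrite ord1.
    have -> : (fun x => u t x i 0) = (fun x => F i t 0%N x) by apply/funext => x; rewrite mxE.
    exact: ider_derivable (dF i).
  have Du i : ('D_1 (u t) X) i 0 = F i t 1%N X.
    rewrite derive_mx// mxE.
    have -> : (fun x => u t x i 0) = (fun x => F i t 0%N x) by apply/funext => x; rewrite mxE.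
    exact: (@derive_val _ _ _ _ _ _ _ (dF i)).
  split => //; apply/mx_cvgP => i j; rewrite ord1 {j}.
  have -> : (fun t' => ((t' - t)^-1 *: (u t' X - u t X)) i 0) =
      (fun t' => (t' - t)^-1 * (F i t' 0%N X - F i t 0%N X)) by apply/funext => t'; rewrite !mxE.
  (* The two-sided derivative exists at every t in [0, T0], ends included, and yields the one-sided
     quotients of the statement. *)
  suff DF : is_derive t 1 (fun t' => F i t' 0%N X)
      ((whitham_matrix gamma1 gamma2 alpha (u t X) *m 'D_1 (u t) X) i 0).
    have DQ := derive_quotient T0 DF.
    exact: DQ.
  have [[j ->]|[j ->]] := ord4E i.
  + rewrite whitham_matrix_ir !Du !mxE !Fr Fv; exact: dr.
  + rewrite whitham_matrix_iv !Du !mxE !Fr Fv.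
    have tT2 : 0 <= t <= T0 by move: tT; rewrite in_itv.
    rewrite -(Fexp false X t tT2) -(Fexp true X t tT2).
    have dvt := dv X t tT' j.
    exact: dvt.
- apply: (@filterS _ _ (ae_filter_ringOfSetsType mu)) GE => X HX; apply/matrixP => i j.
  rewrite ord1 mxE HX; have [[l ->]|[l ->]] := ord4E i; by rewrite ?Fr ?Fv F0.
Unshelve. all: by end_near. Qed.

End Datum.

Lemma whitham_existence : exists T0 C : R, 0 < T0 /\ 0 < C /\
  forall u0, gevrey s (2 * sigma0) u0 -> (gevrey_norm s (2 * sigma0) u0 <= C%:E)%E ->
    exists u, whitham_solution gamma1 gamma2 alpha s sigma0 T0 u0 u.
Proof. by exists T0, C; split; [exact: T00|split; [exact: C0|exact: whitham_solution_exists]]. Qed.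

End Existence.
End WhithamSystem.

Theorem theorem3p3 (R : realType) (gamma1 gamma2 alpha s sigma0 : R)
  (hgamma1 : gamma1 = -1 \/ gamma1 = 1)
  (hgamma2 : gamma2 = -1 \/ gamma2 = 1)
  (halpha : alpha != 0)
  (hdet : gamma1 * gamma2 - alpha ^+ 2 != 0)
  (hs : 1 < s) (hsigma0 : 0 < sigma0) :
  exists T0 C : R, 0 < T0 /\ 0 < C /\
    forall u0 : R -> 'cV[R]_4,
      gevrey s (2 * sigma0) u0 ->
      (gevrey_norm s (2 * sigma0) u0 <= C%:E)%E ->
      exists u : R -> R -> 'cV[R]_4,
        whitham_solution gamma1 gamma2 alpha s sigma0 T0 u0 u /\
        forall w : R -> R -> 'cV[R]_4,
          whitham_solution gamma1 gamma2 alpha s sigma0 T0 u0 w ->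
          forall T X : R, T \in `[0, T0] -> w T X = u T X.
Proof.
have abs1 (g : R) : g = -1 \/ g = 1 -> `|g| = 1 by case=> ->; rewrite ?normrN1 ?normr1.
have [T0 [C [T00 [C0 HE]]]] :=
  whitham_existence alpha hs hsigma0 (abs1 _ hgamma1) (abs1 _ hgamma2).
exists T0, C; split => //; split => // u0 gu0 Nu0.
have [u Hu] := HE u0 gu0 Nu0; exists u; split => // w Hw T X HT.
exact: whitham_solution_unique hsigma0 (ltW T00) Hu Hw T X HT.
Qed.
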